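(* Let $Q$ be a non-degenerate isotropic quadratic form in $3$ variables over $K_\nu$ and let $H_Q=\{g\in G: Q\circ g=Q\}$. If $x\in G/\Gamma$ is such that the closure $\overline{H_Qx}$ is compact, then $H_Qx=\overline{H_Qx}$ (i.e. the orbit $H_Qx$ is closed, hence compact).
   Context: $K$ is a global function field of characteristic $\mathfrak{p}\neq 2$, $\nu$ a place of $K$, $K_\nu\cong\mathbb{F}_{\mathfrak{q}}((\theta^{-1}))$ the completion, $\mathcal{O}_\nu$ the ring of $\nu$-integers of $K$ (elements of $K$ integral at all places other than $\nu$). $G=\mathrm{SL}_3(K_\nu)$, $\Gamma=\mathrm{SL}_3(\mathcal{O}_\nu)$, and $G/\Gamma$ carries the quotient topology (it is identified with the space of free $\mathcal{O}_\nu$-modules of determinant one in $K_\nu^3$). *)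

(* Defs.v *)
From HB Require Import structures.
From mathcomp Require Import all_boot all_order all_algebra.
Set Implicit Arguments. Unset Strict Implicit. Unset Printing Implicit Defensive.
Import Order.TTheory GRing.Theory Num.Theory.
Local Open Scope ring_scope.

(* "x has valuation >= n", with the convention v(0) = +oo *)
Definition ge_val (F : fieldType) (v : F -> int) (x : F) (n : int) : Prop :=
  x = 0 \/ n <= v x.

(* normalized discrete valuation (values on nonzero elements only) *)
Definition is_dval (F : fieldType) (v : F -> int) : Prop :=
  [/\ (forall x y, x != 0 -> y != 0 -> v (x * y) = v x + v y),
      (forall x y, x != 0 -> y != 0 -> x + y != 0 ->
                   Num.min (v x) (v y) <= v (x + y))
    & exists x, x != 0 /\ v x = 1].

Definition same_place (F : fieldType) (v w : F -> int) : Prop :=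
  forall x, x != 0 -> v x = w x.

(* evaluation at t of an integer polynomial, coefficients read in the prime field *)
Definition evalt (K : fieldType) (P : {poly int}) (t : K) : K :=
  (map_poly (fun z : int => z%:~R : K) P).[t].

(* K is a global function field of characteristic p: K contains an element t
   transcendental over the prime field F_p and K is a finite extension of F_p(t) *)
Definition global_function_field (K : fieldType) (p : nat) : Prop :=
  [/\ prime p, (p%:R : K) = 0 &
   exists t : K,
     (forall P : {poly int}, evalt P t = 0 -> map_poly (fun z : int => z%:~R : K) P = 0)
     /\ exists (n : nat) (e : 'I_n -> K), forall x : K,
          exists a b : 'I_n -> {poly int},
            (forall i, evalt (b i) t != 0) /\
            x = \sum_(i < n) (evalt (a i) t / evalt (b i) t) * e i].

Definition nu_integers (K : fieldType) (v : K -> int) (a : K) : Prop :=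
  forall w : K -> int, is_dval w -> ~ same_place w v -> ge_val w a 0.

Definition is_completion (K Kv : fieldType) (v : K -> int) (wv : Kv -> int)
    (iota : {rmorphism K -> Kv}) : Prop :=
  [/\ is_dval wv,
      (forall x, x != 0 -> wv (iota x) = v x),
      (forall (y : Kv) (n : int), exists x : K, ge_val wv (y - iota x) n) &
      forall u : nat -> Kv,
        (forall n : int, exists N, forall m k, (N <= m)%N -> (N <= k)%N ->
             ge_val wv (u m - u k) n) ->
        exists l, forall n : int, exists N, forall m, (N <= m)%N ->
             ge_val wv (u m - l) n].

Definition Gamma (K Kv : fieldType) (v : K -> int) (iota : {rmorphism K -> Kv})
    (g : 'M[Kv]_3) : Prop :=
  \det g = 1 /\ forall i j, exists a, nu_integers v a /\ g i j = iota a.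

Definition coset (K Kv : fieldType) (v : K -> int) (iota : {rmorphism K -> Kv})
    (g : 'M[Kv]_3) : 'M[Kv]_3 -> Prop :=
  fun h => exists c, Gamma v iota c /\ h = g *m c.

Definition GmodGamma (K Kv : fieldType) (v : K -> int) (iota : {rmorphism K -> Kv}) :=
  {A : 'M[Kv]_3 -> Prop | exists g, \det g = 1 /\ A = coset v iota g}.

Definition openG (Kv : fieldType) (wv : Kv -> int) (U : 'M[Kv]_3 -> Prop) : Prop :=
  (forall g, U g -> \det g = 1) /\
  forall g, U g -> exists n : int, forall h, \det h = 1 ->
     (forall i j, ge_val wv (h i j - g i j) n) -> U h.

Section Quotient.
Variables (K Kv : fieldType) (v : K -> int) (wv : Kv -> int) (iota : {rmorphism K -> Kv}).
Local Notation X := (GmodGamma v iota).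

(* quotient topology: S open iff its preimage under G -> G/Gamma is open *)
Definition openX (S : X -> Prop) : Prop :=
  openG wv (fun g => \det g = 1 /\ exists y : X, S y /\ proj1_sig y g).

Definition closureX (S : X -> Prop) : X -> Prop :=
  fun y => forall U, openX U -> U y -> exists z, U z /\ S z.

Definition compactX (C : X -> Prop) : Prop :=
  forall (I : Type) (U : I -> X -> Prop), (forall i, openX (U i)) ->
    (forall y, C y -> exists i, U i y) ->
    exists (n : nat) (f : nat -> I), forall y, C y -> exists k, (k < n)%N /\ U (f k) y.

Definition orbitX (H : 'M[Kv]_3 -> Prop) (x : X) : X -> Prop :=
  fun y => exists h g, H h /\ proj1_sig x g /\ proj1_sig y (h *m g).
End Quotient.

Definition qf (F : fieldType) (A : 'M[F]_3) (z : 'cV[F]_3) : F := (z^T *m A *m z) 0 0.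

Definition isotropic (F : fieldType) (A : 'M[F]_3) : Prop :=
  exists z : 'cV[F]_3, z != 0 /\ qf A z = 0.

Definition H_Q (F : fieldType) (A : 'M[F]_3) (g : 'M[F]_3) : Prop :=
  \det g = 1 /\ forall z, qf A (g *m z) = qf A z.

(* Main.v *)
Require Import Defs.
From HB Require Import structures.
From mathcomp Require Import all_boot all_order all_algebra.
From mathcomp Require Import boolp classical_sets.
From mathcomp Require Import zify ring.
Set Implicit Arguments. Unset Strict Implicit. Unset Printing Implicit Defensive.
Import Order.TTheory GRing.Theory Num.Theory.
Local Open Scope ring_scope.

(** Write [k] for the completion.  After a change of variables the form is a multiple of
    [2 z0 z2 - z1^2]; its group [H] contains the unipotent group [v1 s] and the diagonal
    group [dg t], and [v2 b] is the unipotent one-parameter group commuting with [v1] that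
    does not preserve the form.  Suppose that the closure [Y] of an orbit is compact and that
    the orbit is not closed, and let [M] be a minimal closed [v1]-invariant subset of the
    closure of a second orbit contained in [Y].

    By compactness [M] contains pairs [m], [g m] with [g] close to [1] and [g] outside the
    normalizer of [v1].  Pushing such pairs along [v1] and rescaling, the third row of [g] and
    the form transported by [g] diverge polynomially, and in the limit [dg (rho s)^-1 * v2 (P s)]
    maps [M] into itself, for polynomials [rho] and [P] that are not both constant.  Since the
    orbit is not closed, the same argument applied to points of [Y] close to [M] off their
    [H]-orbit gives [f <> 0] with [v2 f] mapping [M] into [Y].  Hence [v2 (rho s ^ 2 f + P s)]
    maps [M] into [Y] for [s] in an open set; where the derivative of the exponent does not
    vanish, renormalizing by [dg] produces a whole [v2]-orbit inside [Y].  The group generated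
    by [v1], [v2] and [dg] makes some vector of any lattice arbitrarily short, which
    contradicts compactness.

    In characteristic 3 all these derivatives could vanish, when [rho = 1] and [P] is a multiple
    of [s ^ 3].  This is excluded by moving instead along [v1 s * v2 (kap s ^ 3)], with [kap]
    chosen optimally among those [b] for which every [v2 (b s ^ 3)] preserves [M]: a limit
    [P = c s ^ 3] would contradict the optimality of [kap].

    Discreteness of [Gamma] rests on the fact that a nonzero [nu]-integer has nonpositive
    valuation at [nu], i.e. that a function with a zero has a pole elsewhere.  If [a]
    has a zero at [nu], a pole is found through a subring of [K] maximal among those that
    contain [1 / a] but not [a]. *)

(** * Discrete valuations and valuation rings *)

Section DVal.
Variables (F : fieldType) (v : F -> int).
Hypothesis dv : is_dval v.
Local Notation V n x := (ge_val v x n).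

Lemma dvalM x y : x != 0 -> y != 0 -> v (x * y) = v x + v y.
Proof. by case: dv => h _ _; exact: h. Qed.

Lemma dval1 : v 1 = 0.
Proof. have := @dvalM 1 1 (oner_neq0 _) (oner_neq0 _); rewrite mulr1; lia. Qed.

Lemma dvalN x : v (- x) = v x.
Proof.
have [->|x0] := eqVneq x 0; first by rewrite oppr0.
have n1 : (-1 : F) != 0 by rewrite oppr_eq0 oner_neq0.
have h1 : v (-1) = 0.
  have := dvalM n1 n1; rewrite mulrNN mulr1 dval1; lia.
by rewrite -mulN1r dvalM // h1 add0r.
Qed.

Lemma dvalV x : x != 0 -> v x^-1 = - v x.
Proof.
move=> x0; have := @dvalM x x^-1 x0; rewrite invr_eq0 => /(_ x0).
rewrite divff // dval1; lia.
Qed.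

Lemma dvalX x n : x != 0 -> v (x ^+ n) = n%:Z * v x.
Proof.
move=> x0; elim: n => [|n IH]; first by rewrite expr0 dval1 mul0r.
by rewrite exprS dvalM ?expf_neq0 // IH; lia.
Qed.

Lemma ge_valE x n : x != 0 -> V n x <-> n <= v x.
Proof. by move=> /negPf x0; split=> [[/eqP|//]|]; [rewrite x0|right]. Qed.

Lemma ge_valD n x y : V n x -> V n y -> V n (x + y).
Proof.
have [->|x0] := eqVneq x 0; first by rewrite add0r.
have [->|y0] := eqVneq y 0; first by rewrite addr0.
have [->|xy0] := eqVneq (x + y) 0; first by left.
rewrite !ge_valE // => h1 h2; case: dv => _ /(_ _ _ x0 y0 xy0) h _.
by apply: le_trans h; rewrite le_min h1 h2.
Qed.

Lemma ge_valN n x : V n x -> V n (- x).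
Proof. by case=> [->|h]; [left; rewrite oppr0|right; rewrite dvalN]. Qed.

Lemma ge_valB n x y : V n x -> V n y -> V n (x - y).
Proof. by move=> hx hy; apply: ge_valD => //; apply: ge_valN. Qed.

Lemma ge_valM n m x y : V n x -> V m y -> V (n + m) (x * y).
Proof.
have [->|x0] := eqVneq x 0; first by rewrite mul0r; left.
have [->|y0] := eqVneq y 0; first by rewrite mulr0; left.
by rewrite !ge_valE ?mulf_neq0 // dvalM // => h1 h2; lia.
Qed.

Lemma ge_val_le n m x : n <= m -> V m x -> V n x.
Proof. by move=> h [->|h2]; [left|right; lia]. Qed.

Lemma ge_val_1 : V 0 1. Proof. by right; rewrite dval1. Qed.

Lemma ge_valMl n x y : V 0 x -> V n y -> V n (x * y).
Proof. by move=> hx hy; rewrite -[n]add0r; apply: ge_valM. Qed.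

Lemma ge_valMr n x y : V n x -> V 0 y -> V n (x * y).
Proof. by move=> hx hy; rewrite -[n]addr0; apply: ge_valM. Qed.

Lemma ge_valX n x : V 0 x -> V 0 (x ^+ n).
Proof.
move=> hx; elim: n => [|n IH]; first by rewrite expr0; exact: ge_val_1.
by rewrite exprS; apply: ge_valMl.
Qed.

Lemma ge_val_nat n : V 0 n%:R.
Proof.
elim: n => [|n IH]; first by left.
by rewrite -natr1; apply: ge_valD => //; exact: ge_val_1.
Qed.

Lemma ge_val_int (z : int) : V 0 (z%:~R).
Proof. by case: z => n; [|rewrite NegzE mulrNz; apply: ge_valN]; exact: ge_val_nat. Qed.

Lemma ge_val_sum n (I : Type) (r : seq I) (P : pred I) (f : I -> F) :
  (forall i, P i -> V n (f i)) -> V n (\sum_(i <- r | P i) f i).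
Proof. by move=> h; apply: (big_ind (fun x => V n x)) => //; [left|move=> x y; apply: ge_valD]. Qed.

Lemma ge_val_bounded x : exists n, V n x.
Proof. by exists (v x); right. Qed.

Lemma ge_val_all x : (forall n, V n x) -> x = 0.
Proof.
by move=> h; have [//|x0] := eqVneq x 0; have := h (v x + 1); rewrite ge_valE //; lia.
Qed.

End DVal.

(** * Maximal subrings and valuation rings *)

Section ValuationRing.
Variable K : fieldType.

Definition subring (R : K -> Prop) : Prop :=
  [/\ R 1, (forall x y, R x -> R y -> R (x - y)) &
      (forall x y, R x -> R y -> R (x * y))].

Section SubringTheory.
Variable R : K -> Prop.
Hypothesis sR : subring R.

Lemma subringB x y : R x -> R y -> R (x - y).
Proof. by case: sR => _ h _; exact: h. Qed.
Lemma subring1 : R 1. Proof. by case: sR. Qed.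
Lemma subringM x y : R x -> R y -> R (x * y).
Proof. by case: sR => _ _ h; exact: h. Qed.
Lemma subring0 : R 0.
Proof. by rewrite -(subrr 1); apply: subringB; exact: subring1. Qed.
Lemma subringN x : R x -> R (- x).
Proof. by move=> hx; rewrite -sub0r; apply: subringB => //; exact: subring0. Qed.
Lemma subringD x y : R x -> R y -> R (x + y).
Proof. by move=> hx hy; rewrite -(opprK y); apply: subringB => //; exact: subringN. Qed.
Lemma subringX x n : R x -> R (x ^+ n).
Proof.
move=> hx; elim: n => [|n IH]; first by rewrite expr0; exact: subring1.
by rewrite exprS; apply: subringM.
Qed.
Lemma subring_sum (I : Type) (r : seq I) (P : pred I) (f : I -> K) :
  (forall i, P i -> R (f i)) -> R (\sum_(i <- r | P i) f i).
Proof. by move=> h; apply: (big_ind R) => //; [exact: subring0|exact: subringD]. Qed.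
Lemma subring_nat n : R n%:R.
Proof.
elim: n => [|n IH]; first exact: subring0.
by rewrite -natr1; apply: subringD => //; exact: subring1.
Qed.
Lemma subring_int (z : int) : R z%:~R.
Proof. by case: z => n; [|rewrite NegzE mulrNz; apply: subringN]; exact: subring_nat. Qed.

Definition adjoin (y : K) : K -> Prop :=
  fun z => exists q : {poly K}, (forall i, R q`_i) /\ z = q.[y].

Lemma adjoin_subring y : subring (adjoin y).
Proof.
split.
- exists 1; split; last by rewrite hornerC.
  by move=> i; rewrite coef1; case: (i == 0)%N; [exact: subring1|exact: subring0].
- move=> _ _ [q [hq ->]] [r [hr ->]]; exists (q - r); rewrite hornerD hornerN.
  by split=> // i; rewrite coefB; apply: subringB.
- move=> _ _ [q [hq ->]] [r [hr ->]]; exists (q * r); rewrite hornerM.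
  by split=> // i; rewrite coefM; apply: subring_sum => j _; apply: subringM.
Qed.

Lemma adjoin_sub y x : R x -> adjoin y x.
Proof.
move=> hx; exists x%:P; rewrite hornerC; split=> // i.
by rewrite coefC; case: (i == 0)%N => //; exact: subring0.
Qed.

Lemma adjoin_gen y : adjoin y y.
Proof.
exists 'X; rewrite hornerX; split=> // i.
by rewrite coefX; case: (i == 1)%N; [exact: subring1|exact: subring0].
Qed.
End SubringTheory.

(** Zorn's lemma for the subrings that contain [b] but not its inverse. Maximality is recorded in
    the form used later: adjoining one more element produces [b^-1]. *)
Lemma maximal_subring (b : K) (R0 : K -> Prop) :
  subring R0 -> R0 b -> ~ R0 b^-1 ->
  exists R, [/\ subring R, R b, ~ R b^-1 &
    forall y, ~ R y -> adjoin R y b^-1].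
Proof.
move=> sR0 R0b R0b'.
pose good (A : set K) := [/\ subring A, A b & ~ A b^-1].
pose P (A : set K) := A = set0 \/ good A.
have chainP (F : set (set K)) : (F `<=` P)%classic -> total_on F subset ->
    P (\bigcup_(X in F) X)%classic.
  move=> FP Ftot.
  have [[A0 [FA0 gA0]]|nog] := pselect (exists A, F A /\ good A); last first.
    left; rewrite -subset0 => x [A FA Ax]; apply: nog; exists A; split=> //.
    by case: (FP _ FA) => // A0; rewrite A0 in Ax.
  have gA A x : F A -> A x -> good A.
    by move=> FA Ax; case: (FP _ FA) => // A00; rewrite A00 in Ax.
  have two x y : (\bigcup_(X in F) X)%classic x -> (\bigcup_(X in F) X)%classic y ->
      exists A, [/\ F A, A x & A y].
    move=> [A FA Ax] [B FB By]; case: (Ftot A B FA FB) => h.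
      by exists B; split=> //; apply: h.
    by exists A; split=> //; apply: h.
  right; split.
  - split.
    + by exists A0 => //; case: gA0 => -[].
    + move=> x y hx hy; have [A [FA Ax Ay]] := two _ _ hx hy; exists A => //.
      by have [sA _ _] := gA _ _ FA Ax; apply: subringB.
    + move=> x y hx hy; have [A [FA Ax Ay]] := two _ _ hx hy; exists A => //.
      by have [sA _ _] := gA _ _ FA Ax; apply: subringM.
  - by exists A0 => //; case: gA0.
  - by move=> [A FA Ab]; have [_ _] := gA _ _ FA Ab; apply.
have [R [PR maxR]] := Zorn_bigcup chainP.
have gR : good R.
  case: PR => // R0E; exfalso; apply: (maxR R0); last by right; split.
  by rewrite R0E; split=> [x //|/(_ _ R0b)].
have [sR Rb Rb'] := gR.
exists R; split=> // y Ry; apply: contrapT => nb.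
apply: (maxR (adjoin R y)); last first.
  right; split=> //; first exact: adjoin_subring.
  exact: adjoin_sub.
split; first by move=> x; apply: adjoin_sub.
by move=> /(_ y (adjoin_gen sR y)).
Qed.

Lemma adjoin_expand (R : K -> Prop) (y z : K) : subring R -> adjoin R y z ->
  exists n (q : nat -> K), (forall i, R (q i)) /\ z = \sum_(i < n.+1) q i * y ^+ i.
Proof.
move=> sR [q [hq ->]]; exists (size q), (fun i => q`_i); split=> //.
by rewrite (@horner_coef_wide _ (size q).+1).
Qed.

(** Chevalley's argument. If neither [y] nor [y^-1] lies in the maximal ring [R], then 1 is [b]
    times a polynomial over [R] in [y], and likewise in [y^-1]. The longer of two such relations can
    always be shortened with the other one, down to degree 0, where [b] would be invertible in
    [R]. *)
Lemma valuation_ring_exists (b : K) (R0 : K -> Prop) : b != 0 ->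
  subring R0 -> R0 b -> ~ R0 b^-1 ->
  exists R, [/\ subring R, R b, ~ R b^-1 & forall y, R y \/ R y^-1].
Proof.
move=> b0 sR0 R0b R0b'.
have [R [sR Rb Rb' maxR]] := maximal_subring sR0 R0b R0b'.
exists R; split=> //.
(* [b] lies in the Jacobson radical of [R]. Otherwise [b^-1] is a polynomial in the inverse of
   [u = 1 - b * s]; then [u ^+ n] is a multiple of [b] for some [n], although it is 1 modulo [b]. *)
have unit1 s : R s -> R (1 - b * s)^-1.
  move=> Rs; apply: contrapT => nu.
  have u0 : 1 - b * s != 0.
    apply/eqP => h; apply: Rb'; have -> : b^-1 = s; last by [].
    apply: (mulfI b0); rewrite divff //; apply/eqP; rewrite -subr_eq0; exact/eqP.
  have [n [q [Rq hq]]] := adjoin_expand sR (maxR _ nu).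
  set u := 1 - b * s in u0 nu hq.
  have Ru : R u by apply: subringB => //; [exact: subring1|exact: subringM].
  have [r' [Rr' er']] : exists r', R r' /\ u ^+ n = 1 - b * r'.
    elim: (n) => [|k [r [Rr IH]]].
      by exists 0; split; [exact: subring0|rewrite mulr0 subr0].
    exists (r + s - b * r * s); split.
      by apply: subringB => //; [exact: subringD|do 2 apply: subringM => //].
    by rewrite exprSr IH /u; ring.
  have [r [Rr er]] : exists r, R r /\ u ^+ n = b * r.
    exists (\sum_(i < n.+1) q i * u ^+ (n - i)); split.
      by apply: subring_sum => // i _; apply: subringM => //; exact: subringX.
    have -> : u ^+ n = b * (b^-1 * u ^+ n) by rewrite mulrA divff // mul1r.
    rewrite hq mulr_suml; congr (_ * _); apply: eq_bigr => i _.
    rewrite -mulrA exprVn; congr (_ * _).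
    have -> : u ^+ n = u ^+ (n - i) * u ^+ i by rewrite -exprD subnK // -ltnS.
    by rewrite mulrC mulfK // expf_neq0.
  apply: Rb'; have -> : b^-1 = r + r'; last exact: subringD.
  by apply: (mulfI b0); rewrite divff // mulrDr -er er' subrK.
pose rel n y := exists q : nat -> K,
  (forall i, R (q i)) /\ 1 = \sum_(i < n.+1) b * q i * y ^+ i.
have pad n k y : (n <= k)%N -> rel n y -> rel k y.
  move=> nk [q [Rq hq]]; exists (fun i => if (i <= n)%N then q i else 0); split.
    by move=> i; case: ifP => // _; exact: subring0.
  rewrite hq (big_ord_widen_cond k.+1 xpredT (fun i => b * q i * y ^+ i)) //=.
  rewrite big_mkcond; apply: eq_bigr => i _; rewrite ltnS.
  by case: ifP; rewrite ?mulr0 ?mul0r.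
have rel0 y : ~ rel 0%N y.
  move=> [q [Rq]]; rewrite big_ord_recl big_ord0 addr0 expr0 mulr1 => h.
  by apply: Rb'; have -> // : b^-1 = q 0%N; apply: (mulfI b0); rewrite divff.
(* Since [1 - b * s 0] is a unit, the relation for [y^-1], multiplied by [y ^+ n.+1], expresses this
   power through lower ones; this eliminates the top term of the relation for [y]. *)
have reduce n y : y != 0 -> rel n.+1 y -> rel n.+1 y^-1 -> rel n y.
  move=> y0 [q [Rq hq]] [s [Rs hs]].
  set e := (1 - b * s 0%N)^-1.
  have Re : R e by exact: unit1.
  have e0 : 1 - b * s 0%N != 0.
    apply/eqP => h; apply: Rb'; have -> : b^-1 = s 0%N; last by [].
    apply: (mulfI b0); rewrite divff //; apply/eqP; rewrite -subr_eq0; exact/eqP.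
  have yn : y ^+ n.+1 = \sum_(i < n.+1) b * (e * s (n.+1 - i)%N) * y ^+ i.
    have h1 : 1 - b * s 0%N = \sum_(i < n.+1) b * s (n.+1 - i)%N * y ^- (n.+1 - i).
      move: hs; rewrite big_ord_recl /= expr0 mulr1 => hs.
      rewrite {1}hs addrAC subrr add0r (reindex_inj rev_ord_inj) /=.
      apply: eq_bigr => i _; rewrite exprVn /bump leq0n add1n.
      by rewrite subSS -subSn // -ltnS.
    have -> : y ^+ n.+1 = e * (1 - b * s 0%N) * y ^+ n.+1 by rewrite mulVf // mul1r.
    rewrite h1 mulr_sumr mulr_suml; apply: eq_bigr => i _.
    have -> : y ^+ n.+1 = y ^+ (n.+1 - i) * y ^+ i by rewrite -exprD subnK // ltnW.
    have yi0 : y ^+ (n.+1 - i) != 0 by rewrite expf_neq0.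
    by field.
  exists (fun i => q i + b * q n.+1 * e * s (n.+1 - i)%N); split.
    by move=> i; apply: subringD => //; do !apply: subringM => //.
  rewrite hq big_ord_recr /= yn mulr_sumr -big_split /=; apply: eq_bigr => i _.
  by ring.
have key N : forall n m y, y != 0 -> (n + m <= N)%N -> rel n y -> rel m y^-1 -> False.
  elim: N => [|N IH] n m y y0.
    by rewrite leqn0 addn_eq0 => /andP [/eqP -> _] /rel0.
  case: n => [|n]; first by move=> _ /rel0.
  case: m => [|m]; first by move=> _ _ /rel0.
  move=> hnm h1 h2; have [mn|nm] := leqP m n.
    apply: (IH n m.+1 y y0) => //.
    by apply: reduce => //; apply: pad h2.
  apply: (IH n.+1 m y y0) => //; first by move: hnm; rewrite addnS ltnS.
  apply: reduce => //; first by rewrite invr_eq0.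
  by rewrite invrK; apply: pad h1; lia.
have getrel y : ~ R y -> exists n, rel n y.
  move=> /maxR /(adjoin_expand sR) [n [q [Rq hq]]]; exists n, q; split=> //.
  rewrite -(divff b0) hq mulr_sumr; apply: eq_bigr => i _; by rewrite mulrA.
move=> y; apply: contrapT => /not_orP [h1 h2].
have y0 : y != 0 by apply/eqP => h; apply: h1; rewrite h; exact: subring0.
have [n hn] := getrel _ h1; have [m hm] := getrel _ h2.
exact: (key (n + m)%N n m y).
Qed.
End ValuationRing.

(** * Linear dependence over a subfield *)

Section Dependence.
Variables (K : fieldType) (E : K -> Prop).
Hypothesis sE : subring E.
Hypothesis EV : forall x, E x -> E x^-1.

(** Gaussian elimination over the subfield [E], which is given as a predicate on [K]. A row with
    nonzero first entry clears the first column; if there is none, the first row gets coefficient 0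
    and the first column is already clear. *)
Lemma linear_dependence n (C : 'I_n.+1 -> 'I_n -> K) : (forall j i, E (C j i)) ->
  exists u : 'I_n.+1 -> K, [/\ forall j, E (u j), exists j, u j != 0 &
    forall i, \sum_j u j * C j i = 0].
Proof.
elim: n C => [|n IH] C EC.
  exists (fun=> 1); split=> [j||[]//]; first exact: subring1.
  by exists ord0; exact: oner_neq0.
have [[j0 pj0]|nop] := pselect (exists j, C j ord0 != 0); last first.
  have C0 j : C j ord0 = 0 by apply/eqP; apply: contrapT => h; apply: nop; exists j; exact/negP.
  have [//|u [Eu [j uj] hu]] := IH (fun j i => C (lift ord0 j) (lift ord0 i)).
  exists (fun j => if unlift ord0 j is Some j' then u j' else 0); split.
  - by move=> j'; case: unliftP => [k _|_] //; exact: subring0.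
  - by exists (lift ord0 j); rewrite liftK.
  - move=> i; rewrite big_ord_recl unlift_none mul0r add0r.
    case: (unliftP ord0 i) => [i' ->|->]; last first.
      by rewrite big1 // => k _; rewrite C0 mulr0.
    by rewrite -[RHS](hu i'); apply: eq_bigr => k _; rewrite liftK.
pose D j i := C (lift j0 j) (lift ord0 i) -
   C (lift j0 j) ord0 / C j0 ord0 * C j0 (lift ord0 i).
have [|u [Eu [j uj] hu]] := IH D.
  by move=> j i; apply: subringB => //; do 2 apply: subringM => //; exact: EV.
pose u0 := - \sum_j u j * C (lift j0 j) ord0 / C j0 ord0.
exists (fun j => if unlift j0 j is Some j' then u j' else u0); split.
- move=> j'; case: unliftP => [k _|_] //; apply: subringN => //.
  by apply: subring_sum => // k _; apply: subringM => //; [exact: subringM|exact: EV].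
- by exists (lift j0 j); rewrite liftK.
- move=> i; rewrite (bigD1_ord j0) //= unlift_none.
  under eq_bigr => k _ do rewrite liftK.
  rewrite /u0 mulNr mulr_suml addrC -sumrB.
  case: (unliftP ord0 i) => [i' ->|->]; last first.
    by rewrite big1 // => k _; rewrite mulfVK ?subrr.
  rewrite -[RHS](hu i'); apply: eq_bigr => k _; rewrite /D mulrBr; congr (_ - _).
  by rewrite !mulrA.
Qed.
End Dependence.

(** * Units and maximal ideal of a valuation ring *)

Section Units.
Variables (K : fieldType) (R : K -> Prop).
Hypotheses (sR : subring R) (vR : forall y, R y \/ R y^-1).

Definition vunit u := [/\ u != 0, R u & R u^-1].
(** The maximal ideal: in a valuation ring, [x^-1] outside [R] forces [x] into [R]. *)
Definition nonunit x := x = 0 \/ ~ R x^-1.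

Lemma nonunit_in x : nonunit x -> R x.
Proof. by case=> [->|h]; [exact: subring0|case: (vR x)]. Qed.

Lemma vunit1 : vunit 1.
Proof. by split; rewrite ?invr1 ?oner_neq0 //; exact: subring1. Qed.

Lemma vunitM u w : vunit u -> vunit w -> vunit (u * w).
Proof.
case=> a b c [a' b' c']; split; rewrite ?mulf_neq0 ?invfM //; exact: subringM.
Qed.

Lemma vunitV u : vunit u -> vunit u^-1.
Proof. by case=> a b c; split; rewrite ?invr_eq0 ?invrK. Qed.

Lemma vunitX u n : vunit u -> vunit (u ^+ n).
Proof.
move=> h; elim: n => [|n IH]; first by rewrite expr0; exact: vunit1.
by rewrite exprS; apply: vunitM.
Qed.

Lemma not_nonunit x : ~ nonunit x -> R x -> vunit x.
Proof.
move=> /not_orP [/eqP h1 /contrapT h2] h3; by split.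
Qed.

Lemma nonunitM r x : R r -> nonunit x -> nonunit (r * x).
Proof.
move=> Rr; have [->|x0] := eqVneq x 0; first by rewrite mulr0; left.
have [->|r0] := eqVneq r 0; first by rewrite mul0r; left.
case=> [/eqP|h]; first by rewrite (negPf x0).
right=> h2; apply: h; have -> : x^-1 = r * (r * x)^-1 by field; rewrite x0 r0.
exact: subringM.
Qed.

(** Of two nonzero elements one is a multiple of the other, hence so is the sum. *)
Lemma nonunitD x y : nonunit x -> nonunit y -> nonunit (x + y).
Proof.
have W a b : a != 0 -> b != 0 -> R (a / b) -> nonunit a -> nonunit b -> nonunit (a + b).
  move=> a0 b0 Rab _ hb.
  have -> : a + b = (a / b + 1) * b by field.
  by apply: nonunitM => //; apply: subringD => //; exact: subring1.
have [->|x0] := eqVneq x 0; first by rewrite add0r.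
have [->|y0] := eqVneq y 0; first by rewrite addr0.
case: (vR (x / y)) => h hx hy; first exact: W.
by rewrite addrC; apply: W => //; rewrite -invf_div.
Qed.

Lemma nonunit_not_vunit x : nonunit x -> ~ vunit x.
Proof. by case=> [->|h] [] //; rewrite eqxx. Qed.

(** In a vanishing sum the least valuation is attained twice. After division by a term of least
    valuation all quotients lie in [R], and the remaining ones add up to the unit -1, so they cannot
    all be nonunits. *)
Lemma sum_vunit_term n (T : 'I_n -> K) : \sum_i T i = 0 ->
  (exists i, T i != 0) -> exists i j, [/\ i != j, T i != 0, T j != 0 & vunit (T i / T j)].
Proof.
move=> sum0 [i0 Ti0].
have [j [Tj jmax]] : exists j, T j != 0 /\ forall i, R (T i / T j).
  have : forall s : seq 'I_n, exists j, T j != 0 /\ forall i, i \in s -> R (T i / T j).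
    elim=> [|a s [j [Tj hj]]]; first by exists i0.
    have [Ta|Ta] := eqVneq (T a) 0.
      exists j; split=> // i; rewrite inE => /orP [/eqP ->|/hj //].
      by rewrite Ta mul0r; exact: subring0.
    case: (vR (T a / T j)) => h.
      by exists j; split=> // i; rewrite inE => /orP [/eqP ->|/hj].
    exists a; split=> // i; rewrite inE => /orP [/eqP ->|/hj hi].
      by rewrite divff //; exact: subring1.
    have -> : T i / T a = (T i / T j) * (T a / T j)^-1 by field; rewrite Ta Tj.
    exact: subringM.
  by move=> /(_ (enum 'I_n)) [j [Tj hj]]; exists j; split=> // i; apply: hj; rewrite mem_enum.
apply: contrapT => nex.
have : nonunit (\sum_(i | i != j) T i / T j).
  apply: (big_ind nonunit); [by left|exact: nonunitD|move=> i ij].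
  apply: contrapT => h; apply: nex; exists i, j; have u := not_nonunit h (jmax i).
  split=> //; by case: u; rewrite mulf_eq0 negb_or => /andP [].
have -> : \sum_(i | i != j) T i / T j = -1.
  rewrite -mulr_suml; move: sum0; rewrite (bigD1 j) //= => /eqP.
  by rewrite addrC addr_eq0 => /eqP ->; rewrite mulNr divff.
move=> /nonunit_not_vunit; apply; split; rewrite ?invrN1 ?oppr_eq0 ?oner_neq0 //.
  by apply: subringN => //; exact: subring1.
by apply: subringN => //; exact: subring1.
Qed.
End Units.

(** * Polynomials and rational functions of one element *)

Section Evalt.
Variables (K : fieldType) (t : K).

Lemma evaltE (P : {poly int}) : evalt P t = \sum_(i < size P) (P`_i)%:~R * t ^+ i.
Proof.
rewrite /evalt (@horner_coef_wide _ (size P)) ?size_poly //.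
by apply: eq_bigr => i _; rewrite coef_map_id0.
Qed.

Lemma evaltB P Q : evalt (P - Q) t = evalt P t - evalt Q t.
Proof. by rewrite /evalt rmorphB hornerD hornerN. Qed.
Lemma evaltD P Q : evalt (P + Q) t = evalt P t + evalt Q t.
Proof. by rewrite /evalt rmorphD hornerD. Qed.
Lemma evaltM P Q : evalt (P * Q) t = evalt P t * evalt Q t.
Proof. by rewrite /evalt rmorphM hornerM. Qed.
Lemma evalt_C (z : int) : evalt z%:P t = z%:~R.
Proof. by rewrite /evalt map_polyC hornerC. Qed.
Lemma evalt_X : evalt 'X t = t.
Proof. by rewrite /evalt map_polyX hornerX. Qed.
Lemma evalt_Xn n : evalt 'X^n t = t ^+ n.
Proof. by rewrite /evalt map_polyXn hornerXn. Qed.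
Lemma evalt1 : evalt 1 t = 1.
Proof. by rewrite -[1]/(1%:P) evalt_C. Qed.
Lemma evalt0 : evalt 0 t = 0.
Proof. by rewrite -[0]/(0%:P) evalt_C. Qed.

Lemma evalt_in (R : K -> Prop) P : subring R -> R t -> R (evalt P t).
Proof.
move=> sR Rt; rewrite evaltE; apply: subring_sum => // i _.
by apply: subringM => //; [exact: subring_int|exact: subringX].
Qed.

Definition ratfun x := exists a b, evalt b t != 0 /\ x = evalt a t / evalt b t.

Lemma ratfun_subring : subring ratfun.
Proof.
split.
- by exists 1, 1; rewrite evalt1 divr1 oner_neq0.
- move=> _ _ [a [b [b0 ->]]] [c [d [d0 ->]]]; exists (a * d - c * b), (b * d).
  by rewrite evaltB !evaltM mulf_neq0 //; split=> //; field; rewrite d0 b0.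
- move=> _ _ [a [b [b0 ->]]] [c [d [d0 ->]]]; exists (a * c), (b * d).
  by rewrite !evaltM mulf_neq0 //; split=> //; field; rewrite d0 b0.
Qed.

Lemma ratfunV x : ratfun x -> ratfun x^-1.
Proof.
case=> a [b [b0 ->]]; have [->|a0] := eqVneq (evalt a t) 0.
  by rewrite mul0r invr0; exact: (subring0 ratfun_subring).
by exists b, a; rewrite invf_div.
Qed.

Lemma ratfun_gen : ratfun t.
Proof. by exists 'X, 1; rewrite evalt1 evalt_X divr1 oner_neq0. Qed.
End Evalt.

Lemma ratfun_sub (K : fieldType) (t : K) (E : K -> Prop) : subring E ->
  (forall x, E x -> E x^-1) -> E t -> forall x, ratfun t x -> E x.
Proof.
move=> sE EV Et _ [a [b [_ ->]]]; apply: subringM => //; last apply: EV; exact: evalt_in.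
Qed.

Section CharP.
Variables (K : fieldType) (p : nat).
Hypotheses (pp : prime p) (pK : (p%:R : K) = 0).

(** By Bezout with [p], the inverse of a nonzero element of the prime field is again the image of an
    integer. *)
Lemma intr_inverse (l : int) : (l%:~R : K) != 0 -> exists c : int, (c * l)%:~R = 1 :> K.
Proof.
move=> l0; have pz : (Posz p)%:~R = 0 :> K by exact: pK.
have cop : coprimez l p.
  rewrite coprimez_sym coprimezE absz_nat prime_coprime //.
  apply: contra l0 => /dvdnP [q hq].
  by rewrite (intEsg l) hq PoszM !intrM pz !mulr0.
have [[u w] /= h] := coprimezP _ _ cop.
exists u; have -> : u * l = 1 - w * p by move: h; lia.
by rewrite intrB intrM pz mulr0 subr0.
Qed.
End CharP.

(** * Places of the rational function field *)

Section Places.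
Variables (K : fieldType) (p : nat).
Hypotheses (pp : prime p) (pK : (p%:R : K) = 0).

(** Division with remainder over the integers is done by monic polynomials, so values are normalized
    to values of monic polynomials up to a unit of the prime field. A leading coefficient that
    vanishes in [K] is dropped; any other one is inverted. *)
Lemma monic_associate (t : K) (P : {poly int}) : evalt P t != 0 ->
  exists Q (c d : int), [/\ Q \is monic, (size Q <= size P)%N, c%:~R * d%:~R = 1 :> K &
    evalt Q t = c%:~R * evalt P t].
Proof.
move: {2}(size P) (leqnn (size P)) => n.
elim: n P => [|n IH] P.
  by rewrite leqn0 size_poly_eq0 => /eqP ->; rewrite evalt0 eqxx.
move=> sP P0; have PN0 : P != 0 by apply: contra P0 => /eqP ->; rewrite evalt0.
have szP : (0 < size P)%N by rewrite lt0n size_poly_eq0.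
set l := lead_coef P.
have [l0|l0] := eqVneq (l%:~R : K) 0.
  pose P1 := P - l%:P * 'X^((size P).-1).
  have eP1 : evalt P1 t = evalt P t.
    by rewrite evaltB evaltM evalt_C l0 mul0r subr0.
  have sP1 : (size P1 <= (size P).-1)%N.
    apply/leq_sizeP => j; rewrite leq_eqVlt => /orP [/eqP <-|jP].
      by rewrite coefB coefCM coefXn eqxx mulr1 subrr.
    rewrite coefB coefCM coefXn gtn_eqF // mulr0 subr0 nth_default //.
    by move: jP; rewrite -ltnS prednK.
  have [||Q [c [d [mQ sQ cd eQ]]]] := IH P1; [|by rewrite eP1|].
    by apply: leq_trans sP1 _; move: sP; rewrite -{1}(prednK szP) ltnS.
  exists Q, c, d; rewrite -eP1; split=> //.
  by apply: leq_trans sQ _; apply: leq_trans sP1 _; exact: leq_pred.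
have [c hc] := intr_inverse pp pK l0.
(* [c * l] equals 1 only in [K]. The second summand, whose coefficient is 0 in [K], makes the
   leading coefficient 1 over the integers. *)
pose Q := c%:P * P + (1 - c * l)%:P * 'X^((size P).-1).
have topQ : Q`_(size P).-1 = 1.
  by rewrite coefD !coefCM coefXn eqxx mulr1 -/l -lead_coefE -/l; ring.
have sQ : (size Q <= size P)%N.
  apply/leq_sizeP => j jP; rewrite coefD !coefCM coefXn gtn_eqF; last first.
    by apply: leq_trans jP; rewrite prednK.
  by rewrite nth_default // !mulr0 addr0.
have sQ' : size Q = size P.
  apply/eqP; rewrite eqn_leq sQ /= leqNgt; apply/negP => lt.
  have := topQ; rewrite nth_default // ; move: lt; rewrite -{1}(prednK szP) ltnS //.
exists Q, c, l; split=> //.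
- by rewrite monicE lead_coefE sQ' topQ.
- by rewrite -intrM.
- by rewrite evaltD !evaltM !evalt_C evalt_Xn rmorphB /= hc subrr mul0r addr0.
Qed.

Section PlaceOfRing.
Variables (t : K) (R : K -> Prop).
Hypotheses (sR : subring R) (vR : forall y, R y \/ R y^-1) (Rt : R t).
Hypothesis monic_neq0t : forall P : {poly int}, P \is monic -> evalt P t != 0.
Local Notation nonunit := (nonunit R).
Local Notation vunit := (vunit R).

Hypothesis nontriv : exists P, evalt P t != 0 /\ nonunit (evalt P t).

(** [pi] takes the role of the irreducible polynomial that defines a place of the rational function
    field. *)
Lemma minimal_uniformizer : exists pi, [/\ pi \is monic, nonunit (evalt pi t) &
  forall P, P \is monic -> nonunit (evalt P t) -> (size pi <= size P)%N].
Proof.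
pose S n := `[< exists P, [/\ P \is monic, nonunit (evalt P t) & size P = n] >].
have [|n /asboolP [P [mP nP sP]] minn] := @ex_minnP S.
  case: nontriv => P [P0 nP]; have [Q [c [d [mQ _ _ eQ]]]] := monic_associate P0.
  exists (size Q); apply/asboolP; exists Q; split=> //; rewrite eQ.
  by apply: nonunitM => //; exact: subring_int.
exists P; split=> // Q mQ nQ; rewrite sP; apply: minn; apply/asboolP.
by exists Q.
Qed.

Lemma uniformizer_power : exists w, [/\ w != 0, nonunit w &
  forall x, ratfun t x -> x != 0 -> exists (k : int), vunit (x / w ^ k)].
Proof.
have [pi [mpi npi minpi]] := minimal_uniformizer.
set w := evalt pi t; have w0 : w != 0 by exact: monic_neq0t.
have wM (a b : int) : w ^ (a + b) = w ^ a * w ^ b by rewrite expfzDr.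
exists w; split=> //.
(* The remainder of the division by [pi] has a value in the maximal ideal and smaller degree, so by
   minimality of [pi] this value is 0. *)
have divstep f : nonunit (evalt f t) -> f != 0 -> evalt f t != 0 ->
    exists q : {poly int}, (size q < size f)%N /\ evalt f t = evalt q t * w.
  move=> nf f0 ft0; have ef := Pdiv.RingMonic.rdivp_eq mpi f.
  set q := Pdiv.Ring.rdivp f pi in ef; set r := Pdiv.Ring.rmodp f pi in ef.
  have sr : (size r < size pi)%N.
    by apply: Pdiv.Ring.ltn_rmodpN0; exact: monic_neq0.
  have r0 : evalt r t = 0.
    apply/eqP; apply/negPn/negP => r0.
    have nr : nonunit (evalt r t).
      have -> : r = f - q * pi by rewrite ef addrC addKr.
      rewrite evaltB evaltM -/w -mulNr; apply: nonunitD => //; apply: nonunitM => //.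
      by apply: subringN => //; exact: evalt_in.
    have [Q [c [d [mQ sQ _ eQ]]]] := monic_associate r0.
    have := minpi Q mQ; rewrite eQ => /(_ (nonunitM sR (subring_int sR c) nr)) h.
    by move: (leq_ltn_trans (leq_trans h sQ) sr); rewrite ltnn.
  exists q; split; last by rewrite {1}ef evaltD evaltM r0 addr0.
  have q0 : q != 0.
    by apply: contra ft0 => /eqP q0; rewrite ef q0 mul0r add0r r0.
  have spi : (1 < size pi)%N.
    rewrite ltnNge; apply/negP => /size1_polyC h.
    have p1 : pi = 1.
      by move: (monicP mpi); rewrite h lead_coefC => ->.
    by apply: (nonunit_not_vunit npi); rewrite p1 evalt1; exact: vunit1.
  have sqp : size (q * pi) = (size q + size pi).-1 by rewrite size_Mmonic.
  have sq : (0 < size q)%N by rewrite size_poly_gt0.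
  have arith a b : (1 < b -> 0 < a -> a < (a + b).-1 /\ b <= (a + b).-1)%N by lia.
  have [lt1 lt2] := arith _ _ spi sq.
  by rewrite ef size_polyDl sqp //; exact: leq_trans sr lt2.
have polycase f : evalt f t != 0 -> exists k : int, vunit (evalt f t / w ^ k).
  move: {2}(size f) (leqnn (size f)) => n; elim: n f => [|n IH] f.
    by rewrite leqn0 size_poly_eq0 => /eqP ->; rewrite evalt0 eqxx.
  move=> sf f0; have fN0 : f != 0 by apply: contra f0 => /eqP ->; rewrite evalt0.
  have [nf|nf] := pselect (nonunit (evalt f t)); last first.
    by exists 0; rewrite expr0z divr1; apply: not_nonunit nf _; exact: evalt_in.
  have [q [sq eq]] := divstep f nf fN0 f0.
  have q0 : evalt q t != 0 by apply: contra f0; rewrite eq => /eqP ->; rewrite mul0r.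
  have [|k hk] := IH q _ q0; first by rewrite -ltnS; apply: leq_trans sq sf.
  exists (k + 1); rewrite eq wM expr1z; have wk : w ^ k != 0 by rewrite expfz_eq0 negb_and w0 orbT.
  have -> // : evalt q t * w / (w ^ k * w) = evalt q t / w ^ k.
  by field; rewrite w0 wk.
move=> x [a [b [b0 ->]]] x0.
have a0 : evalt a t != 0 by apply: contra x0 => /eqP ->; rewrite mul0r.
have [k hk] := polycase _ a0; have [l hl] := polycase _ b0.
have wn0 m : w ^ m != 0 by rewrite expfz_eq0 negb_and w0 orbT.
exists (k - l); have -> : w ^ (k - l) = w ^ k / w ^ l.
  by apply: (mulIf (wn0 l)); rewrite -wM subrK mulfVK.
have -> : evalt a t / evalt b t / (w ^ k / w ^ l) =
   (evalt a t / w ^ k) * (evalt b t / w ^ l)^-1.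
  by field; rewrite !wn0 b0.
by apply: vunitM => //; apply: vunitV.
Qed.
End PlaceOfRing.
End Places.

Section Transcendental.
Variable K : fieldType.

Definition transcendental (t : K) := forall P : {poly int}, evalt P t = 0 ->
  map_poly (fun z : int => z%:~R : K) P = 0.

Lemma transcendental_monic t P : transcendental t -> P \is monic -> evalt P t != 0.
Proof.
move=> tr mP; apply/eqP => /tr /polyP /(_ (size P).-1).
by rewrite coef_map_id0 // -lead_coefE (monicP mP) coef0 => /eqP; rewrite oner_eq0.
Qed.

(** The reciprocal polynomial [Q] has constant coefficient 1, and its value at [t] is a power of [t]
    times the value of [P] at [t^-1]; a zero would contradict transcendence of [t]. *)
Lemma transcendental_monicV t P : t != 0 -> transcendental t -> P \is monic ->
  evalt P t^-1 != 0.
Proof.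
move=> t0 tr mP; apply/eqP => e0.
pose Q := \poly_(i < size P) P`_((size P).-1 - i).
have szP : (0 < size P)%N by rewrite size_poly_gt0 monic_neq0.
have : evalt Q t = 0.
  have -> : evalt Q t = t ^+ (size P).-1 * evalt P t^-1.
    rewrite {1}/evalt (@horner_coef_wide _ (size P)); last first.
      by apply: leq_trans (size_poly _ _) _; exact: size_poly.
    rewrite evaltE mulr_sumr (reindex_inj rev_ord_inj) /=.
    apply: eq_bigr => i _; rewrite coef_map_id0 // coef_poly.
    rewrite -subSn // subSS leq_subr.
    have ip : (i <= (size P).-1)%N by rewrite -ltnS prednK.
    have -> : ((size P).-1 - (size P - i.+1))%N = i.
      have ar a c : (a <= c.-1 -> 0 < c -> c.-1 - (c - a.+1) = a)%N by lia.
      exact: ar.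
    have -> : (size P - i.+1)%N = ((size P).-1 - i)%N.
      have ar a c : (0 < c -> c - a.+1 = c.-1 - a)%N by lia.
      exact: ar.
    rewrite mulrCA; congr (_ * _).
    by rewrite exprVn -{2}(subnK ip) exprD mulfK // expf_neq0.
  by rewrite e0 mulr0.
move=> /tr /polyP /(_ 0%N); rewrite coef_map_id0 // coef_poly szP subn0 -lead_coefE.
by rewrite (monicP mP) coef0 => /eqP; rewrite oner_eq0.
Qed.

End Transcendental.

(** * The place of the function field given by a valuation ring *)

Section PlaceFromRing.
Variables (K : fieldType) (p : nat).
Hypotheses (pp : prime p) (pK : (p%:R : K) = 0).
Variables (R : K -> Prop) (b t : K) (n : nat) (e : 'I_n -> K).
Hypotheses (sR : subring R) (vR : forall y, R y \/ R y^-1).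
Hypotheses (b0 : b != 0) (Rb : R b) (Rb' : ~ R b^-1) (Rt : R t).
Hypothesis tmonic : forall P : {poly int}, P \is monic -> evalt P t != 0.
Hypothesis span : forall x, exists c : 'I_n -> K,
  (forall i, ratfun t (c i)) /\ x = \sum_i c i * e i.
Local Notation nonunit := (nonunit R).
Local Notation vunit := (vunit R).

(** The powers of [x] from 0 to [n] are dependent over the rational functions in [t], and two terms
    of the relation have the same valuation; their quotient is the claim. The bound on [d] is a
    bound on the ramification. *)
Lemma power_vunit_ratio x : x != 0 -> exists (d : nat) u,
  [/\ (0 < d <= n)%N, ratfun t u, u != 0 & vunit (x ^+ d / u)].
Proof.
move=> x0; have sE := ratfun_subring t; have EV := @ratfunV K t.
have [C hC] := choice (fun j : 'I_n.+1 => span (x ^+ j)).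
have [|u [Eu [j0 uj0] hu]] := linear_dependence sE EV (C := C).
  by move=> j i; case: (hC j).
pose T j := u j * x ^+ (nat_of_ord j).
have sT : \sum_j T j = 0.
  transitivity (\sum_j \sum_i u j * (C j i * e i)).
    by apply: eq_bigr => j _; rewrite /T; case: (hC j) => _ ->; rewrite mulr_sumr.
  rewrite exchange_big big1 // => i _.
  transitivity ((\sum_j u j * C j i) * e i); last by rewrite hu mul0r.
  by rewrite mulr_suml; apply: eq_bigr => j _; rewrite mulrA.
have xn0 m : x ^+ m != 0 by rewrite expf_neq0.
have [|i [j [ij Ti Tj vij]]] := sum_vunit_term sR vR sT.
  by exists j0; rewrite mulf_neq0.
have W (i' j' : 'I_n.+1) : (i' < j')%N -> T i' != 0 -> T j' != 0 -> vunit (T j' / T i') ->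
    exists (d : nat) u, [/\ (0 < d <= n)%N, ratfun t u, u != 0 & vunit (x ^+ d / u)].
  rewrite /T !mulf_eq0 !negb_or => lt /andP [ui _] /andP [uj _] h.
  exists (j' - i')%N, (u i' / u j'); split.
  - by rewrite subn_gt0 lt /=; apply: leq_trans (leq_subr _ _) _; rewrite -ltnS.
  - by apply: subringM => //; exact: EV.
  - by rewrite mulf_neq0 ?invr_eq0.
  - have -> : x ^+ (j' - i') / (u i' / u j') = u j' * x ^+ j' / (u i' * x ^+ i') => //.
    have -> : x ^+ j' = x ^+ (j' - i') * x ^+ i' by rewrite -exprD subnK // ltnW.
    by field; rewrite uj ui xn0.
case: (ltngtP i j) => [lt|lt|eq].
- by apply: (W i j) => //; rewrite -invf_div; exact: vunitV.
- exact: (W j i).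
- by move: ij; rewrite -(inj_eq val_inj) /= eq eqxx.
Qed.

(** Otherwise all nonzero rational functions in [t] would be units of [R], hence also some positive
    power of [b], and then [b^-1] would lie in [R]. *)
Lemma ratfun_nonunit : exists P : {poly int}, evalt P t != 0 /\ nonunit (evalt P t).
Proof.
apply: contrapT => nex.
have evu P : evalt P t != 0 -> vunit (evalt P t).
  move=> h; apply: not_nonunit; last exact: evalt_in.
  by move=> h2; apply: nex; exists P.
have [d [u [/andP [d0 _] [a [c [c0 eu]]] u0 hv]]] := power_vunit_ratio b0.
have a0 : evalt a t != 0 by apply: contra u0; rewrite eu => /eqP ->; rewrite mul0r.
have vu : vunit u by rewrite eu; apply: vunitM => //; [exact: evu|apply: vunitV; exact: evu].
have : vunit (b ^+ d) by rewrite -(mulfVK u0 (b ^+ d)); apply: vunitM.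
case: d d0 hv => // d _ _ [_ _]; rewrite exprS => h; apply: Rb'.
have -> : b^-1 = b ^+ d * (b * b ^+ d)^-1.
  by field; rewrite ?b0 ?expf_neq0 //.
by apply: subringM => //; exact: subringX.
Qed.

(** The exponent [w0] is additive and detects membership in [R] by its sign, which gives the
    ultrametric inequality. By Euclidean division its values are the multiples of the least positive
    one, [m]; dividing by [m] normalizes the valuation. *)
Lemma place_from_ring : exists w : K -> int, is_dval w /\ 0 < w b.
Proof.
have [pi [pi0 npi hpi]] := uniformizer_power pp pK sR vR Rt tmonic ratfun_nonunit.
have pin0 (m : int) : pi ^ m != 0 by rewrite expfz_eq0 negb_and pi0 orbT.
have piM (i j : int) : pi ^ (i + j) = pi ^ i * pi ^ j by rewrite expfzDr.
have Rpi : R pi by exact: nonunit_in.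
have pi_pos (m : int) : R (pi ^ m) -> 0 <= m.
  move=> h; rewrite leNgt; apply/negP => m0.
  case: npi => [/eqP|]; [by rewrite (negPf pi0)|apply].
  have [k ek] : exists k : nat, m = - k.+1%:Z.
    by case: (m) m0 => // k _; exists k; rewrite NegzE.
  have -> : pi^-1 = pi ^+ k * pi ^ m.
    by rewrite ek -invr_expz -exprnP exprS; field; rewrite ?pi0 ?expf_neq0 //.
  by apply: subringM => //; exact: subringX.
have R_pi (m : int) : 0 <= m -> R (pi ^ m).
  by case: m => // m _; rewrite -exprnP; exact: subringX.
pose N := n`!.
have N0 : (0 < N)%N by exact: fact_gt0.
have ex_w x : exists m : int, x != 0 -> vunit (x ^+ N / pi ^ m).
  have [->|x0] := eqVneq x 0; first by exists 0.
  have [d [u [/andP [d0 dn] Eu u0 hv]]] := power_vunit_ratio x0.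
  have [k hk] := hpi u Eu u0.
  have [q hq] : exists q, N = (d * q)%N.
    have /dvdnP [q hq] : (d %| N)%N by apply: dvdn_fact; rewrite d0.
    by exists q; rewrite hq mulnC.
  exists (k * q)=> _; rewrite hq exprM -exprz_exp -exprnP.
  have -> : (x ^+ d) ^+ q / (pi ^ k) ^+ q = ((x ^+ d / u) * (u / pi ^ k)) ^+ q.
    by rewrite mulrA mulfVK // exprMn exprVn.
  by apply: vunitX => //; apply: vunitM.
(* [w0 x] is the integer [m] such that [x ^ N] is a unit times [pi ^ m]; every value group
   element has some multiple of order at most [n] in the group generated by [pi]. *)
have [w0 hw0] := choice ex_w.
have uniq x (m : int) : x != 0 -> vunit (x ^+ N / pi ^ m) -> m = w0 x.
  move=> x0 h1; have h2 := hw0 x x0.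
  have xN0 : x ^+ N != 0 by rewrite expf_neq0.
  have /(vunitM sR h1) [_ h3 h4] := vunitV h2.
  have e1 : x ^+ N / pi ^ m * (x ^+ N / pi ^ w0 x)^-1 = pi ^ (w0 x - m).
    apply: (mulIf (pin0 m)); rewrite -piM subrK.
    by field; rewrite ?pin0 ?xN0 //.
  have e2 : (pi ^ (w0 x - m))^-1 = pi ^ (m - w0 x).
    by rewrite invr_expz opprB.
  rewrite e1 in h3 h4; rewrite e2 in h4.
  by have := pi_pos _ h3; have := pi_pos _ h4; lia.
have w0M x y : x != 0 -> y != 0 -> w0 (x * y) = w0 x + w0 y.
  move=> x0 y0; apply/esym; apply: uniq; first by rewrite mulf_neq0.
  rewrite exprMn piM.
  have -> : x ^+ N * y ^+ N / (pi ^ w0 x * pi ^ w0 y) = (x ^+ N / pi ^ w0 x) * (y ^+ N / pi ^ w0 y).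
    by field; rewrite ?pin0 //.
  by apply: vunitM => //; apply: hw0.
have w0_ge0 x : x != 0 -> (R x <-> 0 <= w0 x).
  move=> x0; have [_ h1 h2] := hw0 x x0; split=> h.
    apply: pi_pos; have -> : pi ^ w0 x = x ^+ N * (x ^+ N / pi ^ w0 x)^-1.
      by field; rewrite ?pin0 ?expf_neq0 //.
    by apply: subringM => //; exact: subringX.
  have RN : R (x ^+ N).
    by rewrite -(mulfVK (pin0 (w0 x)) (x ^+ N)); apply: subringM => //; exact: R_pi.
  case: (vR x) => // Rx'.
  have -> : x = x ^+ N * x^-1 ^+ N.-1.
    by rewrite exprVn -{1}(prednK N0) exprS mulfK // expf_neq0.
  by apply: subringM => //; exact: subringX.
have w0D x y : x != 0 -> y != 0 -> x + y != 0 -> Num.min (w0 x) (w0 y) <= w0 (x + y).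
  have W x' y' : x' != 0 -> y' != 0 -> x' + y' != 0 -> w0 x' <= w0 y' -> w0 x' <= w0 (x' + y').
    move=> x0 y0 xy0 le.
    have w0div z : z != 0 -> w0 (z / x') = w0 z - w0 x'.
      move=> z0; have := @w0M (z / x') x'; rewrite mulfVK // => h.
      by rewrite h ?mulf_neq0 ?invr_eq0 // addrK.
    have h1 : R (y' / x').
      by apply/w0_ge0; [rewrite mulf_neq0 ?invr_eq0|rewrite w0div // subr_ge0].
    have : R ((x' + y') / x').
      by rewrite mulrDl divff //; apply: subringD => //; exact: subring1.
    by rewrite w0_ge0 ?mulf_neq0 ?invr_eq0 // w0div // subr_ge0.
  move=> x0 y0 xy0; rewrite ge_min; apply/orP.
  case: (leP (w0 x) (w0 y)) => h; first by left; exact: W.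
  by right; rewrite addrC; apply: W => //; [rewrite addrC|exact: ltW].
have w0pi : w0 pi = N.
  apply/esym/uniq => //; rewrite -exprnP divff; first exact: vunit1.
  by rewrite expf_neq0.
pose S m := `[< (0 < m)%N /\ exists x, x != 0 /\ w0 x = m%:Z >].
have [|m /asboolP [m0 [x1 [x10 wx1]]] minm] := @ex_minnP S.
  by exists N; apply/asboolP; split=> //; exists pi.
have w0X x (k : nat) : x != 0 -> w0 (x ^+ k) = k%:Z * w0 x.
  move=> x0; elim: k => [|k IH].
    rewrite expr0 mul0r; apply/esym/uniq; rewrite ?oner_neq0 //.
    by rewrite expr1n expr0z divr1; exact: vunit1.
  by rewrite exprS w0M ?expf_neq0 // IH; lia.
have w0V x : x != 0 -> w0 x^-1 = - w0 x.
  move=> x0; have := w0M x x^-1 x0; rewrite invr_eq0 divff // => /(_ x0).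
  by have := w0X x 0%N x0; rewrite expr0 mul0r => ->; lia.
have div_m x : x != 0 -> w0 x = (w0 x %/ m)%Z * m.
  move=> x0; have := divz_eq (w0 x) m; set q := (w0 x %/ m)%Z; set r := (w0 x %% m)%Z => e1.
  have r0 : 0 <= r by apply: modz_ge0; lia.
  have rm : r < m by apply: ltz_pmod; lia.
  have [r00|r00] := eqVneq r 0; first by rewrite e1 r00 addr0.
  have [y [y0 wy]] : exists y, y != 0 /\ w0 y = r.
    have er : r = w0 x - q * m by rewrite e1; ring.
    case: (q) er => k er.
      exists (x / x1 ^+ k); rewrite w0M ?invr_eq0 ?expf_neq0 // w0V ?expf_neq0 // w0X // wx1.
      by rewrite mulf_neq0 ?invr_eq0 ?expf_neq0 // er.
    exists (x * x1 ^+ k.+1); rewrite w0M ?expf_neq0 // w0X // wx1.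
    by rewrite mulf_neq0 ?expf_neq0 // er NegzE; split=> //; ring.
  have : (m <= `|r|)%N.
    by apply: minm; apply/asboolP; split; [lia|exists y; split=> //; lia].
  by lia.
pose w x := (w0 x %/ m)%Z.
have m0' : 0 < m%:Z by lia.
have div_uniq (a c : int) : a * m = c * m -> a = c by nia.
exists w; split; first split.
- move=> x y x0 y0; apply: div_uniq; rewrite mulrDl /w -!div_m ?mulf_neq0 //; exact: w0M.
- move=> x y x0 y0 xy0; have := w0D x y x0 y0 xy0.
  rewrite (div_m x) // (div_m y) // (div_m (x + y)) // -/(w x) -/(w y) -/(w (x + y)).
  rewrite !ge_min => /orP [] h; apply/orP; [left|right]; nia.
- by exists x1; split=> //; rewrite /w wx1 divzz; lia.
- have : 0 <= w0 b by apply/w0_ge0.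
  have : w0 b^-1 < 0.
    by rewrite ltNge; apply/negP => /w0_ge0 h; apply: Rb'; apply: h; rewrite invr_eq0.
  by rewrite w0V // (div_m b) // -/(w b); nia.
Qed.
End PlaceFromRing.

(** If [v a] were positive, the ring generated by [b = a^-1] would not contain [a], and some
    valuation ring would contain [b] but not [a]. Its place [w] has [w a < 0], so it differs from
    [v], against the integrality of [a] at [w]. *)
Lemma nu_integers_val (K : fieldType) (p : nat) (v : K -> int) (a : K) :
  global_function_field K p -> is_dval v -> nu_integers v a -> a != 0 -> v a <= 0.
Proof.
move=> [pp pK [t [transc [n [e span]]]]] dv Oa a0; rewrite leNgt; apply/negP => va.
set b := a^-1; have b0 : b != 0 by rewrite invr_eq0.
pose R0 x := exists P, x = evalt P b.
have sR0 : subring R0.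
  split; first by exists 1; rewrite evalt1.
    by move=> _ _ [P ->] [Q ->]; exists (P - Q); rewrite evaltB.
  by move=> _ _ [P ->] [Q ->]; exists (P * Q); rewrite evaltM.
have R0b : R0 b by exists 'X; rewrite evalt_X.
have vb : v b < 0 by rewrite (dvalV dv a0); lia.
(* If [a] were a polynomial in [b], then after passing to a monic [Q] of degree [m], multiplication
   by [a ^+ m] would write 1 as a sum of terms of positive valuation. *)
have R0b' : ~ R0 b^-1.
  move=> [P]; rewrite invrK => hP.
  have [|Q [c [d [mQ _ _ eQ]]]] := @monic_associate _ _ pp pK b P; first by rewrite -hP.
  have [m szQ] : exists m, size Q = m.+1.
    by exists (size Q).-1; rewrite prednK // size_poly_gt0 monic_neq0.
  have lQ : Q`_m = 1 by rewrite -[m]/(m.+1.-1) -szQ -lead_coefE (monicP mQ).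
  have Va k : ge_val v (a ^+ k.+1) 1.
    rewrite exprS -[1]addr0; apply: ge_valM => //; first by right; lia.
    by apply: ge_valX => //; right; lia.
  have : ge_val v 1 1.
    have -> : (1 : K) = a ^+ m * evalt Q b - \sum_(i < m) (Q`_i)%:~R * (a ^+ m * b ^+ i).
      rewrite evaltE szQ big_ord_recr /= lQ mul1r exprVn mulrDr mulfV ?expf_neq0 //.
      rewrite addrC mulr_sumr addrA -sumrN -big_split big1 ?add0r //= => i _.
      by rewrite mulrCA addrC subrr.
    apply: ge_valB => //.
      rewrite eQ -hP mulrCA -exprSr; apply: ge_valMl => //; exact: ge_val_int.
    apply: ge_val_sum => // i _; apply: ge_valMl; [by []|exact: ge_val_int|].
    rewrite exprVn -{1}(subnK (ltnW (ltn_ord i))) exprD mulfK ?expf_neq0 //.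
    have := ltn_ord i; rewrite -subn_gt0; case: (_ - _)%N => // k _; exact: Va.
  by rewrite ge_valE ?oner_neq0 // (dval1 dv).
have [R [sR Rb Rb' vR]] := valuation_ring_exists b0 sR0 R0b R0b'.
(* The valuation ring contains [t] or [t^-1]; the place is built over whichever of the two it
   contains. *)
have key t' : R t' -> (forall P : {poly int}, P \is monic -> evalt P t' != 0) ->
    (forall x, ratfun t x -> ratfun t' x) -> exists w : K -> int, is_dval w /\ 0 < w b.
  move=> Rt' mon sub; apply: (@place_from_ring _ _ pp pK R b t' n e) => // x.
  have [f [g [h1 ->]]] := span x.
  by exists (fun i => evalt (f i) t / evalt (g i) t); split=> // i; apply: sub; exists (f i), (g i).
have [w [dw wb]] : exists w : K -> int, is_dval w /\ 0 < w b.
  have [Rt|Rt] := pselect (R t).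
    by apply: (key t) => // P; exact: transcendental_monic.
  have t0 : t != 0 by apply/eqP => t0; apply: Rt; rewrite t0; exact: subring0.
  apply: (key t^-1); first by case: (vR t).
    by move=> P mP; apply: (transcendental_monicV t0 transc).
  apply: ratfun_sub; [exact: ratfun_subring|exact: ratfunV|].
  by rewrite -[X in ratfun _ X]invrK; apply: ratfunV; exact: ratfun_gen.
have wa : w a < 0 by move: wb; rewrite (dvalV dw a0); lia.
have := Oa w dw; rewrite ge_valE // => h.
have : 0 <= w a by apply: h => /(_ a a0) h; lia.
by lia.
Qed.

(** * Limits in a complete discretely valued field *)

Section Limits.
Variables (k : fieldType) (w : k -> int).
Hypothesis dw : is_dval w.
Local Notation V n x := (ge_val w x n).

Definition lim_to (u : nat -> k) (l : k) : Prop :=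
  forall n : int, exists N, forall m, (N <= m)%N -> V n (u m - l).

Lemma lim_cst c : lim_to (fun=> c) c.
Proof. by move=> n; exists 0%N => m _; rewrite subrr; left. Qed.

Lemma lim_eventually u u' l : (exists N, forall m, (N <= m)%N -> u m = u' m) ->
  lim_to u l -> lim_to u' l.
Proof.
move=> [N hN] h n; have [N' hN'] := h n; exists (maxn N N') => m.
by rewrite geq_max => /andP [h1 h2]; rewrite -hN //; exact: hN'.
Qed.

Lemma lim_ext u u' l : u =1 u' -> lim_to u l -> lim_to u' l.
Proof. by move=> h; apply: lim_eventually; exists 0%N. Qed.

Lemma limD u u' l l' : lim_to u l -> lim_to u' l' -> lim_to (fun n => u n + u' n) (l + l').
Proof.
move=> h h' n; have [N hN] := h n; have [N' hN'] := h' n; exists (maxn N N') => m.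
rewrite geq_max => /andP [h1 h2].
have -> : u m + u' m - (l + l') = (u m - l) + (u' m - l') by ring.
by apply: ge_valD => //; [exact: hN|exact: hN'].
Qed.

Lemma limN u l : lim_to u l -> lim_to (fun n => - u n) (- l).
Proof.
move=> h n; have [N hN] := h n; exists N => m /hN hm.
by rewrite -opprD; apply: ge_valN.
Qed.

Lemma limB u u' l l' : lim_to u l -> lim_to u' l' -> lim_to (fun n => u n - u' n) (l - l').
Proof. by move=> h h'; apply: limD => //; exact: limN. Qed.

Lemma lim_bounded u l : lim_to u l -> exists B N, forall m, (N <= m)%N -> V B (u m).
Proof.
move=> h; have [N hN] := h 0; have [B hB] := ge_val_bounded w l.
exists (Num.min 0 B), N => m /hN hm; rewrite -(subrK l (u m)).
by apply: ge_valD => //; [apply: ge_val_le hm|apply: ge_val_le hB]; rewrite ge_min lexx ?orbT.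
Qed.

Lemma limM u u' l l' : lim_to u l -> lim_to u' l' -> lim_to (fun n => u n * u' n) (l * l').
Proof.
move=> h h' n; have [B [N0 hB]] := lim_bounded h'; have [C hC] := ge_val_bounded w l.
have [N hN] := h (n - B); have [N' hN'] := h' (n - C).
exists (maxn N0 (maxn N N')) => m; rewrite !geq_max => /and3P [h0 h1 h2].
have -> : u m * u' m - l * l' = (u m - l) * u' m + l * (u' m - l') by ring.
apply: ge_valD => //.
  by rewrite -(subrK B n); apply: ge_valM; [by []|exact: hN|exact: hB].
have -> : n = C + (n - C) by ring.
by apply: ge_valM => //; exact: hN'.
Qed.

Lemma limX u l n : lim_to u l -> lim_to (fun i => u i ^+ n) (l ^+ n).
Proof.
move=> h; elim: n => [|n IH]; first exact: lim_cst.
by apply: (lim_ext (u := fun i => u i * u i ^+ n)) => [i|]; rewrite exprS //; exact: limM.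
Qed.

Lemma lim_sum (I : Type) (r : seq I) (P : pred I) (u : I -> nat -> k) (l : I -> k) :
  (forall i, lim_to (u i) (l i)) ->
  lim_to (fun n => \sum_(i <- r | P i) u i n) (\sum_(i <- r | P i) l i).
Proof.
move=> h; elim: r => [|a r IH].
  by apply: (lim_ext (u := fun=> 0)) => [n|]; rewrite big_nil //; exact: lim_cst.
rewrite big_cons.
apply: (lim_ext (u := fun n => if P a then u a n + \sum_(i <- r | P i) u i n
   else \sum_(i <- r | P i) u i n)) => [n|]; first by rewrite big_cons.
by case: (P a) => //; exact: limD.
Qed.

Lemma lim_prod (I : Type) (r : seq I) (P : pred I) (u : I -> nat -> k) (l : I -> k) :
  (forall i, lim_to (u i) (l i)) ->
  lim_to (fun n => \prod_(i <- r | P i) u i n) (\prod_(i <- r | P i) l i).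
Proof.
move=> h; elim: r => [|a r IH].
  by apply: (lim_ext (u := fun=> 1)) => [n|]; rewrite big_nil //; exact: lim_cst.
rewrite big_cons.
apply: (lim_ext (u := fun n => if P a then u a n * \prod_(i <- r | P i) u i n
   else \prod_(i <- r | P i) u i n)) => [n|]; first by rewrite big_cons.
by case: (P a) => //; exact: limM.
Qed.

(** Extractions are only required to satisfy [n <= phi n], not to be increasing; this suffices for
    limits. *)
Lemma lim_sub u l (phi : nat -> nat) : (forall n, (n <= phi n)%N) -> lim_to u l ->
  lim_to (fun n => u (phi n)) l.
Proof.
move=> hphi h n; have [N hN] := h n; exists N => m hm; apply: hN.
exact: leq_trans hm (hphi m).
Qed.

Lemma lim_ge u l n : lim_to u l -> (exists N, forall m, (N <= m)%N -> V n (u m)) -> V n l.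
Proof.
move=> h [N hN]; have [N' hN'] := h n.
have -> : l = u (maxn N N') - (u (maxn N N') - l) by ring.
by apply: ge_valB => //; [apply: hN; exact: leq_maxl|apply: hN'; exact: leq_maxr].
Qed.

Lemma lim_unique u l l' : lim_to u l -> lim_to u l' -> l = l'.
Proof.
move=> h h'; apply/eqP; rewrite -subr_eq0; apply/eqP; apply: (@ge_val_all _ w) => n.
have h0 : lim_to (fun i => u i - u i) (l - l') by exact: limB.
apply: (lim_ge h0); exists 0%N => m _; rewrite subrr; by left.
Qed.

(** By the ultrametric inequality, a term closer to [l] than 0 is has the valuation of [l]. *)
Lemma lim_unit u l : lim_to u l -> l != 0 ->
  exists N, forall m, (N <= m)%N -> u m != 0 /\ w (u m) = w l.
Proof.
move=> h l0; have [N hN] := h (w l + 1); exists N => m /hN hm.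
have nV : ~ V (w l + 1) l by rewrite ge_valE //; lia.
have u0 : u m != 0.
  apply/eqP => u0; apply: nV; have := ge_valN dw hm; by rewrite u0 sub0r opprK.
split=> //; apply/eqP; rewrite eq_le; apply/andP; split.
  rewrite leNgt; apply/negP => lt; apply: nV.
  rewrite -[X in V _ X](subKr (u m) l).
  by apply: ge_valB => //; right; lia.
rewrite -ge_valE // -[X in V _ X](subrK l (u m)); apply: ge_valD => //; last by right.
by apply: ge_val_le hm; lia.
Qed.

Lemma limV u l : lim_to u l -> l != 0 -> lim_to (fun n => (u n)^-1) l^-1.
Proof.
move=> h l0 n; have [N hN] := lim_unit h l0; have [N' hN'] := h (n + w l + w l).
exists (maxn N N') => m; rewrite geq_max => /andP [/hN [u0 wu] /hN' hm].
have -> : (u m)^-1 - l^-1 = - (u m - l) * ((u m)^-1 * l^-1) by field; rewrite u0 l0.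
have -> : n = (n + w l + w l) + (- w l + - w l) by ring.
apply: ge_valM => //; first exact: ge_valN.
by apply: ge_valM => //; right; rewrite dvalV ?wu.
Qed.

Lemma lim_squeeze u B : lim_to u 0 -> (exists N, forall n, (N <= n)%N -> V 0 (B n)) ->
  lim_to (fun n => u n * B n) 0.
Proof.
move=> h [N' hB] n; have [N hN] := h n; exists (maxn N N') => m.
rewrite geq_max => /andP [/hN + /hB hb]; rewrite !subr0 => hm.
exact: ge_valMr.
Qed.

Lemma lim0_sqr u : lim_to (fun n => u n ^+ 2) 0 -> lim_to u 0.
Proof.
move=> h n; have [N hN] := h (n + n); exists N => m /hN; rewrite !subr0.
have [->|u0] := eqVneq (u m) 0; first by left.
by rewrite !ge_valE ?expf_neq0 // expr2 dvalM //; lia.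
Qed.

Lemma lim0_intro u (j : nat -> int) : (forall n, V (j n) (u n)) ->
  (forall J, exists N, forall n, (N <= n)%N -> J <= j n) -> lim_to u 0.
Proof.
move=> h hj n; have [N hN] := hj n; exists N => m /hN hm; rewrite subr0.
exact: ge_val_le (h m).
Qed.

Lemma lim_horner (P : {poly k}) u l : lim_to u l -> lim_to (fun n => P.[u n]) P.[l].
Proof.
move=> h; rewrite horner_coef.
apply: (lim_ext (u := fun n => \sum_(i < size P) P`_i * u n ^+ i)) => [n|].
  by rewrite horner_coef.
by apply: lim_sum => i; apply: limM; [exact: lim_cst|exact: limX].
Qed.

Definition mlim m n (U : nat -> 'M[k]_(m, n)) (L : 'M[k]_(m, n)) : Prop :=
  forall i j, lim_to (fun q => U q i j) (L i j).

Definition near m n (N : int) (A B : 'M[k]_(m, n)) : Prop :=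
  forall i j, V N (A i j - B i j).

Lemma mlim_near m n (U : nat -> 'M[k]_(m, n)) L : mlim U L <->
  forall N, exists q0, forall q, (q0 <= q)%N -> near N (U q) L.
Proof.
split=> h; last by move=> i j N; have [q0 hq] := h N; exists q0 => q /hq; apply.
move=> N.
have [f hf] := choice (fun ij : 'I_m * 'I_n => h ij.1 ij.2 N).
exists (\max_(ij : 'I_m * 'I_n) f ij) => q hq i j; apply: (hf (i, j)).
exact: leq_trans (leq_bigmax _) hq.
Qed.

Lemma mlim_cst m n (A : 'M[k]_(m, n)) : mlim (fun=> A) A.
Proof. by move=> i j; exact: lim_cst. Qed.

Lemma mlim_ext m n (U U' : nat -> 'M[k]_(m, n)) L : U =1 U' -> mlim U L -> mlim U' L.
Proof. by move=> h hU i j; apply: lim_ext (hU i j) => q; rewrite h. Qed.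

Lemma mlim_sub m n (U : nat -> 'M[k]_(m, n)) L (phi : nat -> nat) :
  (forall q, (q <= phi q)%N) -> mlim U L -> mlim (fun q => U (phi q)) L.
Proof. by move=> hphi h i j; exact: (lim_sub hphi (h i j)). Qed.

Lemma mlimM m n p (U : nat -> 'M[k]_(m, n)) (W : nat -> 'M[k]_(n, p)) L L' :
  mlim U L -> mlim W L' -> mlim (fun q => U q *m W q) (L *m L').
Proof.
move=> h h' i j; rewrite mxE.
apply: (lim_ext (u := fun q => \sum_l U q i l * W q l j)) => [q|]; first by rewrite mxE.
by apply: lim_sum => l; exact: limM.
Qed.

Lemma mlim_tr m n (U : nat -> 'M[k]_(m, n)) L : mlim U L -> mlim (fun q => (U q)^T) L^T.
Proof. by move=> h i j; rewrite mxE; apply: lim_ext (h j i) => q; rewrite mxE. Qed.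

Lemma lim_det n (U : nat -> 'M[k]_n) L : mlim U L -> lim_to (fun q => \det (U q)) (\det L).
Proof.
move=> h; rewrite /determinant; apply: lim_sum => s; apply: limM; first exact: lim_cst.
by apply: lim_prod => i; exact: h.
Qed.

Lemma mlim_inv n (U : nat -> 'M[k]_n) L : \det L != 0 -> mlim U L ->
  mlim (fun q => invmx (U q)) (invmx L).
Proof.
move=> L0 h; have hd := lim_det h; have [N hN] := lim_unit hd L0.
move=> i j; apply: (lim_eventually (u := fun q => (\det (U q))^-1 * cofactor (U q) j i)).
  exists N => q /hN [u0 _]; rewrite /invmx unitmxE unitfE u0 !mxE //.
rewrite /invmx unitmxE unitfE L0 !mxE.
apply: limM; first exact: limV.
rewrite /cofactor; apply: limM; first exact: lim_cst.
by apply: lim_det => a b; rewrite !mxE; apply: lim_ext (h (lift j a) (lift i b)) => q; rewrite !mxE.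
Qed.

Lemma near_refl m n N (A : 'M[k]_(m, n)) : near N A A.
Proof. by move=> i j; rewrite subrr; left. Qed.

Lemma near_trans m n N (A B C : 'M[k]_(m, n)) : near N A B -> near N B C -> near N A C.
Proof.
move=> h h' i j; have -> : A i j - C i j = (A i j - B i j) + (B i j - C i j) by ring.
exact: ge_valD.
Qed.

Lemma near_le m n N N' (A B : 'M[k]_(m, n)) : N <= N' -> near N' A B -> near N A B.
Proof. by move=> h hAB i j; apply: ge_val_le (hAB i j). Qed.

Lemma mx_bounded m n (A : 'M[k]_(m, n)) : exists B, forall i j, V B (A i j).
Proof.
have [f hf] := choice (fun ij : 'I_m * 'I_n => ge_val_bounded w (A ij.1 ij.2)).
exists (- (\sum_(ij : 'I_m * 'I_n) `|f ij|)) => i j; apply: ge_val_le (hf (i, j)).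
rewrite lerNl; apply: le_trans (ler_norm _) _; rewrite normrN.
by rewrite (bigD1 (i, j)) //= lerDl; apply: sumr_ge0.
Qed.

Lemma near_mulr m n p N (C : 'M[k]_(n, p)) : exists N', forall A B : 'M[k]_(m, n),
  near N' A B -> near N (A *m C) (B *m C).
Proof.
have [b hb] := mx_bounded C; exists (N - b) => A B h i j.
rewrite !mxE -sumrB; apply: ge_val_sum => // l _; rewrite -mulrBl.
by rewrite -(subrK b N); apply: ge_valM.
Qed.

Lemma near_mull m n p N (C : 'M[k]_(m, n)) : exists N', forall A B : 'M[k]_(n, p),
  near N' A B -> near N (C *m A) (C *m B).
Proof.
have [b hb] := mx_bounded C; exists (N - b) => A B h i j.
rewrite !mxE -sumrB; apply: ge_val_sum => // l _; rewrite -mulrBr.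
have -> : N = b + (N - b) by ring.
exact: ge_valM.
Qed.

Lemma near_lim m n (U : nat -> 'M[k]_(m, n)) L : (forall q, near q%:Z (U q) L) -> mlim U L.
Proof.
move=> h; apply/mlim_near => N; exists `|N|%N => q hq; apply: near_le (h q).
by apply: le_trans (ler_norm N) _; rewrite -abszE lez_nat.
Qed.

Hypothesis complete : forall u : nat -> k,
  (forall n : int, exists N, forall m q, (N <= m)%N -> (N <= q)%N -> V n (u m - u q)) ->
  exists l, forall n : int, exists N, forall m, (N <= m)%N -> V n (u m - l).

Hypothesis half : V 0 (2%:R^-1) /\ (2%:R : k) != 0.

(* [y |-> (e - y^2) / 2] contracts the maximal ideal; its fixed point satisfies
   [(1 + y)^2 = 1 + e]. *)
Lemma sqrt_near1 (u : k) : V 1 (u - 1) ->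
  exists s, s ^+ 2 = u /\ forall n, 1 <= n -> V n (u - 1) -> V n (s - 1).
Proof.
move=> hu; set e := u - 1 in hu *; case: half => h2 two0.
pose f y := (e - y ^+ 2) / 2%:R.
have fV n y : 1 <= n -> V n e -> V n y -> V n (f y).
  move=> n1 he hy; apply: ge_valMr => //; apply: ge_valB => //; rewrite expr2.
  by apply: ge_val_le (ge_valM dw hy hy); lia.
have fC n y z : V 1 y -> V 1 z -> V n (y - z) -> V (n + 1) (f y - f z).
  move=> hy hz hyz; have -> : f y - f z = (y - z) * (- (y + z)) / 2%:R by rewrite /f; field.
  by apply: ge_valMr => //; apply: ge_valM => //; apply: ge_valN => //; exact: ge_valD.
pose y n := iter n f 0.
have y1 n m : 1 <= m -> V m e -> V m (y n).
  by move=> m1 he; elim: n => [|n IH]; [left|apply: fV].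
have step n : V (n%:Z + 1) (y n.+1 - y n).
  elim: n => [|n IH]; first by rewrite add0r subr0; exact: y1.
  have -> : n.+1%:Z = n%:Z + 1 by lia.
  by apply: (fC _ (y n.+1) (y n)) => //; [exact: (y1 n.+1)|exact: (y1 n)].
have far n m : (n <= m)%N -> V n%:Z (y m - y n).
  move=> /subnKC <-; elim: (m - n)%N => [|d IH]; first by rewrite addn0 subrr; left.
  rewrite addnS.
  have -> : y (n + d).+1 - y n =
    (y (n + d).+1 - y (n + d)%N) + (y (n + d)%N - y n) by ring.
  by apply: ge_valD => //; apply: ge_val_le (step _); lia.
have [l hl] : exists l, lim_to y l.
  apply: complete => n; exists `|n|%N => m q hm hq.
  have hn i : (`|n| <= i)%N -> n <= i%:Z by lia.
  have [le|le] := leqP m q.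
    by rewrite -opprB; apply: ge_valN => //; apply: ge_val_le (far _ _ le); exact: hn.
  by apply: ge_val_le (far _ _ (ltnW le)); exact: hn.
have fl : f l = l.
  apply: (@lim_unique (fun n => y n.+1)).
    apply: limM; last exact: lim_cst.
    by apply: limB; [exact: lim_cst|exact: limX].
  exact: (@lim_sub y l succn).
exists (1 + l); split.
  have : e - l ^+ 2 = l * 2%:R by rewrite -{2}fl /f mulfVK.
  rewrite /e => h; have -> : u = (u - 1 - l ^+ 2) + l ^+ 2 + 1 by ring.
  by rewrite h; ring.
move=> n n1 hn; rewrite addrAC subrr add0r; apply: (lim_ge hl); exists 0%N => m _.
exact: y1.
Qed.

End Limits.

(** * Three by three matrices *)

Section Matrices3.
Variable k : fieldType.

Definition o0 : 'I_3 := @Ordinal 3 0 isT.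
Definition o1 : 'I_3 := @Ordinal 3 1 isT.
Definition o2 : 'I_3 := @Ordinal 3 2 isT.

Lemma ord3P (P : 'I_3 -> Prop) : P o0 -> P o1 -> P o2 -> forall i, P i.
Proof.
move=> h0 h1 h2 [[|[|[|//]]] hi].
- by have -> : Ordinal hi = o0 by apply: val_inj.
- by have -> : Ordinal hi = o1 by apply: val_inj.
- by have -> : Ordinal hi = o2 by apply: val_inj.
Qed.

Lemma sum3 (R : nmodType) (F : 'I_3 -> R) : \sum_(i < 3) F i = F o0 + F o1 + F o2.
Proof.
rewrite !big_ord_recl big_ord0 addr0 addrA.
by congr (F _ + F _ + F _); apply: val_inj.
Qed.

Lemma mulmx3E (A B : 'M[k]_3) i j :
  (A *m B) i j = A i o0 * B o0 j + A i o1 * B o1 j + A i o2 * B o2 j.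
Proof. by rewrite mxE sum3. Qed.

Lemma mx3_ext m (A B : 'M[k]_(3, m)) :
  (forall j, A o0 j = B o0 j) -> (forall j, A o1 j = B o1 j) ->
  (forall j, A o2 j = B o2 j) -> A = B.
Proof. by move=> h0 h1 h2; apply/matrixP; apply: ord3P. Qed.

Lemma det3 (A : 'M[k]_3) : \det A =
  A o0 o0 * (A o1 o1 * A o2 o2 - A o1 o2 * A o2 o1)
  - A o0 o1 * (A o1 o0 * A o2 o2 - A o1 o2 * A o2 o0)
  + A o0 o2 * (A o1 o0 * A o2 o1 - A o1 o1 * A o2 o0).
Proof.
rewrite (expand_det_row _ o0) sum3 /cofactor.
rewrite !(expand_det_row _ ord0) !big_ord_recl !big_ord0 /cofactor !det_mx11 !mxE.
pose f (i j : nat) := A (inord i) (inord j).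
have fE (i j : 'I_3) : A i j = f i j by rewrite /f !inord_val.
rewrite !fE /= /bump /=; ring.
Qed.

Definition mx3 (a b c d e f g h i : k) : 'M[k]_3 :=
  \matrix_(r, s) nth 0 (nth [::] [:: [:: a; b; c]; [:: d; e; f]; [:: g; h; i]] r) s.

Definition mxJ := mx3 0 0 1 0 (-1) 0 1 0 0.
(** The exponential of [s] times the regular nilpotent matrix, which explains the entry
    [s ^+ 2 / 2]. *)
Definition v1 s := mx3 1 s (s ^+ 2 / 2%:R) 0 1 s 0 0 1.
Definition v2 b := mx3 1 0 b 0 1 0 0 0 1.
Definition dg t := mx3 t 0 0 0 1 0 0 0 t^-1.
(** The form [mxJ] transported by [g]. It is unchanged when [g] is multiplied on the left by an
    isometry, so on matrices of determinant 1 it is a coordinate on the quotient by the orthogonal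
    group. *)
Definition gram (g : 'M[k]_3) := g^T *m mxJ *m g.

Lemma gramE g i j :
  gram g i j = g o0 i * g o2 j - g o1 i * g o1 j + g o2 i * g o0 j.
Proof. by rewrite /gram !(mulmx3E, mxE) /=; ring. Qed.

Lemma gram_mul g h : gram (g *m h) = h^T *m gram g *m h.
Proof. by rewrite /gram trmx_mul !mulmxA. Qed.

Lemma gram_sym g i j : gram g i j = gram g j i.
Proof. by rewrite !gramE; ring. Qed.

Lemma det_mxJ : \det mxJ = 1.
Proof. by rewrite det3 !mxE /=; ring. Qed.

Lemma gram_det g : \det (gram g) = \det g ^+ 2.
Proof. by rewrite /gram !det_mulmx det_tr det_mxJ; ring. Qed.

Definition inH (h : 'M[k]_3) := \det h = 1 /\ gram h = mxJ.

Lemma inH_gram h g : inH h -> gram (h *m g) = gram g.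
Proof. by case=> _ hh; rewrite gram_mul hh. Qed.

Lemma inH1 : inH 1%:M.
Proof. by split; [exact: det1|rewrite /gram trmx1 mul1mx mulmx1]. Qed.

Lemma inHM g h : inH g -> inH h -> inH (g *m h).
Proof.
move=> hg [d2 g2]; split; last by rewrite inH_gram.
by case: hg => d1 _; rewrite det_mulmx d1 d2 mulr1.
Qed.

Lemma unit_det (n : nat) (g : 'M[k]_n) : \det g != 0 -> g \in unitmx.
Proof. by rewrite unitmxE unitfE. Qed.

Lemma unit_det1 (n : nat) (g : 'M[k]_n) : \det g = 1 -> g \in unitmx.
Proof. by move=> h; apply: unit_det; rewrite h oner_neq0. Qed.

Lemma inH_unit h : inH h -> h \in unitmx.
Proof. by case=> h1 _; apply: unit_det1. Qed.

Lemma invmx_mul (n : nat) (A B : 'M[k]_n) : A \in unitmx -> B \in unitmx ->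
  invmx (A *m B) = invmx B *m invmx A.
Proof.
move=> uA uB; apply: (can_inj (mulmxK (_ : A *m B \in unitmx))).
  by rewrite unitmx_mul uA uB.
rewrite mulVmx ?unitmx_mul ?uA ?uB // -mulmxA (mulmxA (invmx A)) mulVmx //.
by rewrite mul1mx mulVmx.
Qed.

Lemma det_inv1 (n : nat) (g : 'M[k]_n) : \det g = 1 -> \det (invmx g) = 1.
Proof. by move=> h; rewrite det_inv h invr1. Qed.

Lemma inHV h : inH h -> inH (invmx h).
Proof.
move=> hh; have u := inH_unit hh; case: (hh) => d1 g1; split; first exact: det_inv1.
by rewrite -(inH_gram _ hh) mulmxV // /gram trmx1 mul1mx mulmx1.
Qed.

Hypothesis two0 : (2%:R : k) != 0.

Lemma inH_v1 s : inH (v1 s).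
Proof.
split; first by rewrite det3 !mxE /=; ring.
by apply: mx3_ext; apply: ord3P; rewrite gramE !mxE /=; field.
Qed.

Lemma inH_dg t : t != 0 -> inH (dg t).
Proof.
move=> t0; split; first by rewrite det3 !mxE /=; field.
by apply: mx3_ext; apply: ord3P; rewrite gramE !mxE /=; field.
Qed.

Lemma v1D s s' : v1 s *m v1 s' = v1 (s + s').
Proof. by apply: mx3_ext; apply: ord3P; rewrite mulmx3E !mxE /=; field. Qed.

Lemma v10 : v1 0 = 1%:M.
Proof. by apply: mx3_ext; apply: ord3P; rewrite !mxE /=; field. Qed.

Lemma v20 : v2 0 = 1%:M.
Proof. by apply: mx3_ext; apply: ord3P; rewrite !mxE /=; field. Qed.

Lemma v2D b b' : v2 b *m v2 b' = v2 (b + b').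
Proof. by apply: mx3_ext; apply: ord3P; rewrite mulmx3E !mxE /=; ring. Qed.

Lemma v1v2 s b : v1 s *m v2 b = v2 b *m v1 s.
Proof. by apply: mx3_ext; apply: ord3P; rewrite !mulmx3E !mxE /=; field. Qed.

Lemma v1N s : v1 (- s) *m v1 s = 1%:M.
Proof. by rewrite v1D addNr v10. Qed.

Lemma dg_v1 t s : t != 0 -> dg t *m v1 s = v1 (t * s) *m dg t.
Proof.
by move=> t0; apply: mx3_ext; apply: ord3P; rewrite !mulmx3E !mxE /=; field; rewrite ?t0.
Qed.

Lemma dg_v2 t b : t != 0 -> dg t *m v2 b = v2 (t ^+ 2 * b) *m dg t.
Proof.
by move=> t0; apply: mx3_ext; apply: ord3P; rewrite !mulmx3E !mxE /=; field; rewrite ?t0.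
Qed.

Lemma dgV t : t != 0 -> dg t *m dg t^-1 = 1%:M.
Proof.
move=> t0; apply: mx3_ext; apply: ord3P; rewrite !mulmx3E !mxE /= ?invrK
  ?mulfV ?mulVf //; ring.
Qed.

Lemma det_v2 b : \det (v2 b) = 1.
Proof. by rewrite det3 !mxE /=; ring. Qed.
Lemma det_v1 s : \det (v1 s) = 1. Proof. by case: (inH_v1 s). Qed.
Lemma det_dg t : t != 0 -> \det (dg t) = 1. Proof. by move=> /inH_dg []. Qed.

Lemma gram_v2 b : gram (v2 b) = mx3 0 0 1 0 (-1) 0 1 0 (2%:R * b).
Proof. by apply: mx3_ext; apply: ord3P; rewrite gramE !mxE /=; ring. Qed.

End Matrices3.

Lemma lim_eq (k : fieldType) (w : k -> int) u l l' : lim_to w u l' -> l' = l -> lim_to w u l.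
Proof. by move=> h <-. Qed.

Ltac lim_step dw := first
  [ eassumption
  | match goal with
    | |- lim_to _ (fun _ => ?c) _ => apply (lim_cst _ c)
    | |- lim_to _ (fun n => @?a n + @?b n) _ => eapply (limD dw)
    | |- lim_to _ (fun n => - (@?a n)) _ => eapply (limN dw)
    | |- lim_to _ (fun n => @?a n * @?b n) _ => eapply (limM dw)
    | |- lim_to _ (fun n => (@?a n) ^+ _) _ => eapply (limX dw)
    end ].
(** Computes the limit of an arithmetic expression from the known limits of its atoms and leaves the
    identity between the computed and the claimed limit. *)
Ltac lim_tac dw := eapply lim_eq; [repeat lim_step dw | ].

(** * Local sections of the quotients by [v1] and by the orthogonal group *)

Section LocalSections.
Variables (k : fieldType) (w : k -> int).
Hypothesis dw : is_dval w.
Hypothesis two0 : (2%:R : k) != 0.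
Local Notation V n x := (ge_val w x n).
Local Notation lim := (lim_to w).

(** The entries are recovered one after another from the Gram matrix and the third row. These only
    determine the square of the middle entry; its sign comes from the determinant. *)
Lemma unipotent_section_aux (L : nat -> 'M[k]_3) : (forall n, \det (L n) = 1) ->
  (exists N, forall n, (N <= n)%N -> L n o1 o2 = 0) ->
  lim (fun n => L n o2 o0) 0 -> lim (fun n => L n o2 o1) 0 ->
  lim (fun n => L n o2 o2) 1 -> mlim w (fun n => gram (L n)) (mxJ k) ->
  mlim w L 1%:M.
Proof.
move=> dL [N1 h12] h20 h21 h22 hG.
have [N2 u22] := lim_unit dw h22 (oner_neq0 _).
have ge n : (maxn N1 N2 <= n)%N -> L n o1 o2 = 0 /\ L n o2 o2 != 0.
  by rewrite geq_max => /andP [/h12 a /u22 [b _]].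
have ev (u u' : nat -> k) l : (forall n, L n o1 o2 = 0 -> L n o2 o2 != 0 -> u n = u' n) ->
    lim u l -> lim u' l.
  move=> h; apply: lim_eventually; exists (maxn N1 N2) => n /ge [a b]; exact: h.
have G i j := hG i j.
have G00 := G o0 o0; have G01 := G o0 o1; have G02 := G o0 o2.
have G11 := G o1 o1; have G12 := G o1 o2; have G22 := G o2 o2.
rewrite !mxE /= in G00 G01 G02 G11 G12 G22.
have i22 := limV dw h22 (oner_neq0 _).
have x02 : lim (fun n => L n o0 o2) 0.
  apply: (ev (fun n => gram (L n) o2 o2 * (L n o2 o2)^-1 * 2%:R^-1)).
    by move=> n a b; rewrite gramE a; field; rewrite ?b ?two0 //.
  by lim_tac dw; ring.
have x01 : lim (fun n => L n o0 o1) 0.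
  apply: (ev (fun n => (gram (L n) o1 o2 - L n o0 o2 * L n o2 o1) * (L n o2 o2)^-1)).
    by move=> n a b; rewrite gramE a; field; rewrite ?b ?two0 //.
  by lim_tac dw; ring.
have x00 : lim (fun n => L n o0 o0) 1.
  apply: (ev (fun n => (gram (L n) o0 o2 - L n o2 o0 * L n o0 o2) * (L n o2 o2)^-1)).
    by move=> n a b; rewrite gramE a; field; rewrite ?b ?two0 //.
  by lim_tac dw; rewrite ?invr1; ring.
have y11 : lim (fun n => L n o1 o1 ^+ 2) 1.
  apply: (ev (fun n => 2%:R * L n o0 o1 * L n o2 o1 - gram (L n) o1 o1)).
    by move=> n a b; rewrite gramE; ring.
  by lim_tac dw; ring.
have y10 : lim (fun n => L n o1 o0 * L n o1 o1) 0.
  apply: (ev (fun n => L n o0 o0 * L n o2 o1 + L n o2 o0 * L n o0 o1 - gram (L n) o0 o1)).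
    by move=> n a b; rewrite gramE; ring.
  by lim_tac dw; ring.
(* Multiplied by the middle entry, the equation [\det (L n) = 1] involves on its left side only
   quantities whose limits are known. *)
have x11 : lim (fun n => L n o1 o1) 1.
  apply: (ev (fun n => L n o1 o1 ^+ 2 * (L n o0 o0 * L n o2 o2 - L n o0 o2 * L n o2 o0)
     - (L n o1 o0 * L n o1 o1) * (L n o0 o1 * L n o2 o2 - L n o0 o2 * L n o2 o1))).
    move=> n a b; rewrite -[RHS]mul1r -(dL n) det3 a; ring.
  by lim_tac dw; ring.
have i11 := limV dw x11 (oner_neq0 _).
have [N3 u11] := lim_unit dw x11 (oner_neq0 _).
have x10 : lim (fun n => L n o1 o0) 0.
  apply: (lim_eventually (u := fun n => (L n o1 o0 * L n o1 o1) * (L n o1 o1)^-1)).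
    by exists N3 => n /u11 [a _]; rewrite mulfK.
  by lim_tac dw; ring.
have x12 : lim (fun n => L n o1 o2) 0.
  apply: (lim_eventually (u := fun=> 0)); last exact: lim_cst.
  by exists N1 => n /h12.
by rewrite /mlim; apply: ord3P; apply: ord3P; rewrite mxE /=.
Qed.

Lemma v1_mul_row2 s (g : 'M[k]_3) j : (v1 s *m g) o1 j = g o1 j + s * g o2 j.
Proof. by rewrite mulmx3E !mxE /=; ring. Qed.

Lemma v1_mul_row3 s (g : 'M[k]_3) j : (v1 s *m g) o2 j = g o2 j.
Proof. by rewrite mulmx3E !mxE /=; ring. Qed.

(** The third row and the Gram matrix are invariants of left multiplication by [v1]; convergence of
    these invariants lifts to convergence of suitable translates. The shift [s n] is the one that
    kills the entry [o1 o2] of [g n *m invmx g0]. *)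
Lemma unipotent_section (g : nat -> 'M[k]_3) (g0 : 'M[k]_3) :
  (forall n, \det (g n) = 1) -> \det g0 = 1 ->
  (forall j, lim (fun n => g n o2 j) (g0 o2 j)) ->
  mlim w (fun n => gram (g n)) (gram g0) ->
  exists s : nat -> k, mlim w (fun n => v1 (s n) *m g n) g0.
Proof.
move=> dg dg0 hrow hG; have ug0 := unit_det1 dg0.
pose q n := g n *m invmx g0.
have dq n : \det (q n) = 1 by rewrite det_mulmx dg det_inv1 ?mul1r.
have hqG : mlim w (fun n => gram (q n)) (mxJ k).
  have -> : mxJ k = (invmx g0)^T *m gram g0 *m invmx g0.
    by rewrite -gram_mul mulmxV // /gram trmx1 mul1mx mulmx1.
  apply: (mlim_ext (U := fun n => (invmx g0)^T *m gram (g n) *m invmx g0)) => [n|].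
    by rewrite gram_mul.
  by apply: mlimM => //; [apply: mlimM => //|]; exact: mlim_cst.
have hqr j : lim (fun n => q n o2 j) ((1%:M : 'M[k]_3) o2 j).
  rewrite -(mulmxV ug0) mulmx3E.
  apply: (lim_ext (u := fun n => g n o2 o0 * invmx g0 o0 j + g n o2 o1 * invmx g0 o1 j
    + g n o2 o2 * invmx g0 o2 j)) => [n|]; first by rewrite mulmx3E.
  have a0 := hrow o0; have a1 := hrow o1; have a2 := hrow o2.
  by lim_tac dw.
have q20 := hqr o0; have q21 := hqr o1; have q22 := hqr o2.
rewrite !mxE /= in q20 q21 q22.
pose s n := - q n o1 o2 / q n o2 o2; exists s.
have hL : mlim w (fun n => v1 (s n) *m q n) 1%:M.
  apply: unipotent_section_aux.
  - by move=> n; rewrite det_mulmx det_v1 // dq mul1r.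
  - have [N u22] := lim_unit dw q22 (oner_neq0 _); exists N => n /u22 [a _].
    by rewrite v1_mul_row2 /s mulfVK ?subrr // addrN.
  - by apply: lim_ext q20 => n; rewrite v1_mul_row3.
  - by apply: lim_ext q21 => n; rewrite v1_mul_row3.
  - by apply: lim_ext q22 => n; rewrite v1_mul_row3.
  - by apply: mlim_ext hqG => n; rewrite inH_gram //; exact: inH_v1.
have := mlimM dw hL (mlim_cst w g0); rewrite mul1mx; apply: mlim_ext => n.
by rewrite /q -!mulmxA mulVmx // mulmx1.
Qed.

Hypothesis half : V 0 (2%:R^-1).
Hypothesis complete : forall u : nat -> k,
  (forall n : int, exists N, forall m q, (N <= m)%N -> (N <= q)%N -> V n (u m - u q)) ->
  exists l, forall n : int, exists N, forall m, (N <= m)%N -> V n (u m - l).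

(** One choice of square roots near 1 that serves all sequences; its values away from 1 are
    arbitrary. *)
Lemma lim_sqrt : exists sq : k -> k, forall u : nat -> k, lim u 1 ->
  lim (fun n => sq (u n)) 1 /\ exists N, forall n, (N <= n)%N -> sq (u n) ^+ 2 = u n.
Proof.
have h0 := sqrt_near1 dw complete (conj half two0).
have h1 (u : k) : exists s, V 1 (u - 1) ->
    s ^+ 2 = u /\ forall n, 1 <= n -> V n (u - 1) -> V n (s - 1).
  have [hu|hu] := pselect (V 1 (u - 1)); last by exists 0.
  by have [s hs] := h0 _ hu; exists s.
have [sq hsq] := choice h1; exists sq => u hu; have [N1 hN1] := hu 1; split.
  move=> n; have [N hN] := hu (Num.max 1 n); exists (maxn N N1) => m.
  rewrite geq_max => /andP [/hN a /hN1 b]; have [_ c] := hsq _ b.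
  by apply: ge_val_le (c _ _ a); rewrite le_max lexx ?orbT.
by exists N1 => n /hN1 /hsq [].
Qed.

(** An explicit matrix [m n] close to 1 with the same Gram matrix as [g n] is written down; then
    [m n *m invmx (g n)] is an isometry. *)
Lemma H_section (g : nat -> 'M[k]_3) : (forall n, \det (g n) = 1) ->
  mlim w (fun n => gram (g n)) (mxJ k) ->
  exists h : nat -> 'M[k]_3, (forall n, inH (h n)) /\ mlim w (fun n => h n *m g n) 1%:M.
Proof.
move=> dg hG; have [sq hsq] := lim_sqrt.
pose a n := gram (g n) o0 o0; pose b n := gram (g n) o0 o1; pose c n := gram (g n) o0 o2.
pose d n := gram (g n) o1 o1; pose e n := gram (g n) o1 o2; pose f n := gram (g n) o2 o2.
have la : lim a 0 by have := hG o0 o0; rewrite mxE.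
have lb : lim b 0 by have := hG o0 o1; rewrite mxE.
have lc : lim c 1 by have := hG o0 o2; rewrite mxE.
have ld : lim d (-1) by have := hG o1 o1; rewrite mxE.
have le : lim e 0 by have := hG o1 o2; rewrite mxE.
have lf : lim f 0 by have := hG o2 o2; rewrite mxE.
have n1 : (-1 : k) != 0 by rewrite oppr_eq0 oner_neq0.
have lid := limV dw ld n1.
have [N1 ud] := lim_unit dw ld n1.
(* Completing the square in the middle variable leaves a binary form with coefficients [a'], [c'],
   [f']. The number [ga] below is the root close to 1 of [X^2 - c' X + a' f' / 4]. *)
pose a' n := a n - b n ^+ 2 * (d n)^-1; pose c' n := c n - b n * e n * (d n)^-1.
pose f' n := f n - e n ^+ 2 * (d n)^-1.
have la' : lim a' 0 by rewrite /a'; lim_tac dw; ring.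
have lc' : lim c' 1 by rewrite /c'; lim_tac dw; ring.
have lf' : lim f' 0 by rewrite /f'; lim_tac dw; ring.
have [ldel [N2 edel]] : lim (fun n => sq (- d n)) 1 /\
    exists N, forall n, (N <= n)%N -> sq (- d n) ^+ 2 = - d n.
  by apply: (hsq (fun n => - d n)); lim_tac dw; ring.
have [lD [N3 eD]] : lim (fun n => sq (c' n ^+ 2 - a' n * f' n)) 1 /\ exists N, forall n,
    (N <= n)%N -> sq (c' n ^+ 2 - a' n * f' n) ^+ 2 = c' n ^+ 2 - a' n * f' n.
  by apply: (hsq (fun n => c' n ^+ 2 - a' n * f' n)); lim_tac dw; ring.
pose del n := sq (- d n); pose D n := sq (c' n ^+ 2 - a' n * f' n).
pose ga n := (c' n + D n) * 2%:R^-1; pose be n := f' n * 2%:R^-1 * (ga n)^-1.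
have lga : lim ga 1 by rewrite /ga; lim_tac dw; field.
have liga := limV dw lga (oner_neq0 _).
have [N4 uga] := lim_unit dw lga (oner_neq0 _).
have lbe : lim be 0 by rewrite /be; lim_tac dw; ring.
pose m n := mx3 1 0 (be n) (del n * b n * (d n)^-1) (del n) (del n * e n * (d n)^-1)
  (a' n * 2%:R^-1) 0 (ga n).
have lm : mlim w m 1%:M.
  rewrite /mlim; apply: ord3P; apply: ord3P; rewrite !mxE /=;
  (apply: lim_ext => [n|]; [by rewrite mxE /=|]); rewrite /del; lim_tac dw; ring.
have Gm n : (maxn N1 (maxn N2 (maxn N3 N4)) <= n)%N -> gram (m n) = gram (g n).
  rewrite !geq_max => /and4P [/ud [d0 _] /edel e1 /eD e2 /uga [g0 _]].
  have e2' : D n = 2%:R * ga n - c' n by rewrite /ga; field.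
  rewrite -/(D n) e2' in e2.
  have e3 : a' n * f' n = 4%:R * ga n * (c' n - ga n).
    have -> : a' n * f' n = c' n ^+ 2 - (c' n ^+ 2 - a' n * f' n) by ring.
    rewrite -e2; ring.
  have dd : del n ^+ 2 = - d n := e1.
  have q00 : gram (m n) o0 o0 = a n.
    rewrite gramE !mxE /=.
    have -> : 1 * (a' n / 2%:R) - del n * b n / d n * (del n * b n / d n) + a' n / 2%:R * 1
       = a' n - del n ^+ 2 * (b n ^+ 2 / d n ^+ 2) by field; rewrite d0 two0.
    by rewrite dd /a'; field.
  have q01 : gram (m n) o0 o1 = b n.
    rewrite gramE !mxE /=.
    have -> : 1 * 0 - del n * b n / d n * del n + a' n / 2%:R * 0
       = - del n ^+ 2 * (b n / d n) by ring.
    by rewrite dd; field.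
  have q02 : gram (m n) o0 o2 = c n.
    rewrite gramE !mxE /=.
    have -> : 1 * ga n - del n * b n / d n * (del n * e n / d n) + a' n / 2%:R * be n
       = ga n + (a' n * f' n) / (4%:R * ga n) - del n ^+ 2 * (b n * e n / d n ^+ 2).
      by rewrite /be; field; rewrite d0 g0 two0 -[4%N]/(2 * 2)%N natrM mulf_neq0.
    rewrite e3 dd /c'; field; rewrite d0 g0 -[4%N]/(2 * 2)%N natrM mulf_neq0 //.
  have q11 : gram (m n) o1 o1 = d n.
    rewrite gramE !mxE /=.
    by have -> : 0 * 0 - del n * del n + 0 * 0 = - del n ^+ 2; [ring|rewrite dd opprK].
  have q12 : gram (m n) o1 o2 = e n.
    rewrite gramE !mxE /=.
    have -> : 0 * ga n - del n * (del n * e n / d n) + 0 * be n = - del n ^+ 2 * (e n / d n).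
      by ring.
    by rewrite dd; field.
  have q22 : gram (m n) o2 o2 = f n.
    rewrite gramE !mxE /=.
    have -> : be n * ga n - del n * e n / d n * (del n * e n / d n) + ga n * be n
       = f' n - del n ^+ 2 * (e n ^+ 2 / d n ^+ 2).
      by rewrite /be; field; rewrite d0 g0 two0.
    by rewrite dd /f'; field.
  apply: mx3_ext; apply: ord3P => //; by rewrite gram_sym [RHS]gram_sym.
(* Equality of Gram matrices gives [\det (m n) ^+ 2 = 1]; since [\det (m n) + 1] is nonzero, the
   determinant is 1. *)
have [N5 dm1] : exists N, forall n, (N <= n)%N -> \det (m n) + 1 != 0.
  have hd : lim (fun n => \det (m n) + 1) 2%:R.
    have := lim_det dw lm; rewrite det1 => h; lim_tac dw; ring.
  by have [N hN] := lim_unit dw hd two0; exists N => n /hN [].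
pose ok n := gram (m n) = gram (g n) /\ \det (m n) = 1.
(* The identity is a filler for early [n], so that every [h n] is an isometry. *)
pose h n := if `[< ok n >] then m n *m invmx (g n) else 1%:M.
exists h; split.
  move=> n; rewrite /h; case: asboolP => [[h1 h2]|_]; last exact: inH1.
  have ug := unit_det1 (dg n); split.
    by rewrite det_mulmx h2 det_inv1 ?mulr1.
  by rewrite gram_mul h1 -gram_mul mulmxV // /gram trmx1 mul1mx mulmx1.
move=> i j; apply: lim_eventually (lm i j).
exists (maxn N5 (maxn N1 (maxn N2 (maxn N3 N4)))) => n.
rewrite geq_max => /andP [/dm1 h5 /Gm hGm].
have dm : \det (m n) = 1.
  apply/eqP; rewrite -subr_eq0 -(mulIr_eq0 _ (mulIf h5)); apply/eqP.
  have -> : (\det (m n) - 1) * (\det (m n) + 1) = \det (m n) ^+ 2 - 1 by ring.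
  by rewrite -gram_det hGm gram_det dg expr1n subrr.
have okn : ok n by [].
rewrite /h; case: asboolP => // _.
by rewrite -mulmxA mulVmx ?mulmx1 //; exact: unit_det1.
Qed.

End LocalSections.

(** * Dynamics on the space of lattices *)

Section Lattices.
Variables (k : fieldType) (w : k -> int).
Hypothesis dw : is_dval w.
Hypothesis two0 : (2%:R : k) != 0.
Local Notation V n x := (ge_val w x n).
Local Notation lim := (lim_to w).
Local Notation mlim := (mlim w).
Local Notation near := (near w).
Local Notation M3 := 'M[k]_3.

Lemma near1_mul n N (A B : 'M[k]_n) : 0 <= N -> near N A 1%:M -> near N B 1%:M ->
  near N (A *m B) 1%:M.
Proof.
move=> N0 hA hB i j.
have -> : (A *m B) i j - 1%:M i j = ((A - 1%:M) *m B) i j + (B i j - 1%:M i j).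
  by rewrite mulmxBl mul1mx [in RHS]mxE [(- B) i j]mxE; ring.
apply: ge_valD => //; rewrite mxE; apply: ge_val_sum => // l _.
apply: ge_valMr => //; first by have := hA i l; rewrite !mxE.
rewrite -(subrK (1%:M l j) (B l j)); apply: ge_valD => //.
  exact: ge_val_le (hB l j).
by rewrite mxE; case: (l == j); [exact: ge_val_1|left].
Qed.

Lemma mlim_quotient (n : nat) (a : nat -> 'M[k]_n) L : \det L != 0 -> mlim a L ->
  forall J, exists q0, forall m q, (q0 <= m)%N -> (q0 <= q)%N ->
    near J (a m *m invmx (a q)) 1%:M.
Proof.
move=> L0 h J; apply: contrapT => nex.
have h1 (q0 : nat) : exists mq : nat * nat, [/\ (q0 <= mq.1)%N, (q0 <= mq.2)%N &
    ~ near J (a mq.1 *m invmx (a mq.2)) 1%:M].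
  apply: contrapT => nex2; apply: nex; exists q0 => m q hm hq.
  by apply: contrapT => hn; apply: nex2; exists (m, q).
have [f hf] := choice h1.
have : mlim (fun q => a (f q).1 *m invmx (a (f q).2)) 1%:M.
  rewrite -(mulmxV (unit_det L0)); apply: mlimM => //.
    by apply: (mlim_sub (phi := fun q => (f q).1)) => // q; case: (hf q).
  apply: mlim_inv => //.
  by apply: (mlim_sub (phi := fun q => (f q).2)) => // q; case: (hf q).
move=> /mlim_near /(_ J) [q hq]; case: (hf q) => _ _; apply; exact: hq.
Qed.

Variable O : k -> Prop.
Hypothesis sO : subring O.
Hypothesis O_discrete : forall x, O x -> V 1 x -> x = 0.

Definition lat (g : M3) := \det g = 1 /\ forall i j, O (g i j).

Lemma lat_unit g : lat g -> g \in unitmx.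
Proof. by case=> h _; exact: unit_det1. Qed.

Lemma lat1 : lat 1%:M.
Proof.
split=> [|i j]; first exact: det1.
by rewrite mxE; case: (i == j); [exact: subring1|exact: subring0].
Qed.

Lemma latM g h : lat g -> lat h -> lat (g *m h).
Proof.
move=> [d1 h1] [d2 h2]; split; first by rewrite det_mulmx d1 d2 mulr1.
by move=> i j; rewrite mulmx3E; apply: subringD => //; [apply: subringD => //|]; exact: subringM.
Qed.

Lemma latV g : lat g -> lat (invmx g).
Proof.
move=> lg; case: (lg) => d1 h1; split; first exact: det_inv1.
move=> i j; rewrite /invmx lat_unit // d1 invr1 scale1r mxE /cofactor.
apply: subringM => //; first by apply: subringX => //; apply: subringN => //; exact: subring1.
apply: subring_sum => // s _; apply: subringM => //.
  by apply: subringX => //; apply: subringN => //; exact: subring1.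
apply: (big_ind O); [exact: subring1|by move=> x y; exact: subringM|].
by move=> l _; rewrite !mxE.
Qed.

Lemma lat_near1 g : lat g -> near 1 g 1%:M -> g = 1%:M.
Proof.
move=> [_ h] hn; apply/matrixP => i j; apply/eqP; rewrite -subr_eq0; apply/eqP.
apply: O_discrete => //; apply: subringB => //.
by case: lat1 => _; apply.
Qed.

Definition seq_closed (F : M3 -> Prop) :=
  forall U L, (forall n : nat, F (U n)) -> mlim U L -> F L.
(** Sets of lattices are handled as sets of matrices invariant under [lat] on the right. *)
Definition lat_inv (F : M3 -> Prop) := forall g c, F g -> lat c -> F (g *m c).
Definition v1_inv (F : M3 -> Prop) := forall g s, F g -> F (v1 s *m g).

Variables (delta : k) (Y : M3 -> Prop).
Hypothesis delta0 : delta != 0.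
Hypothesis Ydet : forall g, Y g -> \det g = delta.
Hypothesis Ylat : lat_inv Y.
Hypothesis YH : forall h g, inH h -> Y g -> Y (h *m g).
Hypothesis Yclosed : seq_closed Y.

(** Openness is relative to the matrices of determinant [delta]: the change of variables that
    normalizes the form may have any nonzero determinant. *)
Definition rel_open (U : M3 -> Prop) := forall g, \det g = delta -> U g ->
  exists N, forall g', \det g' = delta -> near N g' g -> U g'.

Hypothesis Ycompact : forall (I : Type) (U : I -> M3 -> Prop),
  (forall i, rel_open (U i)) -> (forall i, lat_inv (U i)) ->
  (forall g, Y g -> exists i, U i g) ->
  exists (n : nat) (f : nat -> I), forall g, Y g -> exists j, (j < n)%N /\ U (f j) g.

Lemma Yunit g : Y g -> g \in unitmx.
Proof. by move=> /Ydet h; apply: unit_det; rewrite h. Qed.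

Lemma Ydet0 g : Y g -> \det g != 0.
Proof. by move=> /Ydet ->. Qed.

(** Sequential compactness modulo [lat]. Without a cluster point, every point of [Y] would have an
    invariant neighbourhood that the sequence eventually leaves, and finitely many of these cover
    [Y]. *)
Lemma seq_compact (u : nat -> M3) : (forall n, Y (u n)) ->
  exists (phi : nat -> nat) (c : nat -> M3) L, [/\ forall n, (n <= phi n)%N,
    forall n, lat (c n), mlim (fun n => u (phi n) *m c n) L & Y L].
Proof.
move=> Yu.
have [[L [YL hL]]|ncl] := pselect (exists L, Y L /\ forall N n0, exists n c,
    [/\ (n0 <= n)%N, lat c & near N (u n *m c) L]).
  have h1 (q : nat) : exists nc : nat * M3,
      [/\ (q <= nc.1)%N, lat nc.2 & near q%:Z (u nc.1 *m nc.2) L].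
    by have [n [c h]] := hL q%:Z q; exists (n, c).
  have [f hf] := choice h1.
  exists (fun n => (f n).1), (fun n => (f n).2), L; split=> //.
  - by move=> n; case: (hf n).
  - by move=> n; case: (hf n).
  - by apply: near_lim => // q; case: (hf q).
exfalso.
have h1 L : exists Nn : int * nat, Y L -> forall n c, (Nn.2 <= n)%N -> lat c ->
    ~ near Nn.1 (u n *m c) L.
  have [YL|nYL] := pselect (Y L); last by exists (0, 0%N).
  apply: contrapT => nex; apply: ncl; exists L; split=> // N n0.
  apply: contrapT => nex2; apply: nex; exists (N, n0) => _ n c hn lc hnear.
  by apply: nex2; exists n, c.
(* For [L] in [Y], [f L] is a radius together with an index from which on no lattice translate of
   the sequence comes that close to [L]. *)
have [f hf] := choice h1.
pose U L g := Y L /\ exists c, lat c /\ near (f L).1 (g *m c) L.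
have [L g _ [YL [c [lc hn]]]|L g c0 [YL [c [lc hn]]] lc0|g Yg|n [F hF]] := Ycompact (U := U).
- have [N hN] := near_mulr dw 3 (f L).1 c; exists N => g' _ hg'; split=> //.
  by exists c; split=> //; apply: near_trans hn => //; exact: hN.
- split=> //; exists (invmx c0 *m c); split; first by apply: latM => //; exact: latV.
  by rewrite mulmxA mulmxK //; exact: lat_unit.
- exists g; split=> //; exists 1%:M; split; first exact: lat1.
  by rewrite mulmx1; exact: near_refl.
pose m := \max_(j < n) (f (F j)).2.
have [j [jn [YF [c [lc hc]]]]] := hF _ (Yu m).
apply: (hf (F j) YF m c _ lc hc).
exact: (leq_bigmax (F := fun j : 'I_n => (f (F j)).2) (Ordinal jn)).
Qed.

(* Compactness of [Y] modulo [lat]: lattice translates of the [m n] converge. *)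
Lemma limit_in_closed (F : M3 -> Prop) (h m : nat -> M3) g : seq_closed F -> lat_inv F ->
  (forall n, Y (m n)) -> (forall n, F (h n *m m n)) -> mlim h g ->
  forall M : M3 -> Prop, seq_closed M -> lat_inv M -> (forall n, M (m n)) ->
  exists m', M m' /\ F (g *m m').
Proof.
move=> Fc Fl Ym Fhm hg M Mc Ml Mm.
have [phi [c [L [hphi lc hL YL]]]] := seq_compact Ym.
exists L; split; first by apply: (Mc _ _ _ hL) => n; exact: Ml.
apply: (Fc (fun n => h (phi n) *m (m (phi n) *m c n))).
  by move=> n; rewrite mulmxA; apply: Fl.
by apply: mlimM => //; exact: mlim_sub.
Qed.

(** A uniform injectivity radius. If conjugates of nontrivial lattice elements tended to 1, then
    along a sequence of base points converging modulo [lat] they could be conjugated back to lattice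
    elements [d n] tending to 1, and these are trivial by discreteness. *)
Lemma uniform_injectivity : exists N0, forall g c, Y g -> lat c ->
  near N0 (g *m c *m invmx g) 1%:M -> c = 1%:M.
Proof.
apply: contrapT => nex.
have h1 (n : nat) : exists gc : M3 * M3, [/\ Y gc.1, lat gc.2,
    near n%:Z (gc.1 *m gc.2 *m invmx gc.1) 1%:M & gc.2 != 1%:M].
  apply: contrapT => nex2; apply: nex; exists n%:Z => g c Yg lc hn.
  by apply/eqP; apply: contrapT => h; apply: nex2; exists (g, c); split=> //; exact/negP.
have [f hf] := choice h1.
have [|phi [c [L [hphi lc hL YL]]]] := @seq_compact (fun n => (f n).1).
  by move=> n; case: (hf n).
pose a n := (f (phi n)).1 *m c n.
pose d n := invmx (c n) *m (f (phi n)).2 *m c n.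
have ug n : (f n).1 \in unitmx by apply: Yunit; case: (hf n).
have hd : mlim d 1%:M.
  have hq : mlim (fun n => (f (phi n)).1 *m (f (phi n)).2 *m invmx (f (phi n)).1) 1%:M.
    apply: (@mlim_sub _ _ _ _ (fun n => (f n).1 *m (f n).2 *m invmx (f n).1)) => //.
    by apply: near_lim => // q; case: (hf q).
  have hi := mlim_inv dw (Ydet0 YL) hL.
  have := mlimM dw (mlimM dw hi hq) hL; rewrite mulmx1 mulVmx ?Yunit //.
  apply: mlim_ext => n; rewrite /d.
  have uc := lat_unit (lc n).
  rewrite invmx_mul //.
  by rewrite !mulmxA mulmxKV // -!mulmxA (mulmxA (invmx (f (phi n)).1)) mulVmx // mul1mx !mulmxA.
have /mlim_near /(_ 1) [q hq] := hd.
have ld : lat (d q).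
  by apply: latM => //; apply: latM; [exact: latV|case: (hf (phi q))].
have /(lat_near1 ld) d1 : near 1 (d q) 1%:M by exact: hq.
case: (hf (phi q)) => _ _ _ /eqP; apply.
have uc := lat_unit (lc q).
have : c q *m d q *m invmx (c q) = (f (phi q)).2.
  by rewrite /d !mulmxA mulmxV // mul1mx mulmxK.
by rewrite d1 mulmx1 mulmxV.
Qed.

Hypothesis half : V 0 (2%:R^-1).

Lemma near_v1 N s : 0 <= N -> V N s -> near N (v1 s) 1%:M.
Proof.
move=> N0 hs; apply: ord3P; apply: ord3P; rewrite !mxE /= ?subrr ?subr0 //;
  try by left.
apply: ge_valMr => //; rewrite expr2; apply: ge_val_le (ge_valM dw hs hs); lia.
Qed.

Lemma near_v1_entry N s : near N (v1 s) 1%:M -> V N s.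
Proof. by move=> /(_ o0 o1); rewrite !mxE /= subr0. Qed.

Hypothesis complete : forall u : nat -> k,
  (forall n : int, exists N, forall m q, (N <= m)%N -> (N <= q)%N -> V n (u m - u q)) ->
  exists l, forall n : int, exists N, forall m, (N <= m)%N -> V n (u m - l).
Variable pi : k.
Hypotheses (pi0 : pi != 0) (wpi : w pi = 1).
Variable y0 : M3.
Hypothesis Yy0 : Y y0.

(* Since [Y] is compact and contains [v1 s *m y0] for every [s], on which small
   displacements are injective, the ring of integers is compact. *)
Lemma locally_compact (s : nat -> k) : (forall n, V 0 (s n)) ->
  exists (phi : nat -> nat) l, (forall n, (n <= phi n)%N) /\ lim (fun n => s (phi n)) l.
Proof.
move=> hs; have [N0 inj] := uniform_injectivity.
pose M := `|N0|%N; pose t n := pi ^+ M * s n.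
have wM : V M (pi ^+ M) by right; rewrite dvalX // wpi; lia.
have ht n : V M (t n) by apply: ge_valMr.
have [|phi [c [L [hphi lc hL YL]]]] := @seq_compact (fun n => v1 (t n) *m y0).
  by move=> n; apply: YH => //; exact: inH_v1.
pose a n := v1 (t (phi n)) *m y0 *m c n.
have Ya n : Y (a n) by apply: Ylat => //; apply: YH => //; exact: inH_v1.
have cau (J : int) : exists q0, forall m q, (q0 <= m)%N -> (q0 <= q)%N ->
    V J (t (phi m) - t (phi q)).
  have [q0 hq0] := mlim_quotient (Ydet0 YL) hL (Num.max J M%:Z).
  exists q0 => m q hm hq; set D := t (phi m) - t (phi q).
  have hn : near (Num.max J M%:Z) (a m *m invmx (a q)) 1%:M by exact: hq0.
  have uc := lat_unit (lc q).
  have am : a m = v1 D *m a q *m (invmx (c q) *m c m).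
    rewrite /a /D -!mulmxA (mulmxA (c q)) mulmxV // mul1mx !mulmxA v1D //.
    by rewrite subrK.
  have c1 : invmx (c q) *m c m = 1%:M.
    apply: (inj (a q)) => //; first by apply: latM => //; exact: latV.
    have -> : a q *m (invmx (c q) *m c m) *m invmx (a q) = v1 (- D) *m (a m *m invmx (a q)).
      by rewrite am !mulmxA v1N // mul1mx.
    apply: (near_le (N' := M%:Z)); first by rewrite /M; lia.
    apply: near1_mul => //; last by apply: near_le hn; rewrite le_max lexx orbT.
    by apply: near_v1 => //; apply: ge_valN => //; exact: ge_valB.
  move: hn; rewrite am c1 mulmx1 mulmxK; last exact: Yunit.
  by move=> /near_v1_entry; apply: ge_val_le; rewrite le_max lexx.
have [l hl] := complete cau.
exists phi, (pi ^- M * l); split=> //.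
apply: (lim_ext (u := fun n => pi ^- M * t (phi n))) => [n|].
  by rewrite /t mulKf // expf_neq0.
by apply: limM => //; exact: lim_cst.
Qed.

Lemma locally_compact_fin (N : nat) (c : 'I_N -> nat -> k) : (forall i n, V 0 (c i n)) ->
  exists (phi : nat -> nat) (l : 'I_N -> k), (forall n, (n <= phi n)%N) /\
    forall i, lim (fun n => c i (phi n)) (l i).
Proof.
elim: N c => [|N IH] c hc.
  by exists id, (fun=> 0); split=> // -[].
have [|phi [l [hphi hl]]] := IH (fun i => c (lift ord0 i)); first by move=> i n.
have [|psi [l0 [hpsi hl0]]] := @locally_compact (fun n => c ord0 (phi n)); first by [].
exists (fun n => phi (psi n)), (fun i => if unlift ord0 i is Some i' then l i' else l0).
split; first by move=> n; apply: leq_trans (hpsi n) _; exact: hphi.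
move=> i; case: unliftP => [i' ->|->] //.
exact: (lim_sub hpsi (hl i')).
Qed.

Lemma compl_open F : seq_closed F -> rel_open (fun g => ~ F g).
Proof.
move=> Fc g _ nFg; apply: contrapT => nex; apply: nFg.
have h1 (n : nat) : exists g', near n%:Z g' g /\ F g'.
  apply: contrapT => nex2; apply: nex; exists n%:Z => g' _ hn Fg'.
  by apply: nex2; exists g'.
have [f hf] := choice h1.
by apply: (Fc f); [move=> n; case: (hf n)|apply: near_lim => // n; case: (hf n)].
Qed.

Lemma compl_lat_inv F : lat_inv F -> lat_inv (fun g => ~ F g).
Proof.
move=> Fl g c nF lc h; apply: nF; have := Fl _ _ h (latV lc).
by rewrite mulmxK //; exact: lat_unit.
Qed.

(** Zorn's lemma applied to complements: the union of a chain of complements corresponds to the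
    intersection of nested closed sets, which is nonempty by compactness. *)
Lemma minimal_set (Y1 : M3 -> Prop) : (forall g, Y1 g -> Y g) -> (exists g, Y1 g) ->
  seq_closed Y1 -> lat_inv Y1 -> v1_inv Y1 ->
  exists M : M3 -> Prop, [/\ forall g, M g -> Y1 g, exists g, M g,
    [/\ seq_closed M, lat_inv M & v1_inv M] &
    forall M' : M3 -> Prop, (forall g, M' g -> M g) -> (exists g, M' g) ->
      seq_closed M' -> lat_inv M' -> v1_inv M' -> forall g, M g -> M' g].
Proof.
move=> Y1Y Y1n Y1c Y1l Y1v.
pose rest (A : set M3) g := Y1 g /\ ~ A g.
pose P (A : set M3) := [/\ seq_closed (rest A), lat_inv (rest A), v1_inv (rest A) &
  exists g, rest A g].
have chainP (F : set (set M3)) : (F `<=` P)%classic -> total_on F subset ->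
    P (\bigcup_(X in F) X)%classic.
  move=> FP Ftot.
  have restE g : rest (\bigcup_(X in F) X)%classic g <-> Y1 g /\ forall A, F A -> rest A g.
    split=> [[h1 h2]|[h1 h2]]; split=> //.
      by move=> A FA; split=> // Ag; apply: h2; exists A.
    by move=> [A FA Ag]; case: (h2 _ FA).
  split.
  - move=> U L hU hL; apply/restE; split.
      by apply: Y1c hL => n; case: (hU n).
    move=> A FA; case: (FP _ FA) => + _ _ _; apply; [|exact: hL] => n.
    by case/restE: (hU n) => _; apply.
  - move=> g c /restE [h1 h2] lc; apply/restE; split; first exact: Y1l.
    by move=> A FA; case: (FP _ FA) => _ + _ _; apply=> //; exact: h2.
  - move=> g s /restE [h1 h2]; apply/restE; split; first exact: Y1v.
    by move=> A FA; case: (FP _ FA) => _ _ + _; apply; exact: h2.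
  - apply: contrapT => nex.
    (* The index [None] stands for [Y1], so that the empty chain needs no separate treatment. *)
    pose FI (i : option {A | F A}) := if i is Some A then rest (sval A) else Y1.
    have FIc i : seq_closed (FI i) by case: i => [[A FA]|] //=; case: (FP _ FA).
    have FIl i : lat_inv (FI i) by case: i => [[A FA]|] //=; case: (FP _ FA).
    have FIn i : exists g, FI i g by case: i => [[A FA]|] //=; case: (FP _ FA).
    have FIt i j : (forall g, FI i g -> FI j g) \/ (forall g, FI j g -> FI i g).
      case: i j => [[A FA]|] [[B FB]|] /=; last by left.
      + case: (Ftot A B FA FB) => h; [right|left] => g [h1 h2]; split=> // h3; apply: h2; exact: h.
      + by left=> g [].
      + by right=> g [].
    have [i|i|g Yg|n [f hf]] := Ycompact (U := fun i g => ~ FI i g).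
    + exact: compl_open.
    + exact: compl_lat_inv.
    + apply: contrapT => h; apply: nex; exists g; apply/restE.
      have hall i : FI i g by apply: contrapT => h'; apply: h; exists i.
      split; first exact: (hall None).
      by move=> A FA; exact: (hall (Some (exist _ A FA))).
    have [i hi] : exists i, forall j, (j < n)%N -> forall g, FI i g -> FI (f j) g.
      elim: (n) => [|m [i hi]]; first by exists None.
      case: (FIt i (f m)) => h; [exists i|exists (f m)] => j; rewrite ltnS leq_eqVlt.
        by case/orP => [/eqP -> //|/hi].
      by case/orP => [/eqP -> //|/hi hj g hg]; apply: hj; exact: h.
    have [g hg] := FIn i.
    have Yg : Y g by apply: Y1Y; case: (i) hg => [[A FA] [] |].
    by have [j [jn]] := hf g Yg; apply; exact: hi.
have [A [[Ac Al Av An] maxA]] := Zorn_bigcup chainP.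
exists (rest A); split=> //; first by move=> g [].
move=> M' sub M'n M'c M'l M'v g hg; apply: contrapT => nM'.
apply: (maxA (fun g => ~ M' g)).
  split; first by move=> x Ax /sub [_].
  by move=> /(_ g nM'); case: hg.
have e x : rest (fun g => ~ M' g) x <-> M' x.
  split=> [[_ /contrapT //]|h]; split; first by case: (sub _ h).
  by move=> h'; exact: h'.
split.
- by move=> U L hU hL; apply/e; apply: M'c hL => n; apply/e.
- by move=> x c /e h lc; apply/e; exact: M'l.
- by move=> x s /e h; apply/e; exact: M'v.
- by case: M'n => x hx; exists x; apply/e.
Qed.

Lemma lim_uniformizer (j : nat -> nat) :
  (forall J, exists N, forall n, (N <= n)%N -> (J <= j n)%N) ->
  lim (fun n => pi ^+ j n) 0.
Proof.
move=> hj; apply: (lim0_intro (j := fun n => (j n)%:Z)) => [n|J].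
  by right; rewrite dvalX // wpi mulr1.
by have [N hN] := hj `|J|%N; exists N => n /hN; lia.
Qed.

Lemma first_failure (P : nat -> Prop) : P 0%N -> (exists m, ~ P m) -> exists j, P j /\ ~ P j.+1.
Proof.
move=> P0 [m nPm]; apply: contrapT => nex; apply: nPm.
by elim: m => [//|m IH]; apply: contrapT => h; apply: nex; exists m.
Qed.

(** [j n] is the largest exponent for which all quotients by weighted powers of [pi ^+ j n] are
    integral. Local compactness gives limits of these quotients, and maximality of [j n] prevents
    all limits from being 0. *)
Lemma rescale (N : nat) (c : 'I_N -> nat -> k) (wt : 'I_N -> nat) :
  (forall i, (0 < wt i)%N) -> (forall i, lim (c i) 0) -> (forall n, exists i, c i n != 0) ->
  exists (phi j : nat -> nat) (l : 'I_N -> k), [/\ forall n, (n <= phi n)%N,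
    forall J, exists N, forall n, (N <= n)%N -> (J <= j n)%N,
    forall i n, V 0 (c i (phi n) / (pi ^+ j n) ^+ wt i),
    forall i, lim (fun n => c i (phi n) / (pi ^+ j n) ^+ wt i) (l i) & exists i, l i != 0].
Proof.
move=> wt0 c0 cn.
pose good n j := forall i, V (wt i * j)%N (c i n).
have good_ev j : exists N0, forall n, (N0 <= n)%N -> good n j.
  have [f hf] := choice (fun i => c0 i (wt i * j)%N).
  exists (\max_i f i)%N => n hn i; rewrite -[c i n]subr0; apply: hf.
  exact: leq_trans (leq_bigmax _) hn.
have good_le n j j' : (j <= j')%N -> good n j' -> good n j.
  by move=> h hg i; apply: ge_val_le (hg i); rewrite lez_nat leq_mul2l h orbT.
have [N0 hN0] := good_ev 0%N.
have exj n : exists j, good (n + N0)%N j /\ ~ good (n + N0)%N j.+1.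
  apply: first_failure; first by apply: hN0; exact: leq_addl.
  have [i ci] := cn (n + N0)%N; exists (`|w (c i (n + N0)%N)|.+1)%N => /(_ i).
  by rewrite ge_valE // => h; have := wt0 i; nia.
have [j hj] := choice exj.
have hjoo J : exists N, forall n, (N <= n)%N -> (J <= j n)%N.
  have [N1 h1] := good_ev J; exists N1 => n hn; rewrite leqNgt; apply/negP => lt.
  case: (hj n) => _; apply; apply: (good_le _ _ J) => //; apply: h1.
  exact: leq_trans hn (leq_addr _ _).
have pin0 m : pi ^+ m != 0 by rewrite expf_neq0.
have wpin m : w (pi ^+ m) = m by rewrite dvalX // wpi mulr1.
pose d i n := c i (n + N0)%N / (pi ^+ j n) ^+ wt i.
have Vd i n (q : nat) : V (wt i * (j n + q))%N (c i (n + N0)%N) <-> V (wt i * q)%N (d i n).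
  rewrite /d -exprM; have [->|x0] := eqVneq (c i (n + N0)%N) 0.
    by rewrite mul0r; split; left.
  rewrite !ge_valE ?mulf_neq0 ?invr_eq0 // dvalM ?invr_eq0 // dvalV // wpin.
  by split; nia.
have hd i n : V 0 (d i n).
  have := Vd i n 0%N; rewrite addn0 muln0 => -[h _]; apply: h.
  by case: (hj n).
have [phi [l [hphi hl]]] := locally_compact_fin hd.
exists (fun n => (phi n + N0)%N), (fun n => j (phi n)), l; split.
- by move=> n; apply: leq_trans (hphi n) (leq_addr _ _).
- move=> J; have [N1 h1] := hjoo J; exists N1 => n hn; apply: h1.
  exact: leq_trans hn (hphi n).
- by move=> i n; exact: hd.
- by move=> i; exact: hl.
(* If all limits vanished, the quotient of index [i] would eventually have valuation at least
   [wt i], so that [j n] could be increased by 1. *)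
apply: contrapT => nex.
have l0 i : l i = 0 by apply/eqP; apply: contrapT => h; apply: nex; exists i; apply/negP.
have [f hf] := choice (fun i => hl i (wt i)).
pose n := (\max_i f i)%N.
case: (hj (phi n)) => _; apply=> i; rewrite -addn1; apply/Vd; rewrite muln1.
have := hf i n; rewrite l0 subr0; apply; exact: leq_bigmax.
Qed.

Lemma uniformizer_pow_inj : injective (fun n : nat => pi ^+ n).
Proof.
move=> m n /(congr1 w); rewrite !dvalX // wpi !mulr1 => /eqP.
by rewrite eqz_nat => /eqP.
Qed.

(** The powers of [pi] are infinitely many distinct points. *)
Lemma exists_nonroot (P : {poly k}) : P != 0 -> exists s, P.[s] != 0.
Proof.
move=> P0; apply: contrapT => nex.
have := @max_poly_roots _ P [seq pi ^+ i | i <- iota 0 (size P)] P0.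
rewrite size_map size_iota ltnn; case/(_ _ _)/Bool.diff_false_true => //.
  apply/allP => x /mapP [i _ ->]; rewrite rootE; apply/eqP.
  by apply/eqP; apply: contrapT => h; apply: nex; exists (pi ^+ i); apply/negP.
by rewrite map_inj_uniq ?iota_uniq //; exact: uniformizer_pow_inj.
Qed.

(** First order Taylor expansion with a polynomial difference quotient, valid in every
    characteristic. *)
Lemma horner_increment (P : {poly k}) s : exists d : {poly k},
  (forall e, P.[s + e] = P.[s] + e * d.[e]) /\ d.[0] = P^`().[s].
Proof.
elim/poly_ind: P => [|P c [d [h1 h2]]].
  by exists 0; rewrite deriv0 !horner0; split=> // e; rewrite !horner0 mulr0 addr0.
exists (s *: d + (P.[s])%:P + 'X * d).
split=> [e|]; first by rewrite !hornerE h1; ring.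
by rewrite derivD derivM derivX derivC !hornerE h2; ring.
Qed.

(* A homomorphism in [S] if [3 kap = 0]. *)
Definition un (kap S : k) := v1 S *m v2 (kap * S ^+ 3).

(** [sg] is the corner entry of [un kap S]. *)
Lemma gram_un (g : M3) kap S (sg := S ^+ 2 / 2%:R + kap * S ^+ 3)
    (a := gram g o0 o0) (b := gram g o0 o1) (c := gram g o0 o2)
    (d := gram g o1 o1) (e := gram g o1 o2) (f := gram g o2 o2) :
  gram (g *m un kap S) =
  let x01 := a * S + b in let x02 := a * sg + b * S + c in
  let x12 := a * S * sg + b * (S ^+ 2 + sg) + c * S + d * S + e in
  mx3 a x01 x02 x01 (a * S ^+ 2 + 2%:R * b * S + d) x12 x02 x12
    (a * sg ^+ 2 + 2%:R * b * S * sg + 2%:R * c * sg + d * S ^+ 2 + 2%:R * e * S + f).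
Proof.
have hM i j (A B : M3) : (A *m B) i j = A i o0 * B o0 j + A i o1 * B o1 j + A i o2 * B o2 j.
  exact: mulmx3E.
have hs : S ^+ 2 / 2%:R = sg - kap * S ^+ 3 by rewrite /sg; ring.
apply: mx3_ext; apply: ord3P; rewrite /a /b /c /d /e /f [RHS]mxE /= !gramE /un !hM;
  rewrite ![v1 _ _ _]mxE ![v2 _ _ _]mxE /= ?hs; ring.
Qed.

Lemma det_un kap S : \det (un kap S) = 1.
Proof. by rewrite /un det_mulmx det_v1 // det_v2 mulr1. Qed.

(** Indices are shifted by one: [l i] has degree [i.+1], which is also the weight with which it is
    rescaled in [gram_limit]. *)
Definition curve (l : nat -> k) s :=
  l 0%N * s + l 1%N * s ^+ 2 + l 2%N * s ^+ 3 + l 3%N * s ^+ 4 + l 4%N * s ^+ 5.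

(* In the limit the [un kap]-orbit of the form [gram g] is [mxJ + curve l s E33]; all the
   other entries are controlled by the five coefficients that make up [curve].  The
   hypothesis on [3 kap] holds since [kap = 0] outside characteristic 3. *)
Lemma gram_limit (g : nat -> M3) (kap th : nat -> k) (l : nat -> k) :
  mlim (fun n => gram (g n)) (mxJ k) ->
  (forall n, th n != 0) -> lim th 0 -> (forall n, 3%:R * kap n = 0) ->
  lim (fun n => kap n / th n) 0 ->
  lim (fun n => 2%:R * gram (g n) o1 o2 / th n ^+ 1) (l 0%N) ->
  lim (fun n => (gram (g n) o0 o2 + gram (g n) o1 o1) / th n ^+ 2) (l 1%N) ->
  lim (fun n => (gram (g n) o0 o1 + 2%:R * gram (g n) o0 o2 * kap n) / th n ^+ 3) (l 2%N) ->
  lim (fun n => (gram (g n) o0 o0 / 4%:R + 2%:R * gram (g n) o0 o1 * kap n) / th n ^+ 4) (l 3%N) ->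
  lim (fun n => gram (g n) o0 o0 * kap n / th n ^+ 5) (l 4%N) ->
  forall s, mlim (fun n => gram (g n *m un (kap n) (s / th n))) (gram (v2 (curve l s / 2%:R))).
Proof.
move=> hG th0 hth k3 hkt.
have four0 : (4%:R : k) != 0 by rewrite -[4%N]/(2 * 2)%N natrM mulf_neq0.
pose a n := gram (g n) o0 o0; pose b n := gram (g n) o0 o1; pose c n := gram (g n) o0 o2.
pose d n := gram (g n) o1 o1; pose e n := gram (g n) o1 o2; pose f n := gram (g n) o2 o2.
have la : lim a 0 by have := hG o0 o0; rewrite mxE.
have lb : lim b 0 by have := hG o0 o1; rewrite mxE.
have lc : lim c 1 by have := hG o0 o2; rewrite mxE.
have ld : lim d (-1) by have := hG o1 o1; rewrite mxE.
have le : lim e 0 by have := hG o1 o2; rewrite mxE.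
have lf : lim f 0 by have := hG o2 o2; rewrite mxE.
(* [E], [La], [W], [X], [Z] are the coefficients of [s] up to [s ^+ 5] in the lower right entry of
   the transported form; that of [s ^+ 6] is [Z n * kt n] and tends to 0. *)
pose E n := 2%:R * e n / th n ^+ 1; pose La n := (c n + d n) / th n ^+ 2.
pose W n := (b n + 2%:R * c n * kap n) / th n ^+ 3.
pose X n := (a n / 4%:R + 2%:R * b n * kap n) / th n ^+ 4.
pose Z n := a n * kap n / th n ^+ 5; pose kt n := kap n / th n.
rewrite -/a -/b -/c -/d -/e -/E -/La -/W -/X -/Z => hE hLa hW hX hZ s.
have hkt' : lim kt 0 by exact: hkt.
pose bt n := b n / th n; pose att n := a n / th n ^+ 2.
have hbt : lim bt 0.
  apply: (lim_ext (u := fun n => W n * th n ^+ 2 - 2%:R * c n * kt n)).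
    by move=> n; rewrite /W /kt /bt; field; rewrite th0.
  by lim_tac dw; ring.
have hatt : lim att 0.
  apply: (lim_ext (u := fun n => 4%:R * (X n * th n ^+ 2 - 2%:R * bt n * kt n))).
    by move=> n; rewrite /X /kt /bt /att; field; rewrite th0 four0.
  by lim_tac dw; ring.
have key n : gram (g n *m un (kap n) (s / th n)) =
   mx3 (a n) (s * (att n * th n) + b n)
     (att n * s ^+ 2 / 2%:R + Z n * th n ^+ 2 * s ^+ 3 + bt n * s + c n)
     (s * (att n * th n) + b n) (att n * s ^+ 2 + 2%:R * bt n * s + d n)
     (e n + La n * th n * s + 3%:R / 2%:R * W n * th n * s ^+ 2 + 2%:R * X n * th n * s ^+ 3
        + Z n * th n * s ^+ 4)
     (att n * s ^+ 2 / 2%:R + Z n * th n ^+ 2 * s ^+ 3 + bt n * s + c n)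
     (e n + La n * th n * s + 3%:R / 2%:R * W n * th n * s ^+ 2 + 2%:R * X n * th n * s ^+ 3
        + Z n * th n * s ^+ 4)
     (f n + E n * s + La n * s ^+ 2 + W n * s ^+ 3 + X n * s ^+ 4 + Z n * s ^+ 5
        + Z n * kt n * s ^+ 6).
  rewrite gram_un /= -/(a n) -/(b n) -/(c n) -/(d n) -/(e n) -/(f n).
  have e12 : a n * (s / th n) * ((s / th n) ^+ 2 / 2%:R + kap n * (s / th n) ^+ 3)
     + b n * ((s / th n) ^+ 2 + ((s / th n) ^+ 2 / 2%:R + kap n * (s / th n) ^+ 3))
     + c n * (s / th n) + d n * (s / th n) + e n =
     e n + La n * th n * s + 3%:R / 2%:R * W n * th n * s ^+ 2 + 2%:R * X n * th n * s ^+ 3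
        + Z n * th n * s ^+ 4.
    (* The two sides differ by a multiple of [3 * kap n], which is zero. *)
    rewrite -[LHS]addr0 -(mul0r (c n * (s / th n) ^+ 2 + b n * (s / th n) ^+ 3)) -(k3 n).
    by rewrite /La /W /X /Z; field; rewrite th0 four0.
  congr mx3 => //; rewrite /E /La /W /X /Z /kt /bt /att; field; by rewrite ?th0 ?four0.
apply: mlim_ext => [n|]; first by rewrite key.
rewrite gram_v2 /mlim; apply: ord3P; apply: ord3P; rewrite !mxE /=;
  (apply: lim_ext => [n|]; [by rewrite mxE /=|]); lim_tac dw; rewrite ?/curve; field;
  by rewrite ?two0.
Qed.

(** * Displacements of a minimal set *)

Section MinimalSet.
Variable M : M3 -> Prop.
Hypotheses (MY : forall g, M g -> Y g) (Mn : exists g, M g).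
Hypotheses (Mc : seq_closed M) (Ml : lat_inv M) (Mv : v1_inv M).
Hypothesis Mmin : forall M' : M3 -> Prop, (forall g, M' g -> M g) -> (exists g, M' g) ->
  seq_closed M' -> lat_inv M' -> v1_inv M' -> forall g, M g -> M' g.

(** As [g] normalizes [v1], the points of [M] that [g] sends into [F] form a closed invariant
    subset; by minimality it is all of [M] once it is nonempty. *)
Lemma normalizer_sub g (F : M3 -> Prop) : (forall s, exists s', v1 s' *m g = g *m v1 s) ->
  seq_closed F -> lat_inv F -> v1_inv F ->
  forall m, M m -> F (g *m m) -> forall m', M m' -> F (g *m m').
Proof.
move=> hg Fc Fl Fv m Mm Fm m' Mm'.
suff [] : M m' /\ F (g *m m') by [].
apply: (Mmin (M' := fun x => M x /\ F (g *m x))) => //; first by move=> x [].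
- by exists m.
- move=> U L hU hL; split; first by apply: Mc hL => n; case: (hU n).
  apply: (Fc (fun n => g *m U n)); first by move=> n; case: (hU n).
  by apply: mlimM => //; exact: mlim_cst.
- by move=> x c [h1 h2] lc; split; [exact: Ml|rewrite mulmxA; exact: Fl].
- move=> x s [h1 h2]; split; first exact: Mv.
  by have [s' hs'] := hg s; rewrite mulmxA -hs' -mulmxA; exact: Fv.
Qed.

Lemma Yv1 : v1_inv Y.
Proof. by move=> g s; apply: YH; exact: inH_v1. Qed.

(* Two far apart points of one [v1]-orbit are close modulo [lat].  If the displacement [g]
   were upper triangular, then a nontrivial upper triangular matrix with diagonal close to
   [1] would stabilize a point of [Y]; contracting it with [dg] contradicts injectivity. *)
Lemma returns N : exists m g, [/\ M m, \det g = 1, near N g 1%:M, M (g *m m) &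
  ~ [/\ g o1 o0 = 0, g o2 o0 = 0 & g o2 o1 = 0]].
Proof.
have [m0 Mm0] := Mn; have [N0 inj] := uniform_injectivity.
pose J : int := (`|N|%N + `|N0|%N + 1)%N.
have J1 : 1 <= J by rewrite /J; lia.
have piV (n : nat) : pi ^- n != 0 by rewrite invr_eq0 expf_neq0.
have [|phi [c [L [hphi lc hL YL]]]] := @seq_compact (fun n => v1 (pi ^- n) *m m0).
  by move=> n; apply: MY; exact: Mv.
pose a n := v1 (pi ^- phi n) *m m0 *m c n.
have Ma n : M (a n) by apply: Ml => //; exact: Mv.
have [q0 hq0] := mlim_quotient (Ydet0 YL) hL J.
(* Taking [j] beyond [phi i] makes the two times [pi ^- phi i] and [pi ^- phi j] differ in
   valuation. *)
pose i := q0; pose j := maxn q0 (phi q0).+1.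
have phij : (phi i < phi j)%N.
  by apply: leq_trans (hphi j); rewrite /j leq_maxr.
pose g := a j *m invmx (a i).
have hg : near J g 1%:M by apply: hq0 => //; exact: leq_maxl.
have ua n : a n \in unitmx by apply: Yunit; exact: MY.
have dg1 : \det g = 1.
  by rewrite /g det_mulmx det_inv !(Ydet (MY _)) // divff.
have gai : g *m a i = a j by rewrite /g mulmxKV.
clearbody g; exists (a i), g; split=> //.
- by apply: near_le hg; rewrite /J; lia.
- by rewrite gai.
move=> [g10 g20 g21].
pose D := pi ^- phi j - pi ^- phi i.
have uc n := lat_unit (lc n).
have aj : a j = v1 D *m a i *m (invmx (c i) *m c j).
  rewrite /a /D -!mulmxA (mulmxA (c i)) mulmxV // mul1mx !mulmxA v1D //.
  by rewrite subrK.
pose e := v1 (- D) *m g.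
have he : a i *m (invmx (c i) *m c j) *m invmx (a i) = e.
  rewrite /e.
  have -> : g = v1 D *m (a i *m (invmx (c i) *m c j) *m invmx (a i)).
    apply: (can_inj (mulmxK (ua i))); rewrite gai aj -!mulmxA.
    by rewrite mulVmx // mulmx1.
  by rewrite mulmxA v1N // mul1mx.
(* Conjugation by [dg x] keeps the diagonal of [e] and multiplies the entries above it by positive
   powers of [x]. With entries of [e] bounded by [b], the exponent [B] brings the conjugate within
   the injectivity radius. *)
have c1 : invmx (c i) *m c j = 1%:M.
  have [b hb] := mx_bounded w e.
  pose B := (`|J| + `|b|)%N; pose x := pi ^+ B.
  have x0 : x != 0 by rewrite expf_neq0.
  have Vx : V B x by right; rewrite dvalX // wpi; lia.
  have hx := inH_dg x0.
  apply: (inj (dg x *m a i)); first by apply: YH => //; exact: MY.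
    by apply: latM => //; exact: latV.
  have -> : dg x *m a i *m (invmx (c i) *m c j) *m invmx (dg x *m a i)
     = dg x *m e *m invmx (dg x).
    have ud : dg x \in unitmx := inH_unit hx.
    by rewrite -he invmx_mul // !mulmxA.
  have dxV : invmx (dg x) = dg x^-1.
    by rewrite -[LHS]mulmx1 -(dgV x0) mulmxA mulVmx ?mul1mx //; exact: inH_unit.
  have e10 : e o1 o0 = 0 by rewrite /e v1_mul_row2 g10 g20 mulr0 addr0.
  have e20 : e o2 o0 = 0 by rewrite /e v1_mul_row3.
  have e21 : e o2 o1 = 0 by rewrite /e v1_mul_row3.
  have e11 : e o1 o1 = g o1 o1 by rewrite /e v1_mul_row2 g21 mulr0 addr0.
  have e22 : e o2 o2 = g o2 o2 by rewrite /e v1_mul_row3.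
  have e00 : e o0 o0 = g o0 o0.
    by rewrite /e mulmx3E !mxE /= g10 g20; ring.
  have small q (y : k) : (0 < q)%N -> V b y -> V N0 (x ^+ q * y).
    move=> q0' hy; apply: (@ge_val_le _ _ N0 (B%:Z + b)); first by rewrite /B; lia.
    apply: ge_valM => //; case: q q0' => // q _; rewrite exprS.
    by apply: ge_valMr => //; apply: ge_valX => //; apply: ge_val_le Vx; lia.
  have hgJ r s : V N0 (g r s - (1%:M : M3) r s).
    by apply: ge_val_le (hg r s); rewrite /J; lia.
  rewrite dxV; clearbody e.
  have E : dg x *m e *m dg x^-1 = mx3 (g o0 o0) (x ^+ 1 * e o0 o1) (x ^+ 2 * e o0 o2)
      0 (g o1 o1) (x ^+ 1 * e o1 o2) 0 0 (g o2 o2).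
    apply: mx3_ext; apply: ord3P; rewrite !mulmx3E [in RHS]mxE /= -?e00 -?e11 -?e22;
      rewrite ![dg _ _ _]mxE /= ?e10 ?e20 ?e21 ?invrK; by field.
  rewrite E; apply: ord3P; apply: ord3P; rewrite [mx3 _ _ _ _ _ _ _ _ _ _ _]mxE /=;
    rewrite ?[(1%:M : M3) _ _]mxE /= ?subr0; first [exact: small|by left|idtac].
  + by have := hgJ o0 o0; rewrite mxE.
  + by have := hgJ o1 o1; rewrite mxE.
  + by have := hgJ o2 o2; rewrite mxE.
(* So [v1 D] is close to 1 and [D] is integral, although [D] has the negative valuation of
   [pi ^- phi j]. *)
have gv : g = v1 D.
  by apply: (can_inj (mulmxK (ua i))); rewrite gai aj c1 mulmx1.
have := near_v1_entry (_ : near J (v1 D) 1%:M); rewrite -gv => /(_ hg) VD.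
have : V (- (phi i)%:Z) (pi ^- phi j).
  rewrite -(subrK (pi ^- phi i) (pi ^- phi j)) -/D; apply: ge_valD => //.
    by apply: ge_val_le VD; lia.
  by right; rewrite dvalV ?expf_neq0 // dvalX // wpi mulr1.
rewrite ge_valE // dvalV ?expf_neq0 // dvalX // wpi mulr1; lia.
Qed.

Lemma v2_normalizes (b s : k) : exists s', v1 s' *m v2 b = v2 b *m v1 s.
Proof. by exists s; rewrite v1v2. Qed.

(** The cofactor [c ^+ 2 + c + 1] tends to 3; in characteristic 3 cubing is injective instead. This
    serves below where a determinant shows that a Gram entry close to 1 has cube 1. *)
Lemma cube_root_near1 (c : nat -> k) : lim c 1 ->
  exists N, forall n, (N <= n)%N -> c n ^+ 3 = 1 -> c n = 1.
Proof.
move=> hc; have [three0|three0] := eqVneq (3%:R : k) 0.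
  exists 0%N => n _ h; apply/eqP; rewrite -subr_eq0.
  suff : (c n - 1) ^+ 3 == 0 by rewrite expf_eq0.
  have -> : (c n - 1) ^+ 3 = c n ^+ 3 - 1 - 3%:R * (c n ^+ 2 - c n) by ring.
  by rewrite h subrr three0 mul0r subr0.
have h3 : lim (fun n => c n ^+ 2 + c n + 1) 3%:R by lim_tac dw; ring.
have [N hN] := lim_unit dw h3 three0; exists N => n /hN [h0 _] h.
apply/eqP; rewrite -subr_eq0 -(mulIr_eq0 _ (mulIf h0)).
have -> : (c n - 1) * (c n ^+ 2 + c n + 1) = c n ^+ 3 - 1 by ring.
by rewrite h subrr.
Qed.

Lemma uniformizer_theta (j : nat -> nat) :
  (forall J, exists N, forall n, (N <= n)%N -> (J <= j n)%N) ->
  lim (fun n => pi ^+ j n) 0 /\ forall n, pi ^+ j n != 0.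
Proof. by move=> hj; split; [exact: lim_uniformizer|move=> n; rewrite expf_neq0]. Qed.

Definition curve_poly (l : nat -> k) : {poly k} :=
  \poly_(i < 6) (if i is i'.+1 then l i' else 0).

Lemma curve_polyE l s : (curve_poly l).[s] = curve l s.
Proof.
rewrite horner_poly !big_ord_recl big_ord0 /curve /= /bump /=; ring.
Qed.

Lemma curve_poly_neq0 l i : (i < 5)%N -> l i != 0 -> curve_poly l != 0.
Proof.
move=> i5 li; apply: contra li => /eqP /polyP /(_ i.+1).
by rewrite coef_poly ltnS i5 coef0 => /eqP.
Qed.

(** By [normalizer_sub] it suffices to send one point of [M] into [Y]. If all relevant coefficients
    of some late [gram (g0 n)] vanish, then [g0 n] already agrees with some [v2 f] up to an
    isometry. Otherwise the coefficients are rescaled, and [H_section] realizes the limit form by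
    [v2 f]. *)
Lemma transverse_translate m0 : M m0 ->
  (forall N, exists g, [/\ \det g = 1, near N g 1%:M, ~ inH g & Y (g *m m0)]) ->
  exists f, f != 0 /\ forall m, M m -> Y (v2 f *m m).
Proof.
move=> Mm0 htr.
have four0 : (4%:R : k) != 0 by rewrite -[4%N]/(2 * 2)%N natrM mulf_neq0.
have [g0 hg0] := choice (fun n : nat => htr n%:Z).
have tosub f : Y (v2 f *m m0) -> forall m, M m -> Y (v2 f *m m).
  move=> Yf; apply: (normalizer_sub _ _ _ _ Mm0 Yf) => //; [exact: v2_normalizes|exact: Yv1].
have g0lim : mlim g0 1%:M by apply: near_lim => // n; case: (hg0 n).
have G0 : mlim (fun n => gram (g0 n)) (mxJ k).
  have -> : mxJ k = gram 1%:M by rewrite /gram trmx1 mul1mx mulmx1.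
  by apply: mlimM => //; apply: mlimM; [by []|exact: mlim_tr|exact: mlim_cst].
pose cf (i : nat) (g : M3) := match i with
  | 0 => 2%:R * gram g o1 o2 | 1 => gram g o0 o2 + gram g o1 o1
  | 2 => gram g o0 o1 | _ => gram g o0 o0 / 4%:R end.
have [N1 hN1] : exists N, forall n, (N <= n)%N ->
    gram (g0 n) o0 o2 ^+ 3 = 1 -> gram (g0 n) o0 o2 = 1.
  by apply: cube_root_near1; have := G0 o0 o2; rewrite mxE.
have [[n [nN1 hz]]|nz] := pselect (exists n, (N1 <= n)%N /\ forall i : 'I_4, cf i (g0 n) = 0).
  have [dg _ nH Yg] := hg0 n; set g := g0 n in dg nH Yg hz.
  have z0 : gram g o1 o2 = 0.
    have : 2%:R * gram g o1 o2 = 0 := hz (@Ordinal 4 0 isT).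
    by move=> /eqP; rewrite mulf_eq0 (negPf two0) => /eqP.
  have z1 : gram g o1 o1 = - gram g o0 o2.
    have : gram g o0 o2 + gram g o1 o1 = 0 := hz (@Ordinal 4 1 isT).
    by move=> /eqP; rewrite addrC addr_eq0 => /eqP.
  have z2 : gram g o0 o1 = 0 := hz (@Ordinal 4 2 isT).
  have z3 : gram g o0 o0 = 0.
    have : gram g o0 o0 / 4%:R = 0 := hz (@Ordinal 4 3 isT).
    by move=> /eqP; rewrite mulf_eq0 invr_eq0 (negPf four0) orbF => /eqP.
  have z4 : gram g o0 o2 = 1.
    apply: hN1 => //; have := gram_det g; rewrite dg expr1n det3.
    rewrite z3 z2 z1 z0 (gram_sym g o1 o0) z2 (gram_sym g o2 o0) (gram_sym g o2 o1) z0 => <-.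
    ring.
  rewrite z4 in z1.
  pose f := gram g o2 o2 / 2%:R; exists f.
  have Gf : gram g = gram (v2 f).
    rewrite gram_v2; apply: mx3_ext; apply: ord3P; rewrite [RHS]mxE /= ?z0 ?z1 ?z2 ?z3 ?z4 //;
      rewrite gram_sym ?z0 ?z2 ?z4 //.
    by rewrite /f; field.
  have ug := unit_det1 dg.
  have hH : inH (v2 f *m invmx g).
    split; first by rewrite det_mulmx det_v2 det_inv1 ?mulr1.
    by rewrite gram_mul -Gf -gram_mul mulmxV // /gram trmx1 mul1mx mulmx1.
  split.
    apply/eqP => f0; apply: nH; split=> //.
    by rewrite Gf f0 v20 /gram trmx1 mul1mx mulmx1.
  by apply: tosub; have := YH hH Yg; rewrite -mulmxA (mulmxA (invmx g)) mulVmx ?mul1mx.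
pose g n := g0 (n + N1)%N.
have gP n : \det (g n) = 1 /\ Y (g n *m m0) by case: (hg0 (n + N1)%N).
have gG : mlim (fun n => gram (g n)) (mxJ k).
  by apply: (mlim_sub (phi := fun n => (n + N1)%N) _ G0) => n; exact: leq_addr.
have [||n|phi [j [l [hphi hj _ hl [i0 li0]]]]] :=
    @rescale 4 (fun i n => cf i (g n)) (fun i => i.+1); first by [].
- have c00 := gG o0 o0; have c01 := gG o0 o1; have c02 := gG o0 o2.
  have c11 := gG o1 o1; have c12 := gG o1 o2; rewrite !mxE /= in c00 c01 c02 c11 c12.
  by case=> [[|[|[|[|//]]]] hi] /=; lim_tac dw; ring.
- apply: contrapT => nex; apply: nz; exists (n + N1)%N; split; first exact: leq_addl.
  by move=> i; apply/eqP; apply: contrapT => h; apply: nex; exists i; apply/negP.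
have [hth th0] := uniformizer_theta hj.
(* With [kap = 0] there is no term of degree 5; its coefficient is filled with 0. *)
pose l' i := if (i < 4)%N then l (inord i) else 0.
have hl' i (hi : (i < 4)%N) :
    lim (fun n => cf i (g (phi n)) / (pi ^+ j n) ^+ i.+1) (l' i).
  rewrite /l' hi; have := hl (inord i); by rewrite inordK.
have hlim := @gram_limit (fun n => g (phi n)) (fun=> 0) (fun n => pi ^+ j n) l'
  (mlim_sub hphi gG) th0 hth.
have lc := lim_cst w (0 : k).
have drop (x y : k) : x = x + y * 0 by rewrite mulr0 addr0.
have {}hlim s := hlim (fun=> mulr0 _) (lim_ext (fun n => esym (mul0r _)) lc)
  (hl' 0%N isT) (hl' 1%N isT)
  (lim_ext (fun n => congr1 (fun x => x / _) (drop _ _)) (hl' 2%N isT))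
  (lim_ext (fun n => congr1 (fun x => x / _) (drop _ _)) (hl' 3%N isT))
  (lim_ext (fun n => esym (etrans (congr1 (fun x => x / _) (mulr0 _)) (mul0r _))) lc) s.
have [s hs] : exists s, (curve_poly l').[s] != 0.
  apply: exists_nonroot; apply: (@curve_poly_neq0 _ i0).
    by apply: leq_trans (ltn_ord i0) _.
  by rewrite /l' ltn_ord inord_val.
rewrite curve_polyE in hs; set f := curve l' s / 2%:R.
have f0 : f != 0 by rewrite mulf_neq0 ?invr_eq0.
pose un0 n := un 0 (s / pi ^+ j n).
pose q n := g (phi n) *m un0 n.
have dq n : \det (q n) = 1.
  by rewrite det_mulmx det_un mulr1; case: (gP (phi n)).
have uf : v2 f \in unitmx by apply: unit_det1; exact: det_v2.
have [h [hH hlimh]] : exists h : nat -> M3, (forall n, inH (h n)) /\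
    mlim (fun n => h n *m (q n *m invmx (v2 f))) 1%:M.
  apply: (H_section dw two0 half complete).
    by move=> n; rewrite det_mulmx dq det_inv1 ?mulr1 // det_v2.
  have -> : mxJ k = (invmx (v2 f))^T *m gram (v2 f) *m invmx (v2 f).
    by rewrite -gram_mul mulmxV // /gram trmx1 mul1mx mulmx1.
  apply: (mlim_ext (U := fun n => (invmx (v2 f))^T *m gram (q n) *m invmx (v2 f))) => [n|].
    by rewrite [RHS]gram_mul.
  apply: mlimM => //; last exact: mlim_cst.
  by apply: mlimM => //; [exact: mlim_cst|exact: hlim].
have hq : mlim (fun n => h n *m q n) (v2 f).
  have := mlimM dw hlimh (mlim_cst w (v2 f)); rewrite mul1mx; apply: mlim_ext => n.
  by rewrite -!mulmxA mulVmx // mulmx1.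
exists f; split=> //.
(* The shift along [v1] is undone on the side of [M]: [q n *m mm n] is [g (phi n) *m m0], which lies
   in [Y]. *)
pose mm n := v1 (- (s / pi ^+ j n)) *m m0.
have Mmm n : M (mm n) by exact: Mv.
have [||m' [Mm' Ym']] := limit_in_closed Yclosed Ylat _ _ hq Mc Ml Mmm.
- by move=> n; exact: MY.
- move=> n; rewrite -mulmxA; apply: YH => //; rewrite /q /un0 /un mul0r v20 mulmx1 /mm.
  rewrite -mulmxA (mulmxA (v1 _)) v1D // subrr v10 // mul1mx.
  by case: (gP (phi n)).
apply: (normalizer_sub _ _ _ _ Mm' Ym') => //; [exact: v2_normalizes|exact: Yv1].
Qed.

(* Only [b = 0] satisfies this outside characteristic 3. *)
Definition cubic_invariance (b : k) :=
  3%:R * b = 0 /\ forall s m, M m -> M (v2 (b * s ^+ 3) *m m).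
Local Notation L := cubic_invariance.

Lemma cubic0 : L 0.
Proof. by split=> [|s m Mm]; rewrite ?mulr0 // mul0r v20 mul1mx. Qed.

Lemma cubicD b c : L b -> L c -> L (b + c).
Proof.
move=> [b3 hb] [c3 hc]; split=> [|s m Mm]; first by rewrite mulrDr b3 c3 addr0.
by rewrite mulrDl -v2D -mulmxA; apply: hb; exact: hc.
Qed.

Lemma cubicZ b t : L b -> L (b * t ^+ 3).
Proof.
move=> [b3 hb]; split=> [|s m Mm]; first by rewrite mulrA b3 mul0r.
by rewrite -mulrA -exprMn; exact: hb.
Qed.

Lemma cubic_closed (u : nat -> k) l : (forall n, L (u n)) -> lim u l -> L l.
Proof.
move=> hu ul; split.
  have h : lim (fun n => 3%:R * u n) (3%:R * l) by apply: limM => //; exact: lim_cst.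
  apply: (lim_unique dw h); apply: (lim_ext (u := fun=> 0)); last exact: lim_cst.
  by move=> n; case: (hu n).
move=> s m Mm; apply: (Mc (U := fun n => v2 (u n * s ^+ 3) *m m)).
  by move=> n; case: (hu n) => _; apply.
apply: mlimM => //; last exact: mlim_cst.
have h : lim (fun n => u n * s ^+ 3) (l * s ^+ 3) by apply: limM => //; exact: lim_cst.
rewrite /mlim; apply: ord3P; apply: ord3P; rewrite !mxE /=;
  (apply: lim_ext => [n|]; [by rewrite mxE /=|]) => //; exact: lim_cst.
Qed.

(** A best approximation exists: either the valuations of [b + c * kap'] are unbounded, and then
    [- b / c] itself is admissible since the condition is closed, or they are bounded and, being
    integers, attain their maximum. *)
Lemma cubic_minimizer (b c : k) : exists kap, L kap /\
  forall kap' n, L kap' -> V n (b + c * kap') -> V n (b + c * kap).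
Proof.
have [c0|c0] := eqVneq c 0.
  by exists 0; split; [exact: cubic0|move=> kap' n _; rewrite c0 !mul0r].
pose S n := exists kap', L kap' /\ V n (b + c * kap').
have [hS|hS] := pselect (forall n : nat, S n).
  have [f hf] := choice hS.
  have h : lim (fun n => b + c * f n) 0.
    by apply: (lim0_intro (j := fun n => n%:Z)) => [n|J]; [case: (hf n)|exists `|J|%N => n; lia].
  exists (- b / c); split; last first.
    by move=> kap' n _ _; left; rewrite mulrC mulfVK // subrr.
  apply: (cubic_closed (u := f)); first by move=> n; case: (hf n).
  apply: (lim_ext (u := fun n => (b + c * f n - b) / c)) => [n|].
    by rewrite addrAC subrr add0r mulrC mulKf.
  by apply: limM => //; [lim_tac dw; rewrite sub0r|exact: lim_cst].
have [n0 hn0] := ge_val_bounded w b.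
have [j [[kap [Lk hk]] nj]] : exists j : nat, S (n0 + j) /\ ~ S (n0 + j.+1).
  apply: (@first_failure (fun j => S (n0 + j%:Z))).
    by exists 0; split; [exact: cubic0|rewrite mulr0 !addr0].
  apply: contrapT => nex; apply: hS => n.
  have h : S (n0 + (`|n0| + n)%N%:Z) by apply: contrapT => h; apply: nex; exists (`|n0| + n)%N.
  by case: h => kap [Lk hk]; exists kap; split=> //; apply: ge_val_le hk; lia.
exists kap; split=> // kap' n Lk' hk'; apply: ge_val_le hk.
rewrite leNgt; apply/negP => lt; apply: nj; exists kap'; split=> //.
by apply: ge_val_le hk'; lia.
Qed.

(* If [kap] were large, then [b], [a] and finally [a * kap] would be forced to be as large
   as [kap], [kap ^+ 2] and [kap ^+ 3], against the last bound. *)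
Lemma kappa_small (kap a b c th : k) : th != 0 -> 1 <= w th -> c != 0 -> w c = 0 ->
  V 0 ((b + 2%:R * c * kap) / th ^+ 3) -> V 0 ((a / 4%:R + 2%:R * b * kap) / th ^+ 4) ->
  V 0 (a * kap / th ^+ 5) -> V 0 (kap ^+ 2 / th ^+ 3).
Proof.
move=> th0 wth c0 wc.
have four0 : (4%:R : k) != 0 by rewrite -[4%N]/(2 * 2)%N natrM mulf_neq0.
have Vth (q : nat) x : V 0 (x / th ^+ q) -> V (q%:Z * w th) x.
  move=> h; rewrite -(mulfVK (expf_neq0 q th0) x) -[q%:Z * _]add0r.
  by apply: ge_valM => //; right; rewrite dvalX.
move=> /Vth hw /Vth hx /Vth hy.
have [->|k0] := eqVneq kap 0; first by rewrite expr0n /= mul0r; left.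
rewrite ge_valE ?mulf_neq0 ?invr_eq0 ?expf_neq0 // dvalM ?invr_eq0 ?expf_neq0 //.
rewrite dvalV ?expf_neq0 // !dvalX // leNgt; apply/negP => lt.
set W := b + _ in hw; set X := _ + 2%:R * b * kap in hx; set Z := a * kap in hy.
(* In [Z - 4 X kap + 8 W kap^2] the terms with [a] and [b] cancel, leaving [16 c kap^3]. *)
have id : kap ^+ 3 = (Z - 4%:R * (X * kap) + 8%:R * (W * kap ^+ 2)) * (2%:R^-1 ^+ 4 * c^-1).
  by rewrite /Z /X /W; field; rewrite c0 two0 four0.
have Vk : V (w kap) kap by right.
have : V (w kap + w kap + w kap + 1) (kap ^+ 3).
  rewrite id; apply: ge_valMr => //; last first.
    by apply: ge_valMl => //; [exact: ge_valX|right; rewrite dvalV // wc].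
  apply: ge_valD => //; [apply: ge_valB => //|].
  - by apply: ge_val_le hy; lia.
  - apply: ge_valMl => //; first exact: ge_val_nat.
    by apply: ge_val_le (ge_valM dw hx Vk); lia.
  - apply: ge_valMl => //; first exact: ge_val_nat.
    have := ge_valM dw hw (ge_valM dw Vk Vk); rewrite -expr2; apply: ge_val_le; lia.
rewrite ge_valE ?expf_neq0 // dvalX //; lia.
Qed.

Lemma un_inv kap S : un kap S *m (v2 (kap * (- S) ^+ 3) *m v1 (- S)) = 1%:M.
Proof.
rewrite /un -mulmxA (mulmxA (v2 _) (v2 _)) v2D.
have -> : kap * S ^+ 3 + kap * (- S) ^+ 3 = 0 by ring.
by rewrite v20 mul1mx v1D // subrr v10.
Qed.

Lemma un_row3 (g : M3) kap S :
  [/\ (g *m un kap S) o2 o0 = g o2 o0, (g *m un kap S) o2 o1 = g o2 o0 * S + g o2 o1 &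
   (g *m un kap S) o2 o2 =
     g o2 o0 * (S ^+ 2 / 2%:R + kap * S ^+ 3) + g o2 o1 * S + g o2 o2].
Proof.
have e : un kap S = mx3 1 S (S ^+ 2 / 2%:R + kap * S ^+ 3) 0 1 S 0 0 1.
  by apply: mx3_ext; apply: ord3P; rewrite /un !mulmx3E !mxE /=; ring.
by rewrite e !mulmx3E ![mx3 _ _ _ _ _ _ _ _ _ _ _]mxE /=; split; ring.
Qed.

Lemma dg_v2_normalizes (t b s : k) : t != 0 ->
  exists s', v1 s' *m (dg t *m v2 b) = (dg t *m v2 b) *m v1 s.
Proof.
by move=> t0; exists (t * s); rewrite mulmxA -dg_v1 // -!mulmxA v1v2.
Qed.

(** The limit of the lower right entry of [g *m un kap (s / th)], where [r] collects the rescaled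
    entries of the third row. *)
Definition rho (r : nat -> k) s := 1 + r 0%N * s + r 1%N * s ^+ 2 / 2%:R.

(** As 2 and 4 are invertible, the excluded combination says that [rho r] is 1 and that the
    derivative of [curve l] vanishes identically. The returns of [M] to itself are pushed along
    [un], and [unipotent_section] turns the limits of the invariants into a limit of
    displacements. *)
Lemma main_curve : exists (r l : nat -> k),
  ~ [/\ r 0%N = 0 /\ r 1%N = 0, l 0%N = 0, l 1%N = 0, 3%:R * l 2%N = 0 &
        l 3%N = 0 /\ 5%:R * l 4%N = 0] /\
  forall s m, rho r s != 0 -> M m ->
    M (dg (rho r s)^-1 *m v2 (curve l s / 2%:R) *m m).
Proof.
have four0 : (4%:R : k) != 0 by rewrite -[4%N]/(2 * 2)%N natrM mulf_neq0.
have ret (n : nat) : exists mg : M3 * M3, [/\ M mg.1, \det mg.2 = 1, near n%:Z mg.2 1%:M,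
    M (mg.2 *m mg.1) & ~ [/\ mg.2 o1 o0 = 0, mg.2 o2 o0 = 0 & mg.2 o2 o1 = 0]].
  by have [m [g h]] := returns n%:Z; exists (m, g).
have [mg hmg] := choice ret.
pose g n := (mg n).2.
have dg1 n : \det (g n) = 1 by case: (hmg n).
have glim : mlim g 1%:M by apply: near_lim => // n; case: (hmg n).
have G : mlim (fun n => gram (g n)) (mxJ k).
  have -> : mxJ k = gram 1%:M by rewrite /gram trmx1 mul1mx mulmx1.
  by apply: mlimM => //; apply: mlimM; [by []|exact: mlim_tr|exact: mlim_cst].
have [kap hkap] := choice (fun n => cubic_minimizer (gram (g n) o0 o1) (2%:R * gram (g n) o0 o2)).
pose W n := gram (g n) o0 o1 + 2%:R * gram (g n) o0 o2 * kap n.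
have c00 := G o0 o0; have c01 := G o0 o1; have c02 := G o0 o2.
have c11 := G o1 o1; have c12 := G o1 o2; rewrite !mxE /= in c00 c01 c02 c11 c12.
have r20 := glim o2 o0; have r21 := glim o2 o1; have r22 := glim o2 o2.
rewrite !mxE /= in r20 r21 r22.
have hW : lim W 0.
  move=> n; have [N hN] := c01 n; exists N => q /hN; rewrite !subr0 => h.
  case: (hkap q) => _; apply; [exact: cubic0|by rewrite mulr0 addr0].
have [N2 u02] := lim_unit dw c02 (oner_neq0 _).
have hk0 : lim kap 0.
  apply: (lim_eventually (u := fun n => (W n - gram (g n) o0 o1) * (gram (g n) o0 o2)^-1 / 2%:R)).
    exists N2 => n /u02 [h _]; rewrite /W; field; by rewrite h two0.
  have ic := limV dw c02 (oner_neq0 _); lim_tac dw; ring.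
have k3 n : 3%:R * kap n = 0 by case: (hkap n) => -[].
pose cf (i : nat) n := match i with
  | 0 => 2%:R * gram (g n) o1 o2 | 1 => gram (g n) o0 o2 + gram (g n) o1 o1
  | 2 => W n | 3 => gram (g n) o0 o0 / 4%:R + 2%:R * gram (g n) o0 o1 * kap n
  | 4 => gram (g n) o0 o0 * kap n | 5 => g n o2 o1 | _ => g n o2 o0 end.
(* The entries [o2 o1] and [o2 o0] get weights 1 and 2 because [un_row3] multiplies them by the
   parameter and by its square to leading order. *)
pose wt (i : nat) := match i with 5 => 1%N | 6 => 2%N | i => i.+1 end.
have [||n|phi [j [l [hphi hj Vl hl [i0 li0]]]]] :=
    @rescale 7 (fun i n => cf i n) (fun i => wt i).
- by case=> [[|[|[|[|[|[|[|//]]]]]]] hi].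
- by case=> [[|[|[|[|[|[|[|//]]]]]]] hi] /=; lim_tac dw; ring.
(* If everything vanished, so would the entries of [g n] at [o2 o0] and [o2 o1], and the Gram entry
   at [o0 o0] would reduce to minus the square of the entry at [o1 o0]. [returns] excludes that
   these three vanish. *)
- apply: contrapT => nex; case: (hmg n) => _ _ _ _; apply.
  have z (i : nat) (hi : (i < 7)%N) : cf i n = 0.
    by apply/eqP; apply: contrapT => h; apply: nex; exists (Ordinal hi); apply/negP.
  have z5 : g n o2 o1 = 0 := z 5%N isT; have z6 : g n o2 o0 = 0 := z 6%N isT.
  have z3 : gram (g n) o0 o0 / 4%:R + 2%:R * gram (g n) o0 o1 * kap n = 0 := z 3%N isT.
  have z4 : gram (g n) o0 o0 * kap n = 0 := z 4%N isT.
  have a0 : gram (g n) o0 o0 = 0.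
    move/eqP: z4; rewrite mulf_eq0 => /orP [/eqP //|/eqP kn].
    by move/eqP: z3; rewrite kn mulr0 addr0 mulf_eq0 invr_eq0 (negPf four0) orbF => /eqP.
  split=> //; move/eqP: a0; rewrite gramE -/(g n) z6 mulr0 mul0r addr0 sub0r oppr_eq0.
  by rewrite mulf_eq0 orbb => /eqP.
have [hth th0] := uniformizer_theta hj.
pose th n := pi ^+ j n; rewrite -/th in hth.
have thn0 n : th n != 0 by exact: th0.
have hV i n (hi : (i < 7)%N) : V 0 (cf i (phi n) / th n ^+ wt i).
  exact: (Vl (Ordinal hi) n).
pose l' i := l (inord i).
have hl' i (hi : (i < 7)%N) : lim (fun n => cf i (phi n) / th n ^+ wt i) (l' i).
  by rewrite /l'; have := hl (inord i); rewrite inordK.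
(* The square of [kap / th] is [th] times [kap ^+ 2 / th ^+ 3], which is integral by
   [kappa_small]. *)
have kt0 : lim (fun n => kap (phi n) / th n) 0.
  apply: lim0_sqr => //.
  apply: (lim_ext (u := fun n => th n * (kap (phi n) ^+ 2 / th n ^+ 3))) => [n|].
    by field; rewrite thn0.
  apply: lim_squeeze => //.
  have [N3 h3] := hj 1%N.
  exists (maxn N2 N3) => n; rewrite geq_max => /andP [n2 /h3 n3].
  have [c0 wc] := u02 _ (leq_trans n2 (hphi n)).
  apply: (@kappa_small _ (gram (g (phi n)) o0 o0) (gram (g (phi n)) o0 o1)
    (gram (g (phi n)) o0 o2)) => //.
  - by rewrite dvalX // wpi; lia.
  - by rewrite wc dval1.
  - exact: (hV 2%N n isT).
  - exact: (hV 3%N n isT).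
  - exact: (hV 4%N n isT).
have hlim := @gram_limit (fun n => g (phi n)) (fun n => kap (phi n)) th l'
  (mlim_sub hphi G) thn0 hth (fun n => k3 (phi n)) kt0 (hl' 0%N isT) (hl' 1%N isT)
  (hl' 2%N isT) (hl' 3%N isT) (hl' 4%N isT).
pose r i := l' (5 + i)%N.
have h5 : lim (fun n => g (phi n) o2 o1 / th n ^+ 1) (r 0%N) by exact: (hl' 5%N isT).
have h6 : lim (fun n => g (phi n) o2 o0 / th n ^+ 2) (r 1%N) by exact: (hl' 6%N isT).
have curveM s m : rho r s != 0 -> M m -> M (dg (rho r s)^-1 *m v2 (curve l' s / 2%:R) *m m).
  move=> rho0 Mm; set t := rho r s in rho0 *; set f := curve l' s / 2%:R.
  pose q n := g (phi n) *m un (kap (phi n)) (s / th n).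
  pose g0 := dg t^-1 *m v2 f.
  have t0 : t^-1 != 0 by rewrite invr_eq0.
  have dq n : \det (q n) = 1 by rewrite det_mulmx det_un dg1 mulr1.
  have dg0 : \det g0 = 1 by rewrite det_mulmx det_dg // det_v2 mulr1.
  have row3 : forall i, lim (fun n => q n o2 i) (g0 o2 i).
    have s20 := lim_sub hphi r20; have s21 := lim_sub hphi r21; have s22 := lim_sub hphi r22.
    apply: ord3P; rewrite mulmx3E !mxE /=.
    - apply: (lim_ext (u := fun n => g (phi n) o2 o0)).
        by move=> n; case: (un_row3 (g (phi n)) (kap (phi n)) (s / th n)).
      by lim_tac dw; ring.
    - apply: (lim_ext (u := fun n => (g (phi n) o2 o0 / th n ^+ 2) * th n * s + g (phi n) o2 o1)).
        move=> n; case: (un_row3 (g (phi n)) (kap (phi n)) (s / th n)) => _ -> _.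
        by field; rewrite thn0.
      by lim_tac dw; ring.
    - apply: (lim_ext (u := fun n => (g (phi n) o2 o0 / th n ^+ 2) * (s ^+ 2 / 2%:R)
         + (g (phi n) o2 o0 / th n ^+ 2) * (kap (phi n) / th n) * s ^+ 3
         + (g (phi n) o2 o1 / th n ^+ 1) * s + g (phi n) o2 o2)).
        move=> n; case: (un_row3 (g (phi n)) (kap (phi n)) (s / th n)) => _ _ ->.
        by field; rewrite thn0 two0.
      by lim_tac dw; rewrite invrK /t /rho; ring.
  have [s' hs'] : exists s' : nat -> k, mlim (fun n => v1 (s' n) *m q n) g0.
    apply: (unipotent_section dw two0) => //.
    have -> : gram g0 = gram (v2 f) by rewrite inH_gram //; exact: inH_dg.
    exact: hlim.
  (* The inverse of [un] applied to the returning point; it stays in [M] because [kap] satisfies the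
     cubic invariance. *)
  pose mm n := v2 (kap (phi n) * (- (s / th n)) ^+ 3) *m v1 (- (s / th n)) *m (mg (phi n)).1.
  have Mmm n : M (mm n).
    rewrite /mm -mulmxA; case: (hkap (phi n)) => -[_ h] _; apply: h; apply: Mv.
    by case: (hmg (phi n)).
  have [||m' [Mm' Mgm']] := limit_in_closed Mc Ml _ _ hs' Mc Ml Mmm.
  - by move=> n; exact: MY.
  - move=> n; rewrite -mulmxA; apply: Mv; rewrite /q /mm mulmxA -(mulmxA (g (phi n))).
    by rewrite un_inv mulmx1; case: (hmg (phi n)).
  by apply: (normalizer_sub _ _ _ _ Mm' Mgm') => // s1; exact: dg_v2_normalizes.
exists r, l'; split; last exact: curveM.
move=> [[ra rb] la lb l3 [ld l5]].
have nz : l' i0 != 0 by rewrite /l' inord_val.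
(* In characteristic 3 the number 5 is invertible; in any other characteristic [kap] is 0, hence so
   is this limit. *)
have le0 : l' 4%N = 0.
  have [three0|three0] := eqVneq (3%:R : k) 0.
    have five0 : (5%:R : k) != 0.
      have -> : (5%:R : k) = 3%:R + 2%:R by rewrite -natrD.
      by rewrite three0 add0r.
    by move/eqP: l5; rewrite mulf_eq0 (negPf five0) => /eqP.
  apply: (lim_unique dw (hl' 4%N isT)); apply: (lim_ext (u := fun=> 0)); last exact: lim_cst.
  move=> n /=; have /eqP := k3 (phi n); rewrite mulf_eq0 (negPf three0) => /eqP ->.
  by rewrite mulr0 mul0r.
have l2 : l' 2%N != 0.
  apply: contra nz => /eqP l2; apply/eqP.
  case: (i0) => [[|[|[|[|[|[|[|//]]]]]]] hi] //=.
have rho1 s : rho r s = 1 by rewrite /rho ra rb; ring.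
have curve3 s : curve l' s = l' 2%N * s ^+ 3 by rewrite /curve la lb ld le0; ring.
(* Now [rho] is 1 and the curve is a multiple of [s ^+ 3], so the limiting motions are exactly those
   of the cubic invariance. *)
have L2 : L (l' 2%N / 2%:R).
  split; first by rewrite mulrA l3 mul0r.
  move=> s m Mm; have := curveM s m; rewrite rho1 invr1 curve3.
  have -> : dg 1 = 1%:M :> M3 by apply: mx3_ext; apply: ord3P; rewrite !mxE /= ?invr1.
  by rewrite mul1mx oner_neq0 mulrAC; apply.
case/eqP: l2; apply: (lim_unique dw (hl' 2%N isT)) => /= n.
(* Subtracting [l' 2 / 2 * th ^+ 3] from [kap] is admissible and replaces [W] by [W' * th ^+ 3].
   Optimality of [kap] bounds [W / th ^+ 3] by [W'], which tends to 0, so that [l' 2] is 0. *)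
pose W' q := W (phi q) / th q ^+ 3 - gram (g (phi q)) o0 o2 * l' 2%N.
have hW' : lim W' 0.
  have h2 := hl' 2%N isT; rewrite /= in h2; have s02 := lim_sub hphi c02.
  by rewrite /W'; lim_tac dw; ring.
have [N hN] := hW' n; exists N => q /hN; rewrite !subr0 => hq.
have wth : w (th q ^+ 3) = w (th q) + w (th q) + w (th q) by rewrite dvalX //; lia.
have th3 : th q ^+ 3 != 0 by rewrite expf_neq0.
rewrite -(subrK (w (th q ^+ 3)) n) addrAC; apply: ge_valM => //; last first.
  by right; rewrite dvalV.
rewrite /W; case: (hkap (phi q)) => Lk; apply.
  by apply: (cubicD Lk (cubicZ (-1) (cubicZ (th q) L2))).
have -> : gram (g (phi q)) o0 o1 + 2%:R * gram (g (phi q)) o0 o2 *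
   (kap (phi q) + l' 2%N / 2%:R * th q ^+ 3 * (-1) ^+ 3) = W' q * th q ^+ 3.
  by rewrite /W' /W; field; rewrite thn0 two0.
by apply: ge_valM => //; right.
Qed.

Definition rho_poly (r : nat -> k) : {poly k} :=
  \poly_(i < 3) (match i with 0 => 1 | 1 => r 0%N | _ => r 1%N / 2%:R end).

Lemma rho_polyE r s : (rho_poly r).[s] = rho r s.
Proof.
rewrite horner_poly !big_ord_recl big_ord0 /rho /= /bump /=; ring.
Qed.

(** If the derivative of [P] vanished identically both for [f' = 0] and for [f' = f], then so would
    that of the curve, and then that of [rho ^+ 2], hence of [rho]; reading off coefficients gives
    the excluded combination. *)
Lemma noncritical_point (r l : nat -> k) (f : k) : f != 0 ->
  ~ [/\ r 0%N = 0 /\ r 1%N = 0, l 0%N = 0, l 1%N = 0, 3%:R * l 2%N = 0 &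
        l 3%N = 0 /\ 5%:R * l 4%N = 0] ->
  exists (P : {poly k}) s f', [/\ f' = 0 \/ f' = f,
    forall x, P.[x] = rho r x ^+ 2 * f' + curve l x / 2%:R, rho r s != 0 & P^`().[s] != 0].
Proof.
move=> f0; apply: contra_notP => nex.
pose P f' := f' *: rho_poly r ^+ 2 + 2%:R^-1 *: curve_poly l.
have PE f' x : (P f').[x] = rho r x ^+ 2 * f' + curve l x / 2%:R.
  by rewrite /P hornerD !hornerZ horner_exp rho_polyE curve_polyE; ring.
have rp0 : rho_poly r != 0.
  apply/eqP => /polyP /(_ 0%N); rewrite coef_poly coef0 /= => /eqP; by rewrite oner_eq0.
have dP f' : f' = 0 \/ f' = f -> (P f')^`() = 0.
  move=> hf'; apply/eqP; apply: contrapT => /negP h.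
  have [s] := exists_nonroot (mulf_neq0 rp0 h).
  rewrite hornerM mulf_eq0 negb_or rho_polyE => /andP [h1 h2].
  by apply: nex; exists (P f'), s, f'; split=> //; exact: PE.
have dc : (curve_poly l)^`() = 0.
  have := dP 0 (or_introl erefl); rewrite /P scale0r add0r derivZ => /eqP.
  by rewrite scaler_eq0 invr_eq0 (negPf two0) => /eqP.
have dr : (rho_poly r)^`() = 0.
  have := dP f (or_intror erefl); rewrite /P derivD !derivZ dc scaler0 addr0 => /eqP.
  rewrite scaler_eq0 (negPf f0) /= expr2 derivM [rho_poly r * _]mulrC -mulr2n -mulr_natl.
  by rewrite !mulf_eq0 (negPf rp0) orbF -polyC_natr polyC_eq0 (negPf two0) => /eqP.
have cl i : (curve_poly l)`_i.+1 *+ i.+1 = 0 by rewrite -coef_deriv dc coef0.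
have rl i : (rho_poly r)`_i.+1 *+ i.+1 = 0 by rewrite -coef_deriv dr coef0.
have nat0 n x : (n%:R : k) != 0 -> x *+ n = 0 -> x = 0 :> k.
  by move=> n0 /eqP; rewrite -mulr_natl mulf_eq0 (negPf n0) => /eqP.
have four0 : (4%:R : k) != 0 by rewrite -[4%N]/(2 * 2)%N natrM mulf_neq0.
have := cl 0%N; have := cl 1%N; have := cl 2%N; have := cl 3%N; have := cl 4%N.
have := rl 0%N; have := rl 1%N; rewrite !coef_poly /= !mulr1n.
move=> /(nat0 _ _ two0) /eqP; rewrite mulf_eq0 invr_eq0 (negPf two0) orbF => /eqP -> ->.
move=> l5 /(nat0 _ _ four0) -> l3 /(nat0 _ _ two0) -> ->.
by split=> //; [rewrite mulr_natl|split=> //; rewrite mulr_natl].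
Qed.

(** Conjugation by [dg] merges the two translations into [v2 P.[x]], which sends [m] into [Y]. Near
    a noncritical point [s], expansion by [dg] straightens this curve into a full [v2]-orbit. *)
Lemma translate_curve_orbit (f : k) : f != 0 -> (forall m, M m -> Y (v2 f *m m)) ->
  exists L, forall x, Y (v2 x *m L).
Proof.
move=> f0 hf; have [r [l [nontriv curveM]]] := main_curve.
have [P [s [f' [hf' PE rs0 dP0]]]] := noncritical_point f0 nontriv.
have [m Mm] := Mn.
have YP x : rho r x != 0 -> Y (v2 P.[x] *m m).
  move=> rx; have Mx := curveM x m rx Mm.
  have Yf : Y (v2 f' *m (dg (rho r x)^-1 *m v2 (curve l x / 2%:R) *m m)).
    by case: hf' => ->; [rewrite v20 mul1mx; exact: MY|exact: hf].
  have := YH (inH_dg rx) Yf; rewrite !mulmxA dg_v2 // -(mulmxA (v2 _)) dgV // mulmx1 v2D.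
  by rewrite PE.
have [d [hd d0]] := horner_increment P s.
pose th (n : nat) := pi ^+ n; pose t n := (th n)^-1.
have th0 n : th n != 0 by rewrite expf_neq0.
have t0 n : t n != 0 by rewrite invr_eq0.
have [|phi [c [L [hphi lc hL YL]]]] := @seq_compact (fun n => dg (t n) *m (v2 P.[s] *m m)).
  by move=> n; apply: YH; [exact: inH_dg|exact: YP].
exists L => x.
(* The expansion of [v2] by [th ^- 2] turns the first order effect of the increment [e n] into [x];
   with the higher order terms it becomes [x_ n], which tends to [x]. *)
pose e n := x * th (phi n) ^+ 2 / P^`().[s].
have hth : lim (fun n => th (phi n)) 0.
  by apply: lim_uniformizer => J; exists J => n hn; exact: leq_trans hn (hphi n).
have he : lim e 0 by rewrite /e; lim_tac dw; ring.
have [N hN] : exists N, forall n, (N <= n)%N -> rho r (s + e n) != 0.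
  have h : lim (fun n => (rho_poly r).[s + e n]) (rho r s).
    by rewrite -rho_polyE; apply: lim_horner => //; lim_tac dw; ring.
  by have [N hN] := lim_unit dw h rs0; exists N => n /hN []; rewrite rho_polyE.
pose x_ n := x / P^`().[s] * d.[e n].
have hx : lim x_ x.
  have hde : lim (fun n => d.[e n]) d.[0] by exact: lim_horner.
  by rewrite /x_; lim_tac dw; rewrite d0; field.
apply: (Yclosed (U := fun n => v2 (x_ (n + N)%N) *m
    (dg (t (phi (n + N)%N)) *m (v2 P.[s] *m m) *m c (n + N)%N))); last first.
  apply: mlimM => //; last first.
    by apply: (mlim_sub (phi := fun n => (n + N)%N) _ hL) => n; exact: leq_addr.
  have hx' : lim (fun n => x_ (n + N)%N) x.
    by apply: (lim_sub (phi := fun n => (n + N)%N) _ hx) => n; exact: leq_addr.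
  rewrite /mlim; apply: ord3P; apply: ord3P; rewrite !mxE /=;
    (apply: lim_ext => [n|]; [by rewrite mxE /=|]) => //; exact: lim_cst.
move=> n; rewrite mulmxA; apply: Ylat => //; set q := (n + N)%N.
have rq : rho r (s + e q) != 0 by apply: hN; exact: leq_addl.
have := YH (inH_dg (t0 (phi q))) (YP _ rq).
rewrite mulmxA dg_v2 // hd.
have -> : t (phi q) ^+ 2 * (P.[s] + e q * d.[e q]) = x_ q + t (phi q) ^+ 2 * P.[s].
  by rewrite /x_ /e /t; field; rewrite th0 dP0.
by rewrite (mulmxA (dg _)) dg_v2 // !mulmxA v2D.
Qed.

End MinimalSet.

(* The group of all [v1 a *m v2 b] moves a column of [L] onto the line spanned by the last
   basis vector, which [dg t] contracts: arbitrarily short vectors contradict compactness. *)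
Lemma no_v2_orbit (L : M3) : (forall x, Y (v2 x *m L)) -> False.
Proof.
move=> YvL; have YL : Y L by have := YvL 0; rewrite v20 mul1mx.
have [j zj] : exists j, L o2 j != 0.
  apply: contrapT => nex.
  have z j : L o2 j = 0 by apply/eqP; apply: contrapT => h; apply: nex; exists j; apply/negP.
  by have := Ydet0 YL; rewrite det3 !z !mulr0 !subrr !mulr0 subrr addr0 eqxx.
pose z0 := L o0 j; pose z1 := L o1 j; pose z2 := L o2 j.
have z20 : z2 != 0 by [].
(* Chosen so that the first two entries of column [j] of [g] vanish. *)
pose a := - z1 / z2; pose b := - (z0 + a * z1 + a ^+ 2 / 2%:R * z2) / z2.
pose g := v1 a *m (v2 b *m L).
have Yg : Y g by apply: YH => //; exact: inH_v1.
have g0 : g o0 j = 0.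
  rewrite /g !mulmx3E !mxE /= -/z0 -/z1 -/z2 /b /a.
  by field; rewrite z20 two0.
have g1 : g o1 j = 0.
  rewrite /g !mulmx3E !mxE /= -/z0 -/z1 -/z2 /b /a.
  by field; rewrite z20.
clearbody g.
have [|phi [c [L' [hphi lc hL YL']]]] := @seq_compact (fun n => dg (pi ^- n) *m g).
  by move=> n; apply: YH => //; apply: inH_dg; rewrite invr_eq0 expf_neq0.
pose u n := dg (pi ^- phi n) *m g.
have hi := mlim_inv dw (Ydet0 YL') hL; rewrite -/u in hi.
have hth : lim (fun n => pi ^+ phi n) 0.
  by apply: lim_uniformizer => J; exists J => n hn; exact: leq_trans hn (hphi n).
(* Column [j] of [u n] tends to 0 and the inverses of [u n *m c n] converge, so column [j] of the
   lattice matrix [invmx (c n)] tends to 0; by discreteness it eventually vanishes, against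
   determinant 1. *)
have cE n : invmx (c n) = invmx (u n *m c n) *m u n.
  have uu : u n \in unitmx.
    by apply: Yunit; apply: YH => //; apply: inH_dg; rewrite invr_eq0 expf_neq0.
  by rewrite invmx_mul //; [rewrite mulmxKV|exact: lat_unit].
have ucol n : [/\ u n o0 j = 0, u n o1 j = 0 & u n o2 j = pi ^+ phi n * g o2 j].
  by rewrite /u !mulmx3E ![dg _ _ _]mxE /= g0 g1 invrK; split; ring.
have hcol i : lim (fun n => invmx (c n) i j) 0.
  have hi2 := hi i o2.
  apply: (lim_ext (u := fun n => invmx (u n *m c n) i o2 * (pi ^+ phi n * g o2 j))).
    by move=> n; rewrite [in RHS]cE mulmx3E; case: (ucol n) => -> -> ->; ring.
  by lim_tac dw; ring.
have [N0 h0] := hcol o0 1; have [N1 h1] := hcol o1 1; have [N2 h2] := hcol o2 1.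
pose n := maxn N0 (maxn N1 N2).
have lcn := latV (lc n).
have zero i : V 1 (invmx (c n) i j) -> invmx (c n) i j = 0.
  by apply: O_discrete; case: lcn.
have {}h0 : invmx (c n) o0 j = 0.
  by apply: zero; rewrite -[X in V _ X]subr0; apply: h0; rewrite leq_max leqnn.
have {}h1 : invmx (c n) o1 j = 0.
  by apply: zero; rewrite -[X in V _ X]subr0; apply: h1; rewrite !leq_max leqnn orbT.
have {}h2 : invmx (c n) o2 j = 0.
  by apply: zero; rewrite -[X in V _ X]subr0; apply: h2; rewrite !leq_max leqnn !orbT.
case: lcn => + _; rewrite (expand_det_col _ j) sum3 h0 h1 h2 !mul0r !addr0 => /eqP.
by rewrite eq_sym oner_eq0.
Qed.

(** The minimal set is taken inside [Y1], at whose points [Y] is known to accumulate transversally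
    to the orbits of the isometry group. *)
Lemma no_transverse_set (Y1 : M3 -> Prop) : (forall g, Y1 g -> Y g) ->
  (exists g, Y1 g) -> seq_closed Y1 -> lat_inv Y1 ->
  (forall h g, inH h -> Y1 g -> Y1 (h *m g)) ->
  (forall m, Y1 m -> forall N, exists g,
     [/\ \det g = 1, near N g 1%:M, ~ inH g & Y (g *m m)]) -> False.
Proof.
move=> sub Y1n Y1c Y1l Y1H tr.
have [|M [MY1 Mn [Mc Ml Mv] Mmin]] := minimal_set sub Y1n Y1c Y1l.
  by move=> g s; apply: Y1H; exact: inH_v1.
have MY g : M g -> Y g by move=> /MY1 /sub.
have [m0 Mm0] := Mn.
have [f [f0 hf]] := transverse_translate MY Mc Ml Mv Mmin Mm0 (tr _ (MY1 _ Mm0)).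
have [L hL] := translate_curve_orbit MY Mn Mc Ml Mv Mmin f0 hf.
exact: no_v2_orbit hL.
Qed.

End Lattices.

(** * Orbits and their closures *)

Section QuadraticForms.
Variables (k : fieldType) (A : 'M[k]_3).
Hypotheses (two0 : (2%:R : k) != 0) (Asym : A^T = A) (Adet : \det A != 0).

Definition bform (B : 'M[k]_3) (x y : 'cV[k]_3) := (x^T *m B *m y) 0 0.

Lemma bformD B x x' y : bform B (x + x') y = bform B x y + bform B x' y.
Proof. by rewrite /bform linearD /= !mulmxDl mxE. Qed.
Lemma bformZ B a x y : bform B (a *: x) y = a * bform B x y.
Proof. by rewrite /bform linearZ /= -!scalemxAl mxE. Qed.
Lemma bform_sym B x y : B^T = B -> bform B x y = bform B y x.
Proof.
move=> sB; rewrite /bform.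
have -> : (x^T *m B *m y) 0 0 = (x^T *m B *m y)^T 0 0 by rewrite [RHS]mxE.
by rewrite !trmx_mul trmxK sB mulmxA.
Qed.

Lemma bform_col B (P : 'M[k]_3) i j : (P^T *m B *m P) i j = bform B (col i P) (col j P).
Proof.
rewrite /bform !mxE; apply: eq_bigr => l _; rewrite !mxE; congr (_ * _).
by apply: eq_bigr => q _; rewrite !mxE.
Qed.

Lemma bform_polar B x y : B^T = B ->
  2%:R * bform B x y = qf B (x + y) - qf B x - qf B y.
Proof.
move=> sB; rewrite -[qf B (x + y)]/(bform B (x + y) (x + y)) -[qf B x]/(bform B x x).
rewrite -[qf B y]/(bform B y y) bformD ![bform B _ (x + y)]bform_sym // !bformD.
rewrite (bform_sym _ _ sB : bform B y x = _); ring.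
Qed.

(** Polarization: in characteristic other than 2 a symmetric matrix is determined by the values of
    its quadratic form. *)
Lemma HQ_gram h : H_Q A h <-> \det h = 1 /\ h^T *m A *m h = A.
Proof.
have qfh z : qf A (h *m z) = qf (h^T *m A *m h) z.
  by rewrite /qf trmx_mul !mulmxA.
split=> [[dh hq]|[dh hA]]; split=> //; last by move=> z; rewrite qfh hA.
have sB : (h^T *m A *m h)^T = h^T *m A *m h by rewrite !trmx_mul trmxK Asym mulmxA.
apply/matrixP => i j.
have e (B : 'M[k]_3) : B i j = bform B (col i 1%:M) (col j 1%:M).
  by rewrite -bform_col trmx1 mul1mx mulmx1.
by rewrite (e A) (e (_ *m h)); apply: (mulfI two0); rewrite !bform_polar // -!qfh !hq.
Qed.

(** The isotropic vector is completed to a hyperbolic pair [z], [y], and then by a vector [u]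
    orthogonal to both. *)
Lemma isotropic_normal_form : isotropic A ->
  exists (P : 'M[k]_3) (c : k), [/\ \det P != 0, c != 0 & P^T *m A *m P = c *: mxJ k].
Proof.
move=> [z [z0 qz]]; have uA := unit_det Adet.
have [y0 hy0] : exists y, bform A z y != 0.
  apply: contrapT => nex; case/eqP: z0.
  have h : z^T *m A = 0.
    apply/rowP => i; rewrite [RHS]mxE; apply/eqP; apply: contrapT => /negP h; apply: nex.
    exists (delta_mx i 0); rewrite /bform -colE mxE //.
  by apply: trmx_inj; rewrite trmx0 -[LHS](mulmxK uA) h mul0mx.
pose y1 := (bform A z y0)^-1 *: y0.
have bzy1 : bform A y1 z = 1 by rewrite /y1 bformZ (bform_sym y0 z) // mulVf.
clearbody y1; have bzz : bform A z z = 0 := qz.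
(* Subtracting half of the value at [y1] times [z] makes [y] isotropic without changing its product
   with [z]. *)
pose y := y1 + (- (bform A y1 y1 / 2%:R)) *: z.
have byz : bform A y z = 1 by rewrite /y bformD bformZ bzz bzy1; ring.
have byy : bform A y y = 0.
  rewrite {1}/y bformD bformZ (bform_sym z y) // byz (bform_sym y1 y) // /y bformD bformZ.
  by rewrite (bform_sym z y1) // bzy1; field.
clearbody y.
(* A matrix with 3 rows and 2 columns has a nonzero left kernel; it provides [u]. *)
pose D : 'M[k]_(3, 2) := A *m row_mx z y.
have [i ui0] : exists i, row i (kermx D) != 0.
  apply: contrapT => nex.
  have : kermx D = 0.
    apply/row_matrixP => i; rewrite row0; apply/eqP; apply: contrapT => h; apply: nex.
    by exists i; apply/negP.
  move=> /(congr1 (fun X => \rank X)); rewrite mxrank_ker mxrank0 => /eqP.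
  by rewrite subn_eq0 leqNgt ltnS rank_leq_col.
pose u : 'cV[k]_3 := (row i (kermx D))^T.
have u0 : u != 0 by apply: contra ui0 => /eqP h; rewrite -[row _ _]trmxK -/u h trmx0.
have huD : u^T *m A *m row_mx z y = 0.
  by rewrite trmxK -mulmxA -row_mul mulmx_ker row0.
have [buz buy] : bform A u z = 0 /\ bform A u y = 0.
  move: huD; rewrite mul_mx_row => /eqP; rewrite -row_mx0 => /eqP /eq_row_mx [h1 h2].
  by rewrite /bform h1 h2 !mxE.
pose Q a := \matrix_(r < 3, s < 3) (match val s with 0 => a * z r 0 | 1 => u r 0 | _ => y r 0 end).
have Q0 a : col o0 (Q a) = a *: z by apply/colP => r; rewrite !mxE.
have Q1 a : col o1 (Q a) = u by apply/colP => r; rewrite !mxE.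
have Q2 a : col o2 (Q a) = y by apply/colP => r; rewrite !mxE.
pose mu := bform A u u.
have QG a : (Q a)^T *m A *m Q a = mx3 0 0 a 0 mu 0 a 0 0.
  apply: mx3_ext; apply: ord3P; rewrite bform_col ?Q0 ?Q1 ?Q2 [RHS]mxE /=
    ?bformZ ?(bform_sym _ (_ *: z)) ?bformZ // ?(bform_sym z) // ?bzz ?buz ?byz ?buy ?byy
    ?mulr0 ?mulr1 //; by rewrite bform_sym.
have dQ a : a != 0 -> \det (Q a) != 0.
  move=> a0; apply/negP => /eqP dQ0.
  have /det0P [c c0 hc] : \det (Q a)^T == 0 by rewrite det_tr dQ0.
  have hc' : Q a *m c^T = 0 by rewrite -[LHS]trmxK trmx_mul trmxK hc trmx0.
  have : mx3 0 0 a 0 mu 0 a 0 0 *m c^T = 0 by rewrite -QG -mulmxA hc' mulmx0.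
  move=> /colP h; have := h o0; have := h o2; rewrite !mxE !sum3 !mxE /=.
  rewrite !mul0r !add0r !addr0 => /eqP; rewrite mulf_eq0 (negPf a0) /= => /eqP c00.
  move=> /eqP; rewrite mulf_eq0 (negPf a0) /= => /eqP c02.
  have c01 : c 0 o1 = 0.
    have hu : c 0 o1 *: u = 0.
      apply/colP => r; move/colP: hc' => /(_ r); rewrite !mxE sum3 !mxE /= c00 c02.
      by rewrite !mulr0 add0r addr0 mulrC.
    by move/eqP: hu; rewrite scaler_eq0 (negPf u0) orbF => /eqP.
  by case/eqP: c0; apply/rowP; apply: ord3P; rewrite mxE.
have mu0 : mu != 0.
  have : \det ((Q 1)^T *m A *m Q 1) != 0.
    by rewrite !det_mulmx det_tr !mulf_neq0 // dQ // oner_neq0.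
  by rewrite QG; apply: contra => /eqP ->; rewrite det3 !mxE /=; apply/eqP; ring.
(* Scaling [z] by [- mu] matches the hyperbolic plane with the value [mu] at [u], so that the form
   becomes [- mu] times [mxJ]. *)
exists (Q (- mu)), (- mu); rewrite dQ ?oppr_eq0 //; split=> //.
by rewrite QG; apply: mx3_ext; apply: ord3P; rewrite !mxE /=; ring.
Qed.
End QuadraticForms.

Section OrbitClosures.
Variables (k : fieldType) (w : k -> int) (O : k -> Prop) (delta : k).
Hypotheses (dw : is_dval w) (sO : subring O) (delta0 : delta != 0).
Local Notation M3 := 'M[k]_3.

(** The double coset of [b], which is the preimage among matrices of an orbit on lattices. *)
Definition in_lat_orbit (b g : M3) := exists h c, [/\ inH h, lat O c & g = h *m b *m c].

Definition orbit_closure (b g : M3) := \det g = delta /\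
  forall N, exists g', in_lat_orbit b g' /\ near w N g' g.

Lemma orbit_closureP b g : orbit_closure b g <-> \det g = delta /\
  exists U, (forall n : nat, in_lat_orbit b (U n)) /\ mlim w U g.
Proof.
split=> [[dg h]|[dg [U [hU hg]]]]; split=> //.
  have [U hU] := choice (fun n : nat => h n%:Z); exists U.
  by split=> [n|]; [case: (hU n)|apply: near_lim => // n; case: (hU n)].
by move=> N; have /mlim_near/(_ N) [n hn] := hg; exists (U n); split=> //; exact: hn.
Qed.

Lemma in_lat_orbit_det b g : \det b = delta -> in_lat_orbit b g -> \det g = delta.
Proof. by move=> db [h [c [[dh _] [dc _] ->]]]; rewrite !det_mulmx db dh dc mul1r mulr1. Qed.

Lemma in_lat_orbit_lat b g c : in_lat_orbit b g -> lat O c -> in_lat_orbit b (g *m c).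
Proof.
move=> [h [c' [hh lc' ->]]] lc; exists h, (c' *m c); split=> //; first exact: latM.
by rewrite !mulmxA.
Qed.

Lemma in_lat_orbit_H b g h : in_lat_orbit b g -> inH h -> in_lat_orbit b (h *m g).
Proof.
move=> [h' [c [hh' lc ->]]] hh; exists (h *m h'), c; split=> //; first exact: inHM.
by rewrite !mulmxA.
Qed.

Lemma in_lat_orbit_trans a b g : in_lat_orbit a b -> in_lat_orbit b g -> in_lat_orbit a g.
Proof.
by move=> hab [h [c [hh lc ->]]]; apply: in_lat_orbit_lat => //; exact: in_lat_orbit_H.
Qed.

Lemma in_lat_orbit_sym a b : in_lat_orbit a b -> in_lat_orbit b a.
Proof.
move=> [h [c [hh lc ->]]]; exists (invmx h), (invmx c); split; [exact: inHV|exact: latV|].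
by rewrite !mulmxA mulVmx ?inH_unit // mul1mx mulmxK //; exact: lat_unit lc.
Qed.

Lemma in_lat_orbit_refl b : in_lat_orbit b b.
Proof.
by exists 1%:M, 1%:M; split; [exact: inH1|exact: lat1|rewrite mul1mx mulmx1].
Qed.

Lemma orbit_in_closure b g : \det b = delta -> in_lat_orbit b g -> orbit_closure b g.
Proof.
move=> db hg; split; first exact: in_lat_orbit_det hg.
by move=> N; exists g; split=> //; exact: near_refl.
Qed.

Lemma orbit_closure_lat b : lat_inv O (orbit_closure b).
Proof.
move=> g c [dg hg] lc; split; first by case: lc => dc _; rewrite det_mulmx dg dc mulr1.
move=> N; have [N' hN'] := near_mulr dw 3 N c; have [g' [og' ng']] := hg N'.
by exists (g' *m c); split; [exact: in_lat_orbit_lat|exact: hN'].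
Qed.

Lemma orbit_closure_H b h g : inH h -> orbit_closure b g -> orbit_closure b (h *m g).
Proof.
move=> hh [dg hg]; split; first by case: hh => dh _; rewrite det_mulmx dg dh mul1r.
move=> N; have [N' hN'] := near_mull dw 3 N h; have [g' [og' ng']] := hg N'.
by exists (h *m g'); split; [exact: in_lat_orbit_H|exact: hN'].
Qed.

Lemma orbit_closure_closed b : seq_closed w (orbit_closure b).
Proof.
move=> U L hU hL; split.
  apply: (lim_unique dw (lim_det dw hL)); apply: (lim_ext (u := fun=> delta)); last exact: lim_cst.
  by move=> n; case: (hU n).
move=> N; have /mlim_near/(_ N) [n hn] := hL; case: (hU n) => _ /(_ N) [g' [og' ng']].
by exists g'; split=> //; apply: near_trans ng' _ => //; exact: hn.
Qed.

Lemma orbit_closure_trans a b g : orbit_closure a b -> orbit_closure b g -> orbit_closure a g.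
Proof.
move=> hab /orbit_closureP [dg [U [hU hg]]]; apply: (orbit_closure_closed _ hg) => n.
have [h [c [hh lc ->]]] := hU n.
by apply: orbit_closure_lat => //; exact: orbit_closure_H.
Qed.

(* Every point of the closure of the orbit of [b] is a limit of points of another orbit:
   of that of [b] if it lies in the orbit of [a], and of that of [a] otherwise. *)
Lemma orbit_closure_transverse a b : \det a = delta -> orbit_closure a b -> ~ in_lat_orbit a b ->
  forall m, orbit_closure b m -> forall N, exists g,
    [/\ \det g = 1, near w N g 1%:M, ~ inH g & orbit_closure a (g *m m)].
Proof.
move=> da hab nab m hbm N; have db : \det b = delta by case: hab.
have dm : \det m = delta by case: hbm.
have um : m \in unitmx by apply: unit_det; rewrite dm.
have [c [oc nc hac]] : exists c, [/\ orbit_closure c m, ~ in_lat_orbit c m &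
    forall g, in_lat_orbit c g -> orbit_closure a g].
  have [ham|nam] := pselect (in_lat_orbit a m).
    exists b; split=> //.
      by move=> hbm'; apply: nab; apply: in_lat_orbit_trans ham (in_lat_orbit_sym hbm').
    by move=> g hg; apply: orbit_closure_trans hab _; exact: orbit_in_closure.
  exists a; split=> //; first exact: orbit_closure_trans hab hbm.
  by move=> g; exact: orbit_in_closure.
have [N' hN'] := near_mulr dw 3 N (invmx m).
case: (oc) => _ /(_ N') [g' [og' ng']].
exists (g' *m invmx m); rewrite mulmxKV //; split.
- rewrite det_mulmx det_inv dm; case: (hac _ og') => -> _; exact: divff.
- by rewrite -(mulmxV um); exact: hN'.
- move=> hh; apply: nc; have := in_lat_orbit_H og' (inHV hh).
  by rewrite -[X in _ *m X](mulmxKV um g') mulmxA mulVmx ?mul1mx //; exact: inH_unit.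
- exact: hac.
Qed.

End OrbitClosures.

(** * Cosets and their representatives *)

Section Cosets.
Variables (K Kv : fieldType) (p : nat) (v : K -> int) (wv : Kv -> int).
Variable iota : {rmorphism K -> Kv}.
Hypotheses (gff : global_function_field K p) (dv : is_dval v).
Hypothesis compl : is_completion v wv iota.
Local Notation M3 := 'M[Kv]_3.
Local Notation X := (GmodGamma v iota).

Definition ints (x : Kv) := exists a, nu_integers v a /\ x = iota a.

Lemma ints_subring : subring ints.
Proof.
split.
- by exists 1; rewrite rmorph1; split=> // w dw _; exact: ge_val_1.
- move=> _ _ [a [ha ->]] [b [hb ->]]; exists (a - b); rewrite rmorphB.
  by split=> // w dw hw; apply: ge_valB => //; [exact: ha|exact: hb].
- move=> _ _ [a [ha ->]] [b [hb ->]]; exists (a * b); rewrite rmorphM.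
  by split=> // w dw hw; apply: ge_valMl => //; [exact: ha|exact: hb].
Qed.

Lemma ints_discrete x : ints x -> ge_val wv x 1 -> x = 0.
Proof.
move=> [a [ha ->]]; have [->|a0] := eqVneq a 0; first by rewrite rmorph0.
have := nu_integers_val gff dv ha a0; case: compl => _ hw _ _.
by rewrite ge_valE ?fmorph_eq0 // hw //; lia.
Qed.

(** As [p] is odd, the integer [(p + 1) / 2] is an inverse of 2, and integers have nonnegative
    valuation. *)
Lemma two_unit : p <> 2%N -> (2%:R : Kv) != 0 /\ ge_val wv (2%:R^-1) 0.
Proof.
move=> p2; case: gff => pp pK _; case: compl => dwv _ _ _.
have pKv : (p%:R : Kv) = 0 by rewrite -(rmorph_nat iota) pK rmorph0.
have podd : odd p by case: (even_prime pp).
have h : (2%:R : Kv) * (p.+1./2)%:R = 1.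
  have -> : (2%:R : Kv) * (p.+1./2)%:R = (p.+1)%:R.
    by rewrite -natrM mul2n -[in RHS](odd_double_half p.+1) /= podd add0n.
  by rewrite -natr1 pKv add0r.
have two0 : (2%:R : Kv) != 0.
  by apply/eqP => h2; move: h; rewrite h2 mul0r => /esym /eqP; rewrite oner_eq0.
split=> //; have -> : (2%:R : Kv)^-1 = (p.+1./2)%:R by apply: (mulfI two0); rewrite divff.
exact: ge_val_nat.
Qed.

Lemma class_det (y : X) g : sval y g -> \det g = 1.
Proof.
case: y => S /= [g0 [d0 ->]] [c [[dc _] ->]]; by rewrite det_mulmx d0 dc mulr1.
Qed.

Lemma coset_mulr g c : lat ints c -> coset v iota (g *m c) = coset v iota g.
Proof.
move=> lc; have sO := ints_subring; apply: funext => h; apply: propext; split.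
  by move=> [c' [lc' ->]]; exists (c *m c'); split; [exact: (latM sO)|rewrite mulmxA].
move=> [c' [lc' ->]]; exists (invmx c *m c').
split; first by apply: (latM sO) => //; exact: (latV sO).
by rewrite mulmxA mulmxK //; exact: lat_unit lc.
Qed.

Lemma class_ext (y : X) g : sval y g -> sval y = coset v iota g.
Proof. by case: y => S /= [g0 [d0 ->]] [c [lc ->]]; rewrite coset_mulr. Qed.

Lemma class_exists g : \det g = 1 -> exists y : X, sval y g.
Proof.
move=> dg; exists (exist _ (coset v iota g) (ex_intro _ g (conj dg erefl))).
by exists 1%:M; split; [exact: (lat1 ints_subring)|rewrite mulmx1].
Qed.

Lemma class_rep (y : X) : exists g, sval y g.
Proof.
case: y => S [g [dg e]] /=; have [y' y'g] := class_exists dg; exists g.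
by rewrite e -(class_ext y'g).
Qed.

Lemma class_lat (y : X) g c : sval y g -> lat ints c -> sval y (g *m c).
Proof. by move=> /class_ext -> lc; exists c. Qed.

Lemma class_same (y : X) g g' : sval y g -> sval y g' ->
  exists c, lat ints c /\ g' = g *m c.
Proof. by move=> /class_ext ->. Qed.

End Cosets.

(** * Transfer to the normal form of the quadratic form *)

Section Transfer.
Variables (K Kv : fieldType) (p : nat) (v : K -> int) (wv : Kv -> int).
Variable iota : {rmorphism K -> Kv}.
Hypotheses (gff : global_function_field K p) (p2 : p <> 2%N) (dv : is_dval v).
Hypothesis compl : is_completion v wv iota.
Local Notation M3 := 'M[Kv]_3.
Local Notation X := (GmodGamma v iota).
Local Notation ints := (ints v iota).
Variables (A P : M3) (c : Kv) (x : X) (g0 : M3).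
Hypotheses (Asym : A^T = A) (P0 : \det P != 0) (c0 : c != 0).
Hypothesis PA : P^T *m A *m P = c *: mxJ Kv.
Hypothesis xg0 : sval x g0.

Let dwv : is_dval wv. Proof. by case: compl. Qed.
Let two0 : (2%:R : Kv) != 0. Proof. by case: (two_unit gff compl p2). Qed.
Let sO : subring ints. Proof. exact: ints_subring. Qed.
Let uP : P \in unitmx. Proof. exact: unit_det. Qed.
Let delta := (\det P)^-1.
Let base := invmx P *m g0.
Local Notation C := (closureX wv (orbitX (H_Q A) x)).

Let delta0 : delta != 0. Proof. by rewrite invr_eq0. Qed.

Lemma det_pull g : \det (invmx P *m g) = delta <-> \det g = 1.
Proof.
rewrite det_mulmx det_inv -/delta; split=> [h|->]; last exact: mulr1.
by apply: (mulfI delta0); rewrite h mulr1.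
Qed.

Let base_det : \det base = delta. Proof. exact/det_pull/(class_det xg0). Qed.

(** Conjugation by [P] carries the isometries of [mxJ] to those of [A]; the scalar [c] cancels. *)
Lemma HQ_conj h : H_Q A (P *m h *m invmx P) <-> inH h.
Proof.
rewrite (HQ_gram two0 Asym) !det_mulmx det_inv mulrAC divff // mul1r.
have e : (P *m h *m invmx P)^T *m A *m (P *m h *m invmx P) =
    c *: ((invmx P)^T *m gram h *m invmx P).
  by rewrite scalemxAl scalemxAr /gram scalemxAl scalemxAr -PA !trmx_mul !mulmxA.
have A_E : A = c *: ((invmx P)^T *m mxJ Kv *m invmx P).
  rewrite scalemxAl scalemxAr -PA !mulmxA -trmx_mul mulmxV // trmx1 mul1mx.
  by rewrite mulmxK.
rewrite e A_E; split=> [[dh e']|[dh ->]] //; split=> //.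
move: e' => /(scalerI c0)/(congr1 (fun Z => P^T *m Z *m P)).
by rewrite !mulmxA -trmx_mul mulVmx // trmx1 !mul1mx !mulmxKV.
Qed.

Lemma orbit_link (y : X) g : sval y g ->
  orbitX (H_Q A) x y <-> in_lat_orbit ints base (invmx P *m g).
Proof.
move=> yg; split.
  move=> [h [g1 [Hh [xg1 yhg1]]]].
  have [c1 [lc1 e1]] := class_same xg0 xg1; have [c2 [lc2 e2]] := class_same yhg1 yg.
  exists (invmx P *m h *m P), (c1 *m c2); split; last first.
  - by rewrite e2 e1 /base -!mulmxA (mulmxA P) mulmxV // mul1mx.
  - exact: latM.
  - by apply/HQ_conj; rewrite !mulmxA mulmxV // mul1mx mulmxK.
move=> [h [c' [hh lc' e]]]; exists (P *m h *m invmx P), (g0 *m c'); split; first exact/HQ_conj.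
split; first exact: class_lat.
have -> : P *m h *m invmx P *m (g0 *m c') = g; last by [].
by rewrite -[RHS](mulKVmx uP) e /base !mulmxA.
Qed.

(** The classes with a representative close to [g] form an open set of the quotient; conversely, an
    open set around the class of [g] contains the classes of all matrices of determinant 1 close to
    [g]. *)
Lemma closure_link (y : X) g : sval y g -> C y <-> orbit_closure wv ints delta base (invmx P *m g).
Proof.
move=> yg; have dg := class_det yg; split.
  move=> Cy; split; first exact/det_pull.
  move=> N; have [N' hN'] := near_mull dwv 3 N (invmx P).
  pose U (y' : X) := exists g', sval y' g' /\ near wv N' g' g.
  have [||z [[g' [zg' ng']] oz]] := Cy U.
  - split; first by move=> g' [].
    move=> g1 [dg1 [y1 [[g' [y1g' ng']] y1g1]]].
    have [c1 [lc1 e1]] := class_same y1g1 y1g'.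
    have [n hn] := near_mulr dwv 3 N' c1; exists n => h dh nh; split=> //.
    have [yh yhh] := class_exists v iota dh; exists yh; split=> //.
    exists (h *m c1); split; first exact: class_lat.
    by apply: near_trans ng' => //; rewrite e1; exact: hn.
  - by exists g; split=> //; exact: near_refl.
  by exists (invmx P *m g'); split; [exact/(orbit_link zg')|exact: hN'].
move=> [_ hcl] U [_ oU] Uy.
have [|n hn] := oU g; first by split=> //; exists y.
have [N' hN'] := near_mull dwv 3 n P; have [g' [og' ng']] := hcl N'.
have dPg' : \det (P *m g') = 1.
  by apply/det_pull; rewrite mulKmx //; exact: in_lat_orbit_det base_det og'.
have [|_ [z [Uz zg']]] := hn _ dPg'.
  by rewrite -[g](mulKVmx uP); exact: hN'.
exists z; split=> //; apply/(orbit_link zg'); by rewrite mulKmx.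
Qed.

(** Relatively open sets invariant under the lattice group descend to open sets of the quotient, so
    covers can be transported. *)
Lemma compact_link : compactX wv C ->
  forall (I : Type) (U : I -> M3 -> Prop),
  (forall i, rel_open wv delta (U i)) -> (forall i, lat_inv ints (U i)) ->
  (forall g, orbit_closure wv ints delta base g -> exists i, U i g) ->
  exists (n : nat) (f : nat -> I),
    forall g, orbit_closure wv ints delta base g -> exists j, (j < n)%N /\ U (f j) g.
Proof.
move=> cC I U oU lU cov.
pose UX i (y : X) := exists g, sval y g /\ U i (invmx P *m g).
have UXE i y g : sval y g -> UX i y -> U i (invmx P *m g).
  move=> yg [g' [yg' Ug']]; have [c1 [lc1 ->]] := class_same yg' yg.
  by rewrite mulmxA; exact: lU.
have [i|y Cy|n [f hf]] := cC I UX.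
- split; first by move=> g [].
  move=> g [dg [y [Uy yg]]].
  have [||N hN] := oU i (invmx P *m g); [exact/det_pull|exact: UXE yg Uy|].
  have [n hn] := near_mull dwv 3 N (invmx P); exists n => h dh nh; split=> //.
  have [yh yhh] := class_exists v iota dh; exists yh; split=> //; exists h; split=> //.
  by apply: hN; [exact/det_pull|exact: hn].
- have [g yg] := class_rep y.
  have [i Ui] := cov _ ((closure_link yg).1 Cy); exists i, g; by split.
exists n, f => g hg.
have dPg : \det (P *m g) = 1 by apply/det_pull; rewrite mulKmx //; case: hg.
have [y yg] := class_exists v iota dPg.
have [|j [jn Uj]] := hf y; first by apply/(closure_link yg); rewrite mulKmx.
by exists j; split=> //; have := UXE _ _ _ yg Uj; rewrite mulKmx.
Qed.

End Transfer.

Theorem theorem2p1 (K : fieldType) (p : nat) (v : K -> int)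
    (Kv : fieldType) (wv : Kv -> int) (iota : {rmorphism K -> Kv})
    (A : 'M[Kv]_3) (x : GmodGamma v iota) :
  global_function_field K p -> p <> 2%N ->
  is_dval v -> is_completion v wv iota ->
  A^T = A -> \det A != 0 -> isotropic A ->
  compactX wv (closureX wv (orbitX (H_Q A) x)) ->
  forall y, orbitX (H_Q A) x y <-> closureX wv (orbitX (H_Q A) x) y.
Proof.
move=> gff p2 dv compl Asym Adet iso cC y; split.
  by move=> oy U _ Uy; exists y.
move=> Cy; apply: contrapT => noy.
have [two0 half] := two_unit gff compl p2.
have [P [c [P0 c0 PA]]] := isotropic_normal_form two0 Asym Adet iso.
have [g0 xg0] := class_rep x; have [g1 yg1] := class_rep y.
have sO := ints_subring v iota.
have [dwv _ _ complete] := compl.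
have [_ _ [pi [pi0 wpi]]] := dwv.
pose delta := (\det P)^-1; have delta0 : delta != 0 by rewrite invr_eq0.
pose a := invmx P *m g0; pose b := invmx P *m g1.
have hb := (closure_link gff p2 compl Asym P0 c0 PA xg0 yg1).1 Cy.
have da : \det a = delta by apply/det_pull => //; exact: class_det xg0.
have nab : ~ in_lat_orbit (ints v iota) a b.
  by move=> h; apply: noy; apply/(orbit_link gff p2 compl Asym P0 c0 PA xg0 yg1).
have cY := compact_link gff p2 compl Asym P0 c0 PA xg0 cC.
have db : \det b = delta by case: hb.
have Ya : orbit_closure wv (ints v iota) delta a a.
  by apply: orbit_in_closure => //; exact: in_lat_orbit_refl.
(* [Y] is the closure of the orbit of [a], and [Y1] the closure of the orbit of [b], a point of [Y]
   off the orbit of [a]. *)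
refine (@no_transverse_set _ _ dwv two0 _ sO (ints_discrete gff dv compl) delta _ delta0
  _ _ _ _ cY half complete pi pi0 wpi a Ya
  (orbit_closure wv (ints v iota) delta b) _ _ _ _ _ _).
- by move=> g [].
- by move=> g q; exact: orbit_closure_lat.
- by move=> h g; exact: orbit_closure_H.
- exact: orbit_closure_closed.
- by move=> g; exact: orbit_closure_trans.
- by exists b; apply: orbit_in_closure => //; exact: in_lat_orbit_refl.
- exact: orbit_closure_closed.
- by move=> g q; exact: orbit_closure_lat.
- by move=> h g; exact: orbit_closure_H.
- exact: orbit_closure_transverse.
Qed.
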